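(* Let $G$ be a second countable locally compact Hausdorff group with Haar measure $\mu$, let $B$ be a $G$-$C^*$-algebra, and let $\ell : G \to \mathbb{R}_{\geq 0}$ be a Borel-measurable length function with $\ell(g) = \ell(g^{-1})$ for all $g \in G$. Let $V_\ell^\infty(G,B) \subset C_r^*(G,B)$ be the associated space, with its topology, as defined in the context. (a) $V_\ell^\infty(G,B)$ is a Fréchet algebra containing $C_c(G,B)$. (b) The inclusion $V_\ell^\infty(G,B) \to C_r^*(G,B)$ is continuous, with dense image. (c) The set of invertible elements in the unitization $V_\ell^\infty(G,B)^+$ is open, and inversion is a continuous map from this set to itself. (d) An element of $V_\ell^\infty(G,B)^+$ is invertible (in $V_\ell^\infty(G,B)^+$) if and only if its image in $C_r^*(G,B)^+$ is invertible.
   Context: A length function on $G$ is a function $\ell : G \to \mathbb{R}_{\geq 0}$ with $\ell(e) = 0$ and $\ell(gh) \leq \ell(g) + \ell(h)$ for all $g,h \in G$. A $G$-$C^*$-algebra is a $C^*$-algebra with a strongly continuous action of $G$ by $*$-automorphisms, written $b \mapsto g(b)$. $L^2(G,B)$ is the Hilbert $C^*$-module over $B$ on which $C_c(G,B)$ acts by convolution: it is the completion of $C_c(G,B)$ with respect to the $B$-valued inner product $\langle v, w\rangle = \int_G g^{-1}(v(g)^* w(g))\, d\mu(g)$, with right action $(v\cdot b)(g) = v(g)\, g(b)$. For $a \in C_c(G,B)$ let $(\lambda(a)v)(g') = \int_G a(g)\, g(v(g^{-1}g'))\, d\mu(g)$. The reduced crossed product $C_r^*(G,B)$ is the closure of $C_c(G,B)$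 in the operator norm of $\mathcal{B}(L^2(G,B))$ (bounded operators), and $\lambda(a)$ denotes the bounded operator on $L^2(G,B)$ corresponding to $a \in C_r^*(G,B)$. Put $\sigma = 1 + \ell$. Pointwise multiplication by $\sigma$ is a (generally unbounded) operator on $L^2(G,B)$ with domain $\mathrm{Dom}(\sigma) = \{v : \sigma v \in L^2(G,B)\}$. For $A \in \mathcal{B}(L^2(G,B))$ let $D(A)$ be the possibly unbounded operator $v \mapsto \sigma A(v) - A(\sigma v)$, i.e. $D(A) = [\sigma, A]$. The notation $D(A) \in \mathcal{B}(L^2(G,B))$ means that $A$ maps $\mathrm{Dom}(\sigma)$ into itself and that the commutator, defined on the dense subspace $\mathrm{Dom}(\sigma)$, extends to a bounded operator, which is then also denoted $D(A)$; $D^n$ is defined by iteration and $D^0(A) = A$. Define $$V_\ell^\infty(G,B) = \{ a \in C_r^*(G,B) : D^n(\lambda(a)) \in \mathcal{B}(L^2(G,B)) \ \forall n \in \mathbb{Z}_{\geq 0} \},$$ with the topology given by the seminorms $a \mapsto \|D^n(\lambda(a))\|_{\mathcal{B}(L^2(G,B))}$, $n \in \mathbb{Z}_{\geq 0}$. A Fréchet algebra is a Fréchet space with a jointly continuous associative bilinear multiplication (here the multiplication of $C_r^*(G,B)$). The unitization of an algebra $A$ is $A^+ = A \oplus \mathbb{C}$. *)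

(* Defs.v *)
From HB Require Import structures.
From mathcomp Require Import all_boot all_order all_algebra complex.
From mathcomp Require Import all_classical all_reals all_analysis.

Set Implicit Arguments.
Unset Strict Implicit.
Unset Printing Implicit Defensive.

Import Order.TTheory GRing.Theory Num.Theory numFieldNormedType.Exports.

Local Open Scope classical_set_scope.
Local Open Scope complex_scope.
Local Open Scope ring_scope.

(* Pointedness costs nothing for a group; [g_sigma_algebraType] requires it. *)
HB.mixin Record isTopologicalGroup G of PointedTopological G & Group G := {
  mulg_continuous : continuous (fun z : G * G => (z.1 * z.2)%g) ;
  invg_continuous : continuous (fun x : G => (x^-1)%g) }.

#[short(type="topologicalGroupType")]
HB.structure Definition TopologicalGroup :=
  {G of PointedTopological G & Group G & isTopologicalGroup G}.

Notation borel G := (g_sigma_algebraType (@open G)).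

Definition is_haar (R : realType) (G : topologicalGroupType)
    (mu : {measure set (borel G) -> \bar R}) : Prop :=
  [/\ forall (g : G) (A : set (borel G)), measurable A ->
        mu [set (g * x)%g | x in (A : set G)] = mu A,
      forall K : set G, compact K -> (mu K < +oo)%E,
      mu setT != 0%E,
      forall A : set (borel G), measurable A ->
        mu A = ereal_inf [set mu U | U in [set U : set G | open U /\ A `<=` U]]
    & forall U : set G, open U ->
        mu U = ereal_sup [set mu K | K in [set K : set G | compact K /\ K `<=` U]]].

Definition is_length (R : realType) (G : topologicalGroupType) (l : G -> R) : Prop :=
  [/\ forall g, 0 <= l g, l 1%g = 0 & forall g h, l (g * h)%g <= l g + l h].

(* The norm of a normed space over [R[i]] takes values in [R[i]]; this is the
   same number in [R]. *)
Definition rnorm (R : realType) (E : normedModType R[i]) (x : E) : R :=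
  complex.Re `|x|.

Record cstarAlgebra (R : realType) := CStarAlgebra {
  cstar_car :> completeNormedModType R[i];
  cmul : cstar_car -> cstar_car -> cstar_car;
  cadj : cstar_car -> cstar_car;
  cmulA : associative cmul;
  cmulDl : forall x y z, cmul (x + y) z = cmul x z + cmul y z;
  cmulDr : forall x y z, cmul x (y + z) = cmul x y + cmul x z;
  cmulZl : forall (k : R[i]) x y, cmul (k *: x) y = k *: cmul x y;
  cmulZr : forall (k : R[i]) x y, cmul x (k *: y) = k *: cmul x y;
  cadjK : involutive cadj;
  cadjD : forall x y, cadj (x + y) = cadj x + cadj y;
  cadjZ : forall (k : R[i]) x, cadj (k *: x) = k^* *: cadj x;
  cadjM : forall x y, cadj (cmul x y) = cmul (cadj y) (cadj x);
  cnormM : forall x y, `|cmul x y| <= `|x| * `|y|;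
  cnorm_adj_mul : forall x, `|cmul (cadj x) x| = `|x| ^+ 2 }.

Record GCstarAlgebra (R : realType) (G : topologicalGroupType) := GCStarAlgebra {
  gcs_alg :> cstarAlgebra R;
  gact : G -> gcs_alg -> gcs_alg;
  gact1 : forall b, gact 1%g b = b;
  gactM : forall g h b, gact (g * h)%g b = gact g (gact h b);
  gactD : forall g b c, gact g (b + c) = gact g b + gact g c;
  gactZ : forall g (k : R[i]) b, gact g (k *: b) = k *: gact g b;
  gact_cmul : forall g b c, gact g (cmul b c) = cmul (gact g b) (gact g c);
  gact_cadj : forall g b, gact g (cadj b) = cadj (gact g b);
  gact_continuous : forall b, continuous (fun g => gact g b) }.

Record hilbertModule (R : realType) (B : cstarAlgebra R) := HilbertModule {
  hm_car :> completeNormedModType R[i];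
  inner : hm_car -> hm_car -> B;
  ract : hm_car -> B -> hm_car;
  ractA : forall x b c, ract x (cmul b c) = ract (ract x b) c;
  ractDl : forall x y b, ract (x + y) b = ract x b + ract y b;
  ractDr : forall x b c, ract x (b + c) = ract x b + ract x c;
  ractZl : forall (k : R[i]) x b, ract (k *: x) b = k *: ract x b;
  ractZr : forall (k : R[i]) x b, ract x (k *: b) = k *: ract x b;
  innerD : forall x y z, inner x (y + z) = inner x y + inner x z;
  innerZ : forall (k : R[i]) x y, inner x (k *: y) = k *: inner x y;
  inner_ract : forall x y b, inner x (ract y b) = cmul (inner x y) b;
  inner_adj : forall x y, cadj (inner x y) = inner y x;
  inner_pos : forall x, exists b, inner x x = cmul (cadj b) b;
  inner_norm : forall x, `|x| ^+ 2 = `|inner x x| }.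

(* [is_bochner mu f I]: [f] is Bochner integrable with integral [I].  A simple
   function sum_k 1_(A_k) b_k is given by the list of the pairs (A_k, b_k). *)
Definition is_bochner (R : realType) d (T : measurableType d)
    (mu : {measure set T -> \bar R}) (E : completeNormedModType R[i])
    (f : T -> E) (I : E) : Prop :=
  exists s : nat -> seq (set T * E),
  let err n x := rnorm (f x - \sum_(p <- s n) (\1_(p.1) x : R[i]) *: p.2) in
  [/\ forall n p, p \in s n -> measurable p.1 /\ (mu p.1 < +oo)%E,
      forall n, measurable_fun [set: T] (err n),
      (\int[mu]_x (err n x)%:E)%E @[n --> \oo] --> 0%E
    & \sum_(p <- s n) (fine (mu p.1))%:C *: p.2 @[n --> \oo] --> I].

Definition bochner (R : realType) d (T : measurableType d)
    (mu : {measure set T -> \bar R}) (E : completeNormedModType R[i])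
    (f : T -> E) : E :=
  xget 0 [set I | is_bochner mu f I].

Definition Cc (R : realType) (G : topologicalGroupType) (B : GCstarAlgebra R G) :
    set (G -> B) :=
  [set v | continuous v /\ compact (closure [set g | v g != 0])].

Definition L2_inner (R : realType) (G : topologicalGroupType)
    (mu : {measure set (borel G) -> \bar R}) (B : GCstarAlgebra R G)
    (v w : G -> B) : B :=
  bochner mu (fun g : borel G => gact (g : G)^-1%g (cmul (cadj (v g)) (w g))).

Definition convolution (R : realType) (G : topologicalGroupType)
    (mu : {measure set (borel G) -> \bar R}) (B : GCstarAlgebra R G)
    (a v : G -> B) : G -> B :=
  fun g' => bochner mu (fun g : borel G =>
    cmul (a g) (gact (g : G) (v ((g : G)^-1 * g')%g))).

(* A completion of the inner product B-module C_c(G,B), i.e. a Hilbert B-module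
   in which it embeds densely; it is unique up to a unique isomorphism.
   [L2_of v] is only meaningful for [v] in [Cc B]. *)
Record L2_completion (R : realType) (G : topologicalGroupType)
    (mu : {measure set (borel G) -> \bar R}) (B : GCstarAlgebra R G) :=
  L2Completion {
  L2_mod :> hilbertModule B;
  L2_of : (G -> B) -> L2_mod;
  L2_ofD : forall v w, Cc v -> Cc w -> L2_of (fun g => v g + w g) = L2_of v + L2_of w;
  L2_ofZ : forall (k : R[i]) v, Cc v -> L2_of (fun g => k *: v g) = k *: L2_of v;
  L2_of_ract : forall v b, Cc v ->
    L2_of (fun g => cmul (v g) (gact g b)) = ract (L2_of v) b;
  L2_of_inner : forall v w, Cc v -> Cc w -> inner (L2_of v) (L2_of w) = L2_inner mu v w;
  L2_of_dense : closure [set L2_of v | v in @Cc R G B] = setT }.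

Definition bounded_op (R : realType) (E : normedModType R[i]) : set (E -> E) :=
  [set A | linear A /\ exists M : R, forall x, rnorm (A x) <= M * rnorm x].

Definition opnorm (R : realType) (E : normedModType R[i]) (A : E -> E) : R :=
  sup [set rnorm (A x) | x in [set x : E | rnorm x <= 1]].

Section CrossedProduct.
Context (R : realType) (G : topologicalGroupType).
Context (mu : {measure set (borel G) -> \bar R}) (B : GCstarAlgebra R G).
Context (L : L2_completion mu B).

Definition is_lambda (a : G -> B) (T : L -> L) : Prop :=
  bounded_op T /\ forall v, Cc v -> T (L2_of L v) = L2_of L (convolution mu a v).

(* C_r^*(G,B), realised inside the bounded operators on L^2(G,B), so that
   "lambda(a)" for a in C_r^*(G,B) is a itself. *)
Definition Crstar : set (L -> L) :=
  [set T | bounded_op T /\ forall e : R, 0 < e ->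
    exists a S, [/\ Cc a, is_lambda a S & opnorm (T - S) < e]].

(* [z] is the class in L^2(G,B) of the function [h : G -> B], which need not be
   continuous. *)
Definition L2_class (z : L) (h : G -> B) : Prop :=
  forall u, Cc u ->
    is_bochner mu (fun g : borel G => gact (g : G)^-1%g (cmul (cadj (u g)) (h g)))
      (inner (L2_of L u) z).

Context (l : G -> R).

(* The graph "w = sigma v" of pointwise multiplication by sigma = 1 + l, with its
   maximal domain.  An element of the completion L^2(G,B) need not be given by a
   function G -> B, so sigma v is defined by its pairings with C_c(G,B),
   <u, sigma v> := <sigma u, v>; sigma u is a measurable, in general
   discontinuous, function. *)
Definition sigma_graph (v w : L) : Prop :=
  forall u, Cc u ->
    exists2 z : L, L2_class z (fun g => (1 + l g)%:C *: u g)
                 & inner z v = inner (L2_of L u) w.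

(* [C] is D(A): [A] preserves Dom(sigma) and the bounded operator [C] extends
   the commutator [sigma, A]. *)
Definition is_D (A C : L -> L) : Prop :=
  bounded_op C /\
  forall v w, sigma_graph v w ->
    exists2 w', sigma_graph (A v) w' & C v = w' - A w.

Definition Dop (A : L -> L) : L -> L := xget 0 [set C | is_D A C].

Definition Dn (n : nat) (A : L -> L) : L -> L := iter n Dop A.

(* D^n(A) is a bounded operator; in particular the D^k(A), k < n, are. *)
Fixpoint Dn_bounded (n : nat) (A : L -> L) : Prop :=
  if n is m.+1 then Dn_bounded m A /\ exists C, is_D (Dn m A) C
  else bounded_op A.

Definition Vinfty : set (L -> L) :=
  [set A | Crstar A /\ forall n, Dn_bounded n A].

Definition Vseminorm (n : nat) (A : L -> L) : R := opnorm (Dn n A).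

End CrossedProduct.

Arguments is_lambda {R G mu B} L a T.
Arguments Crstar {R G mu B} L.
Arguments Vinfty {R G mu B} L l.
Arguments Vseminorm {R G mu B} L l n A.

Section Seminorms.
Context (R : realType).

(* Neighbourhoods of [x] in the topology on the subgroup [V] of [W] generated by
   the restrictions to [V] of the seminorms [p n]. *)
Definition seminorm_nbhs (W : zmodType) (V : set W) (p : nat -> W -> R) (x : W) :
    set_system W :=
  filter_from [set ne : nat * R | 0 < ne.2]
    (fun ne => [set y | V y /\ forall k, (k <= ne.1)%N -> p k (y - x) < ne.2]).

Definition seminorm_open (W : zmodType) (V : set W) (p : nat -> W -> R)
    (U : set W) : Prop :=
  U `<=` V /\ forall x, U x -> seminorm_nbhs V p x U.

Definition is_seminorm (W : lmodType R[i]) (V : set W) (q : W -> R) : Prop :=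
  [/\ forall x, V x -> 0 <= q x,
      forall x y, V x -> V y -> q (x + y) <= q x + q y
    & forall (k : R[i]) x, V x -> q (k *: x) = complex.Re `|k| * q x].

Definition frechet_space (W : lmodType R[i]) (V : set W) (p : nat -> W -> R) : Prop :=
  [/\ V 0 /\ (forall (k : R[i]) x y, V x -> V y -> V (k *: x + y)),
      forall n, is_seminorm V (p n),
      forall x, V x -> (forall n, p n x = 0) -> x = 0
    & forall u : nat -> W, (forall n, V (u n)) ->
        (forall k (e : R), 0 < e -> exists N, forall m n,
          (N <= m)%N -> (N <= n)%N -> p k (u m - u n) < e) ->
        exists2 x, V x & (u @ \oo) `=>` seminorm_nbhs V p x].

Definition frechet_algebra (W : lmodType R[i]) (V : set W) (p : nat -> W -> R)
    (mul : W -> W -> W) : Prop :=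
  [/\ frechet_space V p,
      forall x y, V x -> V y -> V (mul x y),
      forall x y z, V x -> V y -> V z -> mul x (mul y z) = mul (mul x y) z,
      forall (k : R[i]) x y z, V x -> V y -> V z ->
        mul (k *: x + y) z = k *: mul x z + mul y z /\
        mul z (k *: x + y) = k *: mul z x + mul z y
    & forall x y, V x -> V y ->
        ((fun z : W * W => mul z.1 z.2) @
           filter_prod (seminorm_nbhs V p x) (seminorm_nbhs V p y))
        `=>` seminorm_nbhs V p (mul x y)].

End Seminorms.

(* The unitization A (+) C of an algebra [A] of operators on [E]. *)
Section Unitization.
Context (R : realType) (E : normedModType R[i]).

Definition unitization (A : set (E -> E)) : set ((E -> E) * R[i]) :=
  [set x | A x.1].

Definition umul (x y : (E -> E) * R[i]) : (E -> E) * R[i] :=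
  (x.1 \o y.1 + y.2 *: x.1 + x.2 *: y.1, x.2 * y.2).

Definition uone : (E -> E) * R[i] := (0, 1).

Definition useminorm (p : nat -> (E -> E) -> R) (n : nat) (x : (E -> E) * R[i]) : R :=
  p n x.1 + complex.Re `|x.2|.

Definition is_uinv (A : set (E -> E)) (x y : (E -> E) * R[i]) : Prop :=
  [/\ unitization A x, unitization A y, umul x y = uone & umul y x = uone].

Definition uinvertible (A : set (E -> E)) : set ((E -> E) * R[i]) :=
  [set x | exists y, is_uinv A x y].

Definition uinv (A : set (E -> E)) (x : (E -> E) * R[i]) : (E -> E) * R[i] :=
  xget 0 [set y | is_uinv A x y].

End Unitization.

(* Main.v *)
Require Import Defs.
From HB Require Import structures.
From mathcomp Require Import all_boot all_order all_algebra complex.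
From mathcomp Require Import all_classical all_reals all_analysis.
From mathcomp Require Import measurable_realfun ring lra.
Import Order.TTheory GRing.Theory Num.Theory numFieldNormedType.Exports.
Local Open Scope classical_set_scope.
Local Open Scope complex_scope.
Local Open Scope ring_scope.

Set Implicit Arguments.
Unset Strict Implicit.
Unset Printing Implicit Defensive.

(* Put rho_k = sigma / (1 + sigma / (k + 1)), a bounded multiplier.  An element v
   lies in Dom(sigma) iff rho_k v converges, the limit being sigma v, and for a
   bounded operator A the commutator D(A) exists and equals C iff [rho_k, A]
   converges strongly to C.  So D is a closed derivation, and if A is invertible
   then D(A^-1) = - A^-1 D(A) A^-1; therefore an inverse of a smooth operator is
   smooth, and V is a Frechet algebra stable under inversion.

   For a in C_c(G,B), lambda(a) is the strong limit of Riemann sums of the shifts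
   v |-> a(g) g(v(g^-1 . )).  The n-fold commutator of rho_k with such a shift is its
   product with (rho_k - rho_k(g^-1 . ))^n, which is at most l(g)^n because rho_k is
   1-Lipschitz for l; and l is bounded on the support of a by Steinhaus's theorem
   on differences of sets of positive measure.  These commutators converge on
   C_c(G,B) as k tends to infinity, so D^n(lambda(a)) is bounded for all n. *)

(** * Norms and C*-algebras *)

(** The difficulties come from the generality: an element of the completion L^2(G,B) need not be a
    function, sigma is merely Borel and unbounded, and B need not be separable. Identities between
    operators are therefore checked on C_c(G,B), by uniqueness of the Bochner integrals that
    represent the pairings, and carried to the completion by density and equiboundedness. The
    product of a C_c function with a discontinuous multiplier is a limit of products with continuous
    multipliers that approximate it in L^1 on the support.

    Norm bounds come from elementary arguments, without order or functional calculus in B. This is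
    the origin of the factors 2 for automorphisms, 4 for the Cauchy-Schwarz inequality and for
    multipliers, and 8 for shifts; they are harmless, as only boundedness and convergence matter.

    For (c), invertibility is decided in C_r^* by (d), and there a Neumann series shows that it is
    an open condition in norm. The identity y - y0 = - y (x - x0) y0 between inverses then gives
    continuity in every seminorm. *)

Section RealNorm.
Context {R : realType}.

Lemma Re_normE (k : R[i]) : (complex.Re `|k|)%:C = `|k|.
Proof. by rewrite RRe_real// normr_real. Qed.

Lemma normC_real (r : R) : complex.Re `|r%:C| = `|r|.
Proof. by rewrite normc_def /= expr0n addr0 sqrtr_sqr. Qed.

Lemma conj_real (r : R) : (r%:C)^* = r%:C :> R[i].
Proof. by apply: conj_Creal; apply/complex_realP; exists r. Qed.

Lemma Re_norm_ge0 (k : R[i]) : 0 <= complex.Re `|k|.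
Proof. by rewrite -ler0c Re_normE. Qed.

Context {E : normedModType R[i]}.
Implicit Types x y z : E.

Lemma rnormE x : (rnorm x)%:C = `|x|.
Proof. by rewrite /rnorm RRe_real// normr_real. Qed.

Lemma rnorm_ge0 x : 0 <= rnorm x.
Proof. by rewrite -ler0c rnormE. Qed.

Lemma rnorm0 : rnorm (0 : E) = 0.
Proof. by rewrite /rnorm normr0. Qed.

Lemma rnorm0_eq0 x : rnorm x = 0 -> x = 0.
Proof. by move=> h; apply/normr0_eq0; rewrite -rnormE h. Qed.

Lemma rnormN x : rnorm (- x) = rnorm x.
Proof. by rewrite /rnorm normrN. Qed.

Lemma rnormB x y : rnorm (x - y) = rnorm (y - x).
Proof. by rewrite -rnormN opprB. Qed.

Lemma ler_rnormD x y : rnorm (x + y) <= rnorm x + rnorm y.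
Proof. by rewrite -lecR rmorphD /= !rnormE ler_normD. Qed.

Lemma ler_rnormB x y : rnorm (x - y) <= rnorm x + rnorm y.
Proof. by rewrite -[rnorm y]rnormN ler_rnormD. Qed.

Lemma ler_rnormBD x y z : rnorm (x - z) <= rnorm (x - y) + rnorm (y - z).
Proof. by rewrite (_ : x - z = (x - y) + (y - z)) ?ler_rnormD// addrA subrK. Qed.

Lemma ler_rnorm_dist x y : `|rnorm x - rnorm y| <= rnorm (x - y).
Proof.
rewrite ler_norml; apply/andP; split.
  rewrite lerNl opprB lerBlDr rnormB.
  by rewrite -[X in rnorm X <= _](subrK x) ler_rnormD.
by rewrite lerBlDr -[X in rnorm X <= _](subrK y) ler_rnormD.
Qed.

Lemma rnormZ (k : R[i]) x : rnorm (k *: x) = complex.Re `|k| * rnorm x.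
Proof. by apply/complexI; rewrite rnormE rmorphM /= Re_normE rnormE normrZ. Qed.

Lemma rnormZr (r : R) x : rnorm (r%:C *: x) = `|r| * rnorm x.
Proof. by rewrite rnormZ normC_real. Qed.

Lemma ler_rnorm_sum (I : Type) (r : seq I) (P : pred I) (F : I -> E) :
  rnorm (\sum_(i <- r | P i) F i) <= \sum_(i <- r | P i) rnorm (F i).
Proof.
elim/big_ind2 : _ => [|x a y b h1 h2|//]; first by rewrite rnorm0.
by rewrite (le_trans (ler_rnormD _ _))// lerD.
Qed.

Lemma cvg_rnormP (I : Type) (F : set_system I) {FF : Filter F} (u : I -> E) (x : E) :
  u @ F --> x <-> forall e : R, 0 < e -> \forall i \near F, rnorm (u i - x) < e.
Proof.
split=> [/cvgrPdist_lt h e e0|h].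
  have /h : (0 : R[i]) < e%:C by rewrite (ltcR 0).
  by apply: filterS => i; rewrite -rnormE ltcR rnormB.
apply/cvgrPdist_lt => e e0.
have er : e = (complex.Re e)%:C by rewrite RRe_real// gtr0_real.
have : 0 < complex.Re e by rewrite -ltcR -er.
by move=> /h; apply: filterS => i; rewrite er -rnormE ltcR rnormB.
Qed.

Lemma cvg_rnorm (I : Type) (F : set_system I) {FF : Filter F} (u : I -> E) (x : E) :
  u @ F --> x -> (fun i => rnorm (u i)) @ F --> rnorm x.
Proof.
move=> /cvg_rnormP h; apply/cvgrPdist_lt => e e0.
have := h _ e0; apply: filterS => i; apply: le_lt_trans.
by rewrite distrC ler_rnorm_dist.
Qed.

Lemma cvg_rnorm_le (I : Type) (F : set_system I) {FF : ProperFilter F} (u : I -> E)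
    (x : E) (M : R) :
  u @ F --> x -> (\forall i \near F, rnorm (u i) <= M) -> rnorm x <= M.
Proof.
move=> /cvg_rnormP ux uM; apply/ler_addgt0Pl => e e0.
have [i [h1 h2]] := filter_ex (filterI (ux _ e0) uM).
have := ler_rnormBD x (u i) 0; rewrite !subr0 rnormB => /le_trans; apply.
by rewrite lerD// ltW.
Qed.

Lemma cvg_rnorm_unique (I : Type) (F : set_system I) {FF : ProperFilter F} (u : I -> E)
    (x y : E) :
  u @ F --> x -> u @ F --> y -> x = y.
Proof.
move=> ux uy; apply/subr0_eq/rnorm0_eq0/eqP; rewrite eq_le rnorm_ge0 andbT.
apply: (@cvg_rnorm_le _ F _ (u - u)); first exact: cvgB.
by apply: nearW => i; rewrite subrr rnorm0.
Qed.

Lemma cvg_rnorm_bound (I : Type) (F : set_system I) {FF : Filter F} (u : I -> E)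
    (x : E) (k : I -> R) :
  (forall i, rnorm (u i - x) <= k i) -> k @ F --> (0 : R) -> u @ F --> x.
Proof.
move=> uk /cvgrPdist_lt k0; apply/cvg_rnormP => e /k0; apply: filterS => i.
by rewrite sub0r normrN; apply: le_lt_trans; rewrite (le_trans (uk i))// ler_norm.
Qed.

End RealNorm.

Section Completeness.
Context {R : realType} {E : completeNormedModType R[i]}.

Lemma cauchy_rnorm_cvg (I : Type) (F : set_system I) {FF : ProperFilter F} (u : I -> E) :
  (forall e : R, 0 < e -> exists i0, \forall i \near F, rnorm (u i - u i0) < e) ->
  exists x : E, u @ F --> x.
Proof.
move=> h; suff /cauchy_cvg : @cauchy E (u @ F) by move=> ?; exists (lim (nbhs (u @ F))).
apply: cauchy_exP => e e0.
have er : e = (complex.Re e)%:C by rewrite RRe_real// gtr0_real.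
have : 0 < complex.Re e by rewrite -ltcR -er.
move=> /h[i0 hi]; exists (u i0); rewrite -ball_normE /=.
by near=> i; rewrite /= er -rnormE ltcR rnormB; near: i.
Unshelve. all: by end_near. Qed.

Lemma cauchy_seq_cvg (u : nat -> E) :
  (forall e : R, 0 < e -> exists N, forall m n, (N <= m)%N -> (N <= n)%N ->
     rnorm (u m - u n) < e) ->
  exists x : E, u @ \oo --> x.
Proof.
move=> h; apply: cauchy_rnorm_cvg => e /h[N hN]; exists N.
by exists N => // m /= Nm; exact: hN.
Qed.

End Completeness.

(** Stated for an abstract distance between indices, so that it serves both vectors with [rnorm] and
    operators with [opnorm], the latter not being the norm of a normed module. *)
Lemma geometric_cauchy {R : realType} (d : nat -> nat -> R) (C r : R) :
  (forall n, d n n = 0) -> (forall m n, d m n = d n m) ->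
  (forall m n p, d m n <= d m p + d p n) ->
  0 <= r < 1 -> (forall n, d n n.+1 <= C * r ^+ n) ->
  forall e, 0 < e -> exists N, forall m n, (N <= m)%N -> (N <= n)%N -> d m n < e.
Proof.
move=> d0 dC dD /andP[r0 r1] dr.
(* The exact partial sum of the geometric series is kept: with it the induction step is an
   equality. *)
have dk n k : d n (n + k)%N <= C / (1 - r) * r ^+ n * (1 - r ^+ k).
  elim: k => [|k IH]; first by rewrite addn0 d0 expr0 subrr mulr0.
  rewrite addnS (le_trans (dD _ _ (n + k)%N))// (le_trans (lerD IH (dr _)))//.
  rewrite exprD exprS le_eqVlt; apply/orP; left; apply/eqP.
  by field; rewrite subr_eq0 eq_sym lt_eqF.
have C0 : 0 <= C.
  have := dD 0%N 0%N 1%N; rewrite d0 (dC 1%N) => h.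
  by have := dr 0%N; rewrite expr0 mulr1; lra.
have dk' n k : (n <= k)%N -> d n k <= C / (1 - r) * r ^+ n.
  move=> /subnK <-; rewrite addnC (le_trans (dk _ _))// ler_piMr//.
    by rewrite mulr_ge0 ?exprn_ge0// divr_ge0// subr_ge0 ltW.
  by rewrite gerBl exprn_ge0.
move=> e e0.
have : (fun n => C / (1 - r) * r ^+ n) @ \oo --> (C / (1 - r) * 0 : R).
  by apply: cvgMr; apply: cvg_expr; rewrite ger0_norm.
rewrite mulr0 => /cvgrPdist_lt/(_ e e0)[N _ NP].
have {}NP n : (N <= n)%N -> C / (1 - r) * r ^+ n < e.
  by move=> /NP /=; rewrite sub0r normrN; apply: le_lt_trans; rewrite ler_norm.
exists N => m n Nm Nn.
case: (leqP m n) => mn; first by rewrite (le_lt_trans (dk' _ _ mn))// NP.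
by rewrite dC (le_lt_trans (dk' _ _ (ltnW mn)))// NP.
Qed.

Section Cstar.
Context {R : realType} {B : cstarAlgebra R}.
Implicit Types x y z : B.

Lemma cmul0l y : cmul 0 y = 0.
Proof. by have := cmulZl 0 0 y; rewrite !scale0r. Qed.

Lemma cmul0r x : cmul x 0 = 0.
Proof. by have := cmulZr 0 x 0; rewrite !scale0r. Qed.

Lemma cmulNl x y : cmul (- x) y = - cmul x y.
Proof. by rewrite -scaleN1r cmulZl scaleN1r. Qed.

Lemma cmulNr x y : cmul x (- y) = - cmul x y.
Proof. by rewrite -scaleN1r cmulZr scaleN1r. Qed.

Lemma cmulBl x y z : cmul (x - y) z = cmul x z - cmul y z.
Proof. by rewrite cmulDl cmulNl. Qed.

Lemma cmulBr x y z : cmul x (y - z) = cmul x y - cmul x z.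
Proof. by rewrite cmulDr cmulNr. Qed.

Lemma cadj0 : cadj (0 : B) = 0.
Proof. by have := cadjZ 0 (0 : B); rewrite scale0r rmorph0 scale0r. Qed.

Lemma cadjN x : cadj (- x) = - cadj x.
Proof. by rewrite -scaleN1r cadjZ rmorphN1 scaleN1r. Qed.

Lemma cadjB x y : cadj (x - y) = cadj x - cadj y.
Proof. by rewrite cadjD cadjN. Qed.

Lemma rnormM_le x y : rnorm (cmul x y) <= rnorm x * rnorm y.
Proof. by rewrite -lecR rmorphM /= !rnormE cnormM. Qed.

Lemma rnorm_adj_mul x : rnorm (cmul (cadj x) x) = rnorm x ^+ 2.
Proof. by apply/complexI; rewrite rmorphXn /= !rnormE cnorm_adj_mul. Qed.

(** The C*-identity and submultiplicativity bound the norm of y by that of its adjoint; taking y to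
    be the adjoint of x gives the converse. *)
Lemma rnorm_adj x : rnorm (cadj x) = rnorm x.
Proof.
have le y : rnorm y <= rnorm (cadj y).
  have := rnormM_le (cadj y) y; rewrite rnorm_adj_mul expr2.
  have := rnorm_ge0 y; rewrite le_eqVlt => /predU1P[<- _|y0].
    exact: rnorm_ge0.
  by rewrite ler_pM2r.
by apply/eqP; rewrite eq_le le andbT -{2}(cadjK x) le.
Qed.

Lemma cvg_cmul (I : Type) (F : set_system I) {FF : Filter F} (u v : I -> B) x y :
  u @ F --> x -> v @ F --> y -> (fun i => cmul (u i) (v i)) @ F --> cmul x y.
Proof.
move=> ux vy; apply: (@cvg_rnorm_bound _ _ _ _ _ _ _
    (fun i => rnorm (u i - x) * rnorm (v i) + rnorm x * rnorm (v i - y))) => [i|].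
  rewrite (_ : _ - _ = cmul (u i - x) (v i) + cmul x (v i - y)); last first.
    by rewrite cmulBl cmulBr addrA subrK.
  by rewrite (le_trans (ler_rnormD _ _))// lerD ?rnormM_le.
have d (w : I -> B) z : w @ F --> z -> (fun i => rnorm (w i - z)) @ F --> (0 : R).
  move=> wz; rewrite -(rnorm0 (E := B)) -(subrr z); apply: cvg_rnorm.
  by apply: cvgB => //; exact: cvg_cst.
have -> : 0 = 0 * rnorm y + rnorm x * 0 :> R by rewrite mul0r mulr0 addr0.
apply: cvgD; apply: cvgM; [exact: d|exact: cvg_rnorm|exact: cvg_cst|exact: d].
Qed.

Lemma cvg_cadj (I : Type) (F : set_system I) {FF : Filter F} (u : I -> B) x :
  u @ F --> x -> (fun i => cadj (u i)) @ F --> cadj x.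
Proof.
move=> /cvg_rnormP ux; apply/cvg_rnormP => e /ux; apply: filterS => i.
by rewrite -cadjB rnorm_adj.
Qed.

(* A square root of [1 - h^2] of the form [1 - q], by fixed-point iteration. *)
Lemma cstar_sqrt (h : B) : cadj h = h -> rnorm h <= 1 / 2 ->
  exists q, [/\ cadj q = q, cmul h q = cmul q h & q + q = cmul h h + cmul q q].
Proof.
move=> hadj h2.
pose half : R[i] := (1 / 2 : R)%:C.
(* A fixed point q of [f] satisfies (1 - q)^2 = 1 - h^2, written without the unit that B may lack.
   The map sends the ball of radius 1/2 into itself, and each iterate is self-adjoint and commutes
   with h. *)
pose f q := half *: (cmul h h + cmul q q).
pose u n := iter n f 0.
have uS n : u n.+1 = f (u n) by [].
have nhh : rnorm (cmul h h) <= 1 / 4.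
  have := rnormM_le h h; have := rnorm_ge0 h; nra.
have ub n : rnorm (u n) <= 1 / 2.
  elim: n => [|n IH]; first by rewrite rnorm0.
  rewrite uS /f rnormZr ger0_norm//.
  have := ler_rnormD (cmul h h) (cmul (u n) (u n)).
  have := rnormM_le (u n) (u n); have := rnorm_ge0 (u n); nra.
have uadj n : cadj (u n) = u n.
  elim: n => [|n IH]; first exact: cadj0.
  by rewrite uS /f cadjZ cadjD !cadjM hadj IH conj_real.
have ucomm n : cmul h (u n) = cmul (u n) h.
  elim: n => [|n IH]; first by rewrite cmul0l cmul0r.
  by rewrite uS /f cmulZl cmulZr cmulDl cmulDr !cmulA IH -(cmulA (u n) h) IH cmulA.
(* From a a - b b = a (a - b) + (a - b) b with both norms at most 1/2, [f] contracts by the factor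
   1/2. *)
have ud n : rnorm (u n.+1 - u n) <= 1 / 2 * (1 / 2) ^+ n.
  elim: n => [|n IH].
    by rewrite subr0 expr0 mulr1 ub.
  rewrite (uS n.+1) {2}uS /f -scalerBr rnormZr ger0_norm// opprD addrACA subrr add0r.
  rewrite (_ : _ - _ = cmul (u n.+1) (u n.+1 - u n) + cmul (u n.+1 - u n) (u n)); last first.
    by rewrite cmulBl cmulBr addrA subrK.
  set a := u n.+1 in IH *; set b := u n in IH *.
  have := ler_rnormD (cmul a (a - b)) (cmul (a - b) b).
  have := rnormM_le a (a - b); have := rnormM_le (a - b) b.
  have := ub n; have := ub n.+1; rewrite -/a -/b.
  have := rnorm_ge0 a; have := rnorm_ge0 b; have := rnorm_ge0 (a - b).
  rewrite exprS; set p := (1 / 2) ^+ n in IH *.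
  nra.
have [//|q uq] := @cauchy_seq_cvg _ _ u.
  apply: (@geometric_cauchy _ (fun m n => rnorm (u m - u n)) (1 / 2) (1 / 2)) => //.
  - by move=> n; rewrite subrr rnorm0.
  - by move=> m n; rewrite rnormB.
  - by move=> m n p; exact: ler_rnormBD.
  - by apply/andP; split; lra.
  - by move=> n; rewrite rnormB.
exists q; split.
- apply: (@cvg_rnorm_unique _ _ _ \oo _ (fun n => cadj (u n))); first exact: cvg_cadj.
  by rewrite (funext uadj).
- apply: (@cvg_rnorm_unique _ _ _ \oo _ (fun n => cmul h (u n))); first by apply: cvg_cmul => //; exact: cvg_cst.
  rewrite (_ : (fun _ => _) = fun n => cmul (u n) h); last by apply/funext => n.
  by apply: cvg_cmul => //; exact: cvg_cst.
- have uq' : (fun n => u n.+1) @ \oo --> q by rewrite (cvg_shiftS u).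
  have qf : q = f q.
    apply: (@cvg_rnorm_unique _ _ _ \oo _ (fun n => u n.+1)) => //; apply: cvgZr.
    by apply: cvgD; [exact: cvg_cst|exact: cvg_cmul].
  rewrite {1 2}qf /f -scalerDl /half -rmorphD /= (_ : 1 / 2 + 1 / 2 = 1) ?scale1r//.
  by field.
Unshelve. all: by end_near. Qed.

(** The two hypotheses say that k + w satisfies u^* u = 1 in the unitization. Since B may have no
    unit, this isometry is only used through left multiplication on B. *)
Lemma cstar_isometry (k : R[i]) (w : B) : k^* * k = 1 ->
  k^* *: w + k *: cadj w + cmul (cadj w) w = 0 ->
  forall b, rnorm (k *: b + cmul w b) = rnorm b.
Proof.
move=> kk wk b; apply/eqP; rewrite -(@eqrXn2 _ 2)// ?rnorm_ge0//.
rewrite -!rnorm_adj_mul; apply/eqP; congr rnorm.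
rewrite cadjD cadjZ cadjM cmulDl !cmulDr !(cmulZl, cmulZr) !cmulA scalerA (mulrC k) kk scale1r.
rewrite -[X in _ + (_ + X)](cmulA (cmul (cadj b) (cadj w))) -!cmulA (cmulA (cadj w)).
rewrite -addrA -!(cmulZr _ (cadj b)) -!cmulDr -!cmulZl -!cmulDl addrA wk.
by rewrite cmul0l addr0.
Qed.

End Cstar.

(* If [h] is self-adjoint and small, [1 - h^2 = (1 - q)^2], so that
   [a +- i (1 - q)] are unitaries with sum [2 a] whenever [a], [q] are the images
   of [h], [q]. *)
Lemma star_hom_bounded {R : realType} (A B : cstarAlgebra R) (f : A -> B) :
  (forall x y, f (x + y) = f x + f y) -> (forall (k : R[i]) x, f (k *: x) = k *: f x) ->
  (forall x y, f (cmul x y) = cmul (f x) (f y)) -> (forall x, f (cadj x) = cadj (f x)) ->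
  forall x, rnorm (f x) <= 2 * rnorm x.
Proof.
move=> fD fZ fM fA.
have small h : cadj h = h -> rnorm h <= 1 / 2 -> rnorm (f h) <= 1.
  move=> hadj h2; have [q [qadj hq qq]] := cstar_sqrt hadj h2.
  pose a := f h; pose c := f q.
  have aadj : cadj a = a by rewrite -fA hadj.
  have cadj' : cadj c = c by rewrite -fA qadj.
  have acomm : cmul a c = cmul c a by rewrite -!fM hq.
  have ccE : c + c = cmul a a + cmul c c by rewrite -fD qq fD !fM.
  (* Here k b + (a - k c) b is (a + k (1 - c)) b, for k = i or k = -i. *)
  have iso (k : R[i]) : k^* = - k -> k ^+ 2 = -1 -> forall b,
      rnorm (k *: b + cmul (a - k *: c) b) = rnorm b.
    move=> kJ k2; apply: cstar_isometry; first by rewrite kJ mulNr -expr2 k2 opprK.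
    rewrite cadjB cadjZ aadj cadj' kJ !scaleNr opprK.
    rewrite !(scalerBr, scalerDr, cmulDl, cmulBr, cmulZl, cmulZr, scalerA).
    rewrite -!expr2 k2 !scaleN1r !opprK acomm subrKA opprD.
    by rewrite (addrC (- _)) subrKA -opprD ccE addNr.
  have ii : ('i%R : R[i])^* = - 'i%R by exact: conjCi.
  have ii2 : ('i%R : R[i]) ^+ 2 = -1 by exact: sqrCi.
  (* Both isometries are applied to a itself, in place of a unit. The results have norm that of a
     and sum to 2 a a, so the square of the norm of a is at most the norm of a. *)
  have := iso 'i%R ii ii2 a.
  have jj : (- 'i%R : R[i])^* = - - 'i%R by rewrite raddfN /= ii.
  have jj2 : (- 'i%R : R[i]) ^+ 2 = -1 by rewrite sqrrN.
  have := iso _ jj jj2 a.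
  rewrite !scaleNr opprK cmulDl cmulBl => n1 n2.
  have : 2 * rnorm a ^+ 2 <= 2 * rnorm a.
    rewrite -rnorm_adj_mul aadj -[X in X * rnorm _ <= _]ger0_norm// -rnormZr.
    set P := (X in rnorm X = _) in n2; set Q := (X in rnorm X = _) in n1.
    have -> : (2 : R)%:C *: cmul a a = P + Q.
      rewrite rmorph_nat scaler_nat mulr2n /P /Q addrACA subrr add0r addrACA addNr.
      by rewrite addr0.
    by have := ler_rnormD P Q; rewrite n1 n2; lra.
  have := rnorm_ge0 a; nra.
have sa h : cadj h = h -> rnorm (f h) <= 2 * rnorm h.
  move=> hadj; have [h0|h0] := eqVneq (rnorm h) 0.
    by rewrite h0 mulr0 (rnorm0_eq0 h0) -(scale0r h) fZ scale0r rnorm0.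
  have hp : 0 < rnorm h by rewrite lt_neqAle eq_sym h0 rnorm_ge0.
  pose c := (2 * rnorm h)^-1.
  have cp : 0 < c by rewrite invr_gt0 mulr_gt0.
  have := small (c%:C *: h); rewrite cadjZ conj_real hadj fZ !rnormZr gtr0_norm//.
  have le : c * rnorm h <= 1 / 2 by rewrite /c invfM -mulrA mulVf// mulr1; lra.
  by move=> /(_ erefl le); rewrite ler_pdivrMl ?mulr_gt0// mulr1.
(* By the C*-identity the bound 2 for self-adjoint elements gives the square root of 2 for x, which
   is at most 2. *)
move=> x; have := sa (cmul (cadj x) x); rewrite cadjM cadjK => /(_ erefl).
rewrite fM fA !rnorm_adj_mul.
have := rnorm_ge0 x; have := rnorm_ge0 (f x); nra.
Qed.

(** * Hilbert modules and the Cauchy-Schwarz inequality up to a constant *)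

Section Hilbert.
Context {R : realType} {B : cstarAlgebra R} {H : hilbertModule B}.
Implicit Types x y z : H.

Lemma innerDl x y z : inner (x + y) z = inner x z + inner y z.
Proof. by rewrite -[LHS]inner_adj innerD cadjD !inner_adj. Qed.

Lemma innerZl (k : R[i]) x y : inner (k *: x) y = k^* *: inner x y.
Proof. by rewrite -[LHS]inner_adj innerZ cadjZ inner_adj. Qed.

Lemma inner0r x : inner x (0 : H) = 0.
Proof. by have := innerZ 0 x (0 : H); rewrite !scale0r. Qed.

Lemma inner0l x : inner (0 : H) x = 0.
Proof. by rewrite -inner_adj inner0r cadj0. Qed.

Lemma innerNr x y : inner x (- y) = - inner x y.
Proof. by rewrite -scaleN1r innerZ scaleN1r. Qed.

Lemma innerBr x y z : inner x (y - z) = inner x y - inner x z.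
Proof. by rewrite innerD innerNr. Qed.

Lemma innerNl x y : inner (- x) y = - inner x y.
Proof. by rewrite -[LHS]inner_adj innerNr cadjN inner_adj. Qed.

Lemma innerBl x y z : inner (x - y) z = inner x z - inner y z.
Proof. by rewrite innerDl innerNl. Qed.

Lemma rnorm_inner x : rnorm (inner x x) = rnorm x ^+ 2.
Proof. by apply/complexI; rewrite rmorphXn /= !rnormE inner_norm. Qed.

Lemma inner_polarization x y :
  4%:R *: inner x y = inner (x + y) (x + y) - inner (x - y) (x - y)
    - 'i%R *: (inner (x + 'i%R *: y) (x + 'i%R *: y) - inner (x - 'i%R *: y) (x - 'i%R *: y)).
Proof.
have E z : inner (x + z) (x + z) - inner (x - z) (x - z) = 2%:R *: (inner x z + inner z x).
  rewrite !(innerD, innerDl, innerNr, innerNl) !opprD !opprK scaler_nat mulr2n.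
  rewrite addrACA [X in X + _]addrACA subrr add0r [X in _ + X]addrACA subrr addr0.
  by rewrite addrACA (addrC (inner z x)).
have ii : ('i%R : R[i])^* = - 'i%R by exact: conjCi.
have ii2 : 'i%R * 'i%R = -1 :> R[i] by rewrite -expr2 sqrCi.
rewrite !E innerZ innerZl ii scaleNr -scalerBr.
have -> : 'i%R *: (2%:R *: ('i%R *: (inner x y - inner y x))) =
    2%:R *: (inner y x - inner x y).
  by rewrite !scalerA mulrAC ii2 mulN1r scaleNr -scalerN opprB.
rewrite -scalerBr opprB addrACA subrr addr0 -mulr2n -(scaler_nat 2 (inner x y)) scalerA -natrM.
by [].
Qed.

(** Polarization reduces the pairing to four diagonal terms, whose norms are squares of norms of
    vectors. For unit vectors each term is at most (1 + 1)^2, hence the factor 4 after scaling. *)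
Lemma CS_inner x y : rnorm (inner x y) <= 4 * (rnorm x * rnorm y).
Proof.
have ineq x' y' : rnorm (inner x' y') <= (rnorm x' + rnorm y') ^+ 2.
  have i1 : complex.Re `|'i%R : R[i]| = 1 by rewrite normCi.
  have bd (k : R[i]) : complex.Re `|k| = 1 ->
      rnorm (inner (x' + k *: y') (x' + k *: y')) <= (rnorm x' + rnorm y') ^+ 2.
    move=> k1; rewrite rnorm_inner lerXn2r// ?nnegrE ?rnorm_ge0 ?addr_ge0 ?rnorm_ge0//.
    by rewrite (le_trans (ler_rnormD _ _))// rnormZ k1 mul1r.
  have b1 := bd 1; have b2 := bd (-1); have b3 := bd 'i%R; have b4 := bd (- 'i%R).
  rewrite ?normrN ?normr1 ?scale1r ?scaleN1r ?scaleNr in b1 b2 b3 b4.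
  have {b1} := b1 erefl; have {b2} := b2 erefl; have {b3} := b3 i1; have {b4} := b4 i1.
  set a1 := inner _ _; set a2 := inner _ _; set a3 := inner _ _; set a4 := inner _ _.
  move=> h1 h2 h3 h4.
  have := congr1 (@rnorm _ _) (inner_polarization x' y').
  rewrite -/a1 -/a2 -/a3 -/a4 rnormZ.
  have -> : complex.Re `|4%:R : R[i]| = 4%:R by rewrite normr_nat.
  have := ler_rnormB (a4 - a3) ('i%R *: (a2 - a1)).
  rewrite rnormZ i1 mul1r.
  have := ler_rnormB a4 a3; have := ler_rnormB a2 a1.
  lra.
have [x0|x0] := eqVneq (rnorm x) 0.
  by rewrite (rnorm0_eq0 x0) inner0l !rnorm0 mul0r mulr0.
have [y0|y0] := eqVneq (rnorm y) 0.
  by rewrite (rnorm0_eq0 y0) inner0r !rnorm0 !mulr0.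
have xp : 0 < rnorm x by rewrite lt_neqAle eq_sym x0 rnorm_ge0.
have yp : 0 < rnorm y by rewrite lt_neqAle eq_sym y0 rnorm_ge0.
have := ineq ((rnorm x)^-1%:C *: x) ((rnorm y)^-1%:C *: y).
rewrite innerZ innerZl conj_real !rnormZr !ger0_norm ?invr_ge0 ?rnorm_ge0//.
rewrite !mulVf// mulrA -invfM ler_pdivrMl ?mulr_gt0// => /le_trans; apply.
by rewrite (mulrC (rnorm y)); lra.
Qed.

Lemma cvg_inner (I : Type) (F : set_system I) {FF : Filter F} (u v : I -> H) x y :
  u @ F --> x -> v @ F --> y -> (fun i => inner (u i) (v i)) @ F --> inner x y.
Proof.
move=> ux vy; apply: (@cvg_rnorm_bound _ _ _ _ _ _ _
    (fun i => 4 * (rnorm (u i - x) * rnorm (v i)) + 4 * (rnorm x * rnorm (v i - y)))) => [i|].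
  rewrite (_ : _ - _ = inner (u i - x) (v i) + inner x (v i - y)); last first.
    by rewrite innerBl innerBr addrA subrK.
  by rewrite (le_trans (ler_rnormD _ _))// lerD ?CS_inner.
have d (w : I -> H) z : w @ F --> z -> (fun i => rnorm (w i - z)) @ F --> (0 : R).
  move=> wz; rewrite -(rnorm0 (E := H)) -(subrr z); apply: cvg_rnorm.
  by apply: cvgB => //; exact: cvg_cst.
have -> : 0 = 4 * (0 * rnorm y) + 4 * (rnorm x * 0) :> R.
  by rewrite mul0r !mulr0 addr0.
by apply: cvgD; apply: cvgMr; apply: cvgM;
  [exact: d|exact: cvg_rnorm|exact: cvg_cst|exact: d].
Qed.

End Hilbert.

Lemma gact_bound {R : realType} (G : topologicalGroupType) (B : GCstarAlgebra R G)
  (g : G) (b : B) : rnorm (gact g b) <= 2 * rnorm b.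
Proof.
apply: star_hom_bounded; [exact: gactD|exact: gactZ|exact: gact_cmul|exact: gact_cadj].
Qed.

(** * The Bochner integral *)

Section EIntegral.
Context {R : realType} d {T : measurableType d} (mu : {measure set T -> \bar R}).

Lemma cvge0P (u : nat -> \bar R) : (forall n, 0 <= u n)%E ->
  u @ \oo --> 0%E <-> forall e : R, 0 < e -> \forall n \near \oo, (u n < e%:E)%E.
Proof.
move=> u0; split=> [/fine_cvgP[ufin /cvgrPdist_lt uc] e e0|h].
  apply: filterS2 ufin (uc e e0) => n fn.
  by rewrite sub0r normrN /= ger0_norm ?fine_ge0// -lte_fin fineK.
apply/fine_cvgP; split.
  have := h 1 ltr01; apply: filterS => n un.
  by rewrite ge0_fin_numE// (lt_trans un)// ltry.
apply/cvgrPdist_lt => e /h; apply: filterS => n un.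
rewrite sub0r normrN /= ger0_norm ?fine_ge0// -lte_fin fineK//.
by rewrite ge0_fin_numE// (lt_trans un)// ltry.
Qed.

Lemma ge0_le_integral_real (f g : T -> R) :
  measurable_fun [set: T] f -> measurable_fun [set: T] g ->
  (forall x, 0 <= f x) -> (forall x, f x <= g x) ->
  (\int[mu]_x (f x)%:E <= \int[mu]_x (g x)%:E)%E.
Proof.
move=> mf mg f0 fg; apply: ge0_le_integral => //.
- by move=> x _; rewrite lee_fin.
- exact/measurable_EFinP.
- exact/measurable_EFinP.
- by move=> x _; rewrite lee_fin.
Qed.

Lemma ge0_integralD_real (f g : T -> R) :
  measurable_fun [set: T] f -> measurable_fun [set: T] g ->
  (forall x, 0 <= f x) -> (forall x, 0 <= g x) ->
  (\int[mu]_x (f x + g x)%:E = \int[mu]_x (f x)%:E + \int[mu]_x (g x)%:E)%E.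
Proof.
move=> mf mg f0 g0; rewrite -ge0_integralD//.
- by move=> x _; rewrite lee_fin.
- exact/measurable_EFinP.
- by move=> x _; rewrite lee_fin.
- exact/measurable_EFinP.
Qed.

Lemma ge0_integralZ_real (k : R) (f : T -> R) :
  measurable_fun [set: T] f -> (forall x, 0 <= f x) -> 0 <= k ->
  (\int[mu]_x (k * f x)%:E = k%:E * \int[mu]_x (f x)%:E)%E.
Proof.
move=> mf f0 k0; rewrite -ge0_integralZl_EFin//.
- by move=> x _; rewrite lee_fin.
- exact/measurable_EFinP.
Qed.

Lemma ge0_integral_real (f : T -> R) :
  (forall x, 0 <= f x) -> (0 <= \int[mu]_x (f x)%:E)%E.
Proof. by move=> f0; apply: integral_ge0 => x _; rewrite lee_fin. Qed.

End EIntegral.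

Section Bochner.
Context {R : realType} d {T : measurableType d} (mu : {measure set T -> \bar R}).

Section Simple.
Context {E : normedModType R[i]}.
Implicit Types (s t : seq (set T * E)) (f g : T -> E).

Definition stepf s (x : T) : E := \sum_(p <- s) (\1_(p.1) x : R[i]) *: p.2.

Definition stepint s : E := \sum_(p <- s) (fine (mu p.1))%:C *: p.2.

Definition swf s : Prop :=
  forall p, p \in s -> measurable p.1 /\ (mu p.1 < +oo)%E.

(* A weak form of strong measurability that needs no separability: it is stable
   under subtracting simple functions. *)
Definition nmeas f : Prop :=
  forall c, measurable_fun [set: T] (fun x => rnorm (f x - c)).

Lemma stepf_nil x : stepf [::] x = 0. Proof. by rewrite /stepf big_nil. Qed.

Lemma stepf_cons p s x : stepf (p :: s) x = (\1_(p.1) x : R[i]) *: p.2 + stepf s x.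
Proof. by rewrite /stepf big_cons. Qed.

Lemma swf_cons p s : swf (p :: s) <-> [/\ measurable p.1, (mu p.1 < +oo)%E & swf s].
Proof.
split=> [h|[mp pf sw]].
  have [] := h p; first by rewrite mem_head.
  by split=> // q qs; apply: h; rewrite inE qs orbT.
by move=> q; rewrite inE => /orP[/eqP ->//|]; exact: sw.
Qed.

Lemma swf_cat s t : swf s -> swf t -> swf (s ++ t).
Proof. by move=> hs ht p; rewrite mem_cat => /orP[/hs|/ht]. Qed.

Lemma indic_real (A : set T) x : (\1_A x : R[i]) = (\1_A x : R)%:C.
Proof. by rewrite !indicE; case: (_ \in _). Qed.

(** Subtracting one step 1_A b changes the distance to c into the distance of f to b + c on A and to
    c off A. The quantification over all constants in [nmeas] is what lets the induction go
    through. *)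
Lemma nmeas_sub_simple f s : nmeas f -> swf s -> nmeas (fun x => f x - stepf s x).
Proof.
elim: s f => [|[A b] s IH] f mf; first by under [X in nmeas X]eq_fun do rewrite stepf_nil subr0.
move=> /swf_cons[/= mA _ sw].
have -> : (fun x => f x - stepf ((A, b) :: s) x) =
    (fun x => (f x - (\1_A x : R[i]) *: b) - stepf s x).
  by apply/funext => x; rewrite stepf_cons opprD addrA.
apply: IH => // c.
have -> : (fun x => rnorm (f x - (\1_A x : R[i]) *: b - c)) =
    (fun x => \1_A x * rnorm (f x - (b + c)) + (1 - \1_A x) * rnorm (f x - c)).
  apply/funext => x; rewrite !indicE; case: (x \in A).
    by rewrite scale1r mul1r subrr mul0r addr0 opprD addrA.
  by rewrite scale0r subr0 mul0r add0r subr0 mul1r.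
apply: measurable_funD; apply: measurable_funM => //.
by apply: measurable_funB => //; exact: measurable_indic.
Qed.

Lemma nmeas_cst c : nmeas (fun=> c).
Proof. by move=> b; exact: measurable_cst. Qed.

Lemma measurable_stepf s (c : E) : swf s ->
  measurable_fun [set: T] (fun x => rnorm (c + stepf s x)).
Proof.
move=> sw; have /(_ 0) := nmeas_sub_simple (nmeas_cst (- c)) sw.
by under [X in measurable_fun _ X -> _]eq_fun do rewrite subr0 -rnormN opprB opprK addrC.
Qed.

(** The sets of a simple function may overlap. The domain D and the constant c are generalized so
    that the head (A, b) is absorbed by splitting D: the constant becomes c + b on D inside A and
    stays c outside. No disjoint normal form is required. *)
Lemma stepint_triangle_in s (D : set T) (c : E) :
  measurable D -> (mu D < +oo)%E -> swf s ->
  ((rnorm ((fine (mu D))%:C *: c + \sum_(p <- s) (fine (mu (p.1 `&` D)))%:C *: p.2))%:E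
    <= \int[mu]_(x in D) (rnorm (c + stepf s x))%:E)%E.
Proof.
elim: s D c => [|[A b] s IH] D c mD Df.
  move=> _; rewrite big_nil addr0.
  under eq_integral do rewrite stepf_nil addr0.
  rewrite (integral_cst mu mD (rnorm c)%:E) rnormZr ger0_norm ?fine_ge0//.
  by rewrite EFinM fineK ?ge0_fin_numE// muleC.
move=> /swf_cons[/= mA Af sw].
have mDA : measurable (D `&` A) by exact: measurableI.
have mDA' : measurable (D `\` A) by exact: measurableD.
have le_fin X : measurable X -> X `<=` D -> (mu X < +oo)%E.
  by move=> mX XD; rewrite (le_lt_trans _ Df)// le_measure ?inE.
have DAf := le_fin _ mDA (@subIsetl _ D A).
have DAf' := le_fin _ mDA' (@subDsetl _ D A).
have DE : D = (D `&` A) `|` (D `\` A) by rewrite setUIDK.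
have split X : measurable X ->
    (fine (mu (X `&` D)))%:C = (fine (mu (X `&` (D `&` A))))%:C + (fine (mu (X `&` (D `\` A))))%:C :> R[i].
  move=> mX; have mXD : measurable (X `&` D) by exact: measurableI.
  rewrite -rmorphD /= (measureDI mu mXD mA) fineD; last 2 first.
  - rewrite ge0_fin_numE// le_fin//; first exact: measurableD.
    by move=> x [[]].
  - rewrite ge0_fin_numE// le_fin//; first exact: measurableI.
    by move=> x [[]].
  by rewrite addrC setIDA setIA.
have := IH _ (c + b) mDA DAf sw; have := IH _ c mDA' DAf' sw.
set I1 := (X in (_ <= X)%E -> _ -> _); set I2 := (X in _ -> (_ <= X)%E -> _).
move=> h1 h2.
have -> : (\int[mu]_(x in D) (rnorm (c + stepf ((A, b) :: s) x))%:E = I2 + I1)%E.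
  rewrite {1}DE ge0_integral_setU//.
  - congr (_ + _)%E; apply: eq_integral => x.
      by rewrite inE => -[_ xA]; rewrite stepf_cons /= indicE mem_set// scale1r addrA.
    by rewrite inE => -[_ xA]; rewrite stepf_cons /= indicE memNset// scale0r add0r.
  - apply/measurable_EFinP; apply: measurable_funTS.
    by apply: measurable_stepf; apply/swf_cons.
  - by move=> x _; rewrite lee_fin rnorm_ge0.
  - by apply/disj_set2P; rewrite setDE setIACA setICr setI0.
refine (le_trans _ (leeD h2 h1)); rewrite -EFinD lee_fin.
apply: le_trans (ler_rnormD _ _).
rewrite le_eqVlt; apply/orP; left; apply/eqP; congr rnorm.
rewrite big_cons /=.
have -> : (fine (mu D))%:C = (fine (mu (D `&` A)))%:C + (fine (mu (D `\` A)))%:C :> R[i].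
  by have := split _ (@measurableT _ T); rewrite !setTI.
have -> : \sum_(p <- s) (fine (mu (p.1 `&` D)))%:C *: p.2 =
    \sum_(p <- s) (fine (mu (p.1 `&` (D `&` A))))%:C *: p.2 +
    \sum_(p <- s) (fine (mu (p.1 `&` (D `\` A))))%:C *: p.2.
  rewrite -big_split /=; apply: eq_big_seq => p ps.
  by rewrite split ?scalerDl//; have [] := sw p ps.
rewrite scalerDl scalerDr (setIC A D).
by rewrite [LHS](AC (2*(1*2)) ((1*3*4)*(2*5))).
Qed.

Lemma stepint_triangle s : swf s ->
  ((rnorm (stepint s))%:E <= \int[mu]_x (rnorm (stepf s x))%:E)%E.
Proof.
move=> sw; pose D := \big[setU/set0]_(p <- s) p.1.
have [mD Df] : measurable D /\ (mu D < +oo)%E.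
  rewrite /D; elim: s sw {D} => [_|p s IH /swf_cons[mp pf /IH[mD Df]]].
    by rewrite big_nil measure0; split.
  rewrite big_cons; split; first exact: measurableU.
  rewrite (le_lt_trans (measureU2 _ _ _))// lte_add_pinfty//.
have sD p : p \in s -> p.1 `<=` D.
  rewrite /D; elim: s {sw D mD Df} => [//|q s IH]; rewrite inE big_cons.
  by move=> /orP[/eqP ->|/IH h] x px; [left|right; exact: h].
have := stepint_triangle_in 0 mD Df sw.
rewrite scaler0 add0r.
have -> : \sum_(p <- s) (fine (mu (p.1 `&` D)))%:C *: p.2 = stepint s.
  by apply: eq_big_seq => p /sD pD; rewrite (setIidl pD).
move=> /le_trans; apply.
under eq_integral do rewrite add0r.
apply: ge0_subset_integral => //; last by move=> x _; rewrite lee_fin rnorm_ge0.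
apply/measurable_EFinP.
have := measurable_stepf 0 sw.
by under [X in measurable_fun _ X -> _]eq_fun do rewrite add0r.
Qed.

Lemma stepint_cat s t : stepint (s ++ t) = stepint s + stepint t.
Proof. by rewrite /stepint big_cat. Qed.

Lemma stepf_cat s t x : stepf (s ++ t) x = stepf s x + stepf t x.
Proof. by rewrite /stepf big_cat. Qed.

Definition sopp s := [seq (p.1, - p.2) | p <- s].

Lemma stepint_opp s : stepint (sopp s) = - stepint s.
Proof. by rewrite /stepint big_map -sumrN; apply: eq_bigr => p _; rewrite scalerN. Qed.

Lemma stepf_opp s x : stepf (sopp s) x = - stepf s x.
Proof. by rewrite /stepf big_map -sumrN; apply: eq_bigr => p _; rewrite scalerN. Qed.

Lemma swf_opp s : swf s -> swf (sopp s).
Proof. by move=> sw q /mapP[p ps ->]; exact: (sw _ ps). Qed.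

Lemma stepint_dist s t : swf s -> swf t ->
  ((rnorm (stepint s - stepint t))%:E <= \int[mu]_x (rnorm (stepf s x - stepf t x))%:E)%E.
Proof.
move=> sw tw; have := stepint_triangle (swf_cat sw (swf_opp tw)).
rewrite stepint_cat stepint_opp; under eq_integral do rewrite stepf_cat stepf_opp.
by [].
Qed.

End Simple.

Section Integral.
Context {E : completeNormedModType R[i]}.
Implicit Types (f g : T -> E) (s : seq (set T * E)).

Local Notation err f s := (fun x => rnorm (f x - stepf s x)).

Lemma is_bochnerP f (I : E) : is_bochner mu f I <->
  exists s : nat -> seq (set T * E),
  [/\ forall n, swf (s n),
      forall n, measurable_fun [set: T] (err f (s n)),
      forall e : R, 0 < e -> \forall n \near \oo, (\int[mu]_x (err f (s n) x)%:E < e%:E)%E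
    & stepint (s n) @[n --> \oo] --> I].
Proof.
by split=> -[s [sw ms se sI]]; exists s; split=> //; apply/cvge0P => // n;
   apply: ge0_integral_real => x; exact: rnorm_ge0.
Qed.

(** The difference of f and g enters through a measurable majorant [k], because measurability of its
    norm is not among the data. Uniqueness, norm bounds and limit theorems for the integral all
    follow from this estimate. *)
Lemma bochner_dist f g (I J : E) (k : T -> R) :
  is_bochner mu f I -> is_bochner mu g J ->
  measurable_fun [set: T] k -> (forall x, rnorm (f x - g x) <= k x) ->
  ((rnorm (I - J))%:E <= \int[mu]_x (k x)%:E)%E.
Proof.
move=> /is_bochnerP[s [sw ms se sI]] /is_bochnerP[t [tw mt te tJ]] mk fgk.
have k0 x : 0 <= k x by rewrite (le_trans _ (fgk x))// rnorm_ge0.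
apply/lee_addgt0Pr => e e0.
(* One third for each of the two simple approximations, one for the convergence of the difference of
   their integrals. *)
have e4 : 0 < e / 3 by rewrite divr_gt0.
have /cvg_rnormP/(_ _ e4) sd : stepint (s n) - stepint (t n) @[n --> \oo] --> I - J by exact: cvgB.
have [n [[h1 h2] h3]] := filter_ex (filterI (filterI (se _ e4) (te _ e4)) sd).
have le1 : ((rnorm (I - J))%:E <= (rnorm (stepint (s n) - stepint (t n)))%:E + (e / 3)%:E)%E.
  rewrite -EFinD lee_fin; have := ler_rnormBD (I - J) (stepint (s n) - stepint (t n)) 0.
  rewrite !subr0 (rnormB (I - J)) => h4; rewrite (le_trans h4)// addrC lerD2l.
  exact: ltW.
have eE : e = e / 3 + e / 3 + e / 3 by field.
apply: (le_trans le1).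
suff : ((rnorm (stepint (s n) - stepint (t n)))%:E <= \int[mu]_x (k x)%:E + (e / 3 + e / 3)%:E)%E.
  by move=> le0; rewrite [X in (_ <= _ + X%:E)%E]eE EFinD addeA leeD2r.
have le2 := stepint_dist (sw n) (tw n).
have le3 : (\int[mu]_x (rnorm (stepf (s n) x - stepf (t n) x))%:E <=
    \int[mu]_x ((err f (s n) x + k x) + err g (t n) x)%:E)%E.
  apply: ge0_le_integral_real.
  - have := measurable_stepf 0 (swf_cat (sw n) (swf_opp (tw n))).
    by under [X in measurable_fun _ X -> _]eq_fun do rewrite add0r stepf_cat stepf_opp.
  - by apply: measurable_funD => //; exact: measurable_funD.
  - by move=> x; exact: rnorm_ge0.
  - move=> x; have := ler_rnormBD (stepf (s n) x) (f x) (stepf (t n) x).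
    have := ler_rnormBD (f x) (g x) (stepf (t n) x).
    rewrite (rnormB (stepf (s n) x) (f x)); have := fgk x; lra.
apply: (le_trans le2); apply: (le_trans le3).
rewrite ge0_integralD_real//; last 3 first.
- exact: measurable_funD.
- by move=> x; rewrite addr_ge0// rnorm_ge0.
- by move=> x; exact: rnorm_ge0.
rewrite ge0_integralD_real//; last by move=> x; exact: rnorm_ge0.
rewrite addeAC [in X in (X <= _)%E]addeC leeD2l// EFinD.
by rewrite leeD ?ltW.
Qed.

Lemma bochner_unique f (I J : E) : is_bochner mu f I -> is_bochner mu f J -> I = J.
Proof.
move=> fI fJ; apply/subr0_eq/rnorm0_eq0/eqP; rewrite eq_le rnorm_ge0 andbT -lee_fin.
have m0 : measurable_fun [set: T] (fun=> 0 : R) by exact: measurable_cst.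
have := bochner_dist fI fJ m0.
by rewrite integral0; apply => x; rewrite subrr rnorm0.
Qed.

Lemma bochner_eq f (I : E) : is_bochner mu f I -> bochner mu f = I.
Proof.
by move=> fI; apply: bochner_unique (fI); rewrite /bochner; apply: (@xgetPex _ _ [set I | is_bochner mu f I]); exists I.
Qed.

Lemma bochnerP f (I : E) : is_bochner mu f I -> is_bochner mu f (bochner mu f).
Proof. by move=> fI; rewrite (bochner_eq fI). Qed.

Lemma bochner_approx f : nmeas f ->
  (forall e : R, 0 < e -> exists2 s, swf s & (\int[mu]_x (err f s x)%:E < e%:E)%E) ->
  exists I, is_bochner mu f I.
Proof.
move=> mf fs.
have {}fs n : exists s, swf s /\ (\int[mu]_x (err f s x)%:E < (n.+1%:R^-1)%:E)%E.
  by have [|s ? ?] := fs (n.+1%:R^-1); [rewrite invr_gt0|exists s].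
have [s hs] := choice fs.
have sw n := (hs n).1; have se n := (hs n).2.
have ms n : measurable_fun [set: T] (err f (s n)).
  by have := nmeas_sub_simple mf (sw n) 0; under [X in measurable_fun _ X -> _]eq_fun do rewrite subr0.
have sd m n : rnorm (stepint (s m) - stepint (s n)) < m.+1%:R^-1 + n.+1%:R^-1.
  rewrite -lte_fin; apply: (le_lt_trans (stepint_dist (sw m) (sw n))).
  rewrite EFinD; apply: (le_lt_trans _ (lteD (se m) (se n))).
  rewrite -ge0_integralD_real//; last 2 first.
  - by move=> x; exact: rnorm_ge0.
  - by move=> x; exact: rnorm_ge0.
  apply: ge0_le_integral_real.
  - have := measurable_stepf 0 (swf_cat (sw m) (swf_opp (sw n))).
    by under [X in measurable_fun _ X -> _]eq_fun do rewrite add0r stepf_cat stepf_opp.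
  - exact: measurable_funD.
  - by move=> x; exact: rnorm_ge0.
  - by move=> x; rewrite (rnormB (f x) (stepf (s m) x)) ler_rnormBD.
have small (e : R) : 0 < e -> exists N, forall n, (N <= n)%N -> n.+1%:R^-1 < e.
  move=> e0; have [N _ NP] := near_infty_natSinv_lt (PosNum e0).
  by exists N => n /NP.
have [|I sI] := @cauchy_seq_cvg _ _ (fun n => stepint (s n)).
  move=> e e0; have [|N NP] := small (e / 2); first by rewrite divr_gt0.
  exists N => m n /NP h1 /NP h2; apply: (lt_trans (sd m n)).
  by rewrite [ltRHS]splitr ltrD.
exists I; apply/is_bochnerP; exists s; split=> // e /small[N NP].
by exists N => // n /= /NP h; apply: (lt_trans (se n)); rewrite lte_fin.
Qed.

(** A simple function close to some f_n is close to f in mean, so f is integrable; [bochner_dist]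
    then gives the limit. It serves for multipliers, where the f_n are better behaved than f. *)
Lemma bochner_lim (f_ : nat -> T -> E) (I_ : nat -> E) (k_ : nat -> T -> R) f :
  (forall n, is_bochner mu (f_ n) (I_ n)) -> nmeas f ->
  (forall n, measurable_fun [set: T] (k_ n)) ->
  (forall n x, rnorm (f_ n x - f x) <= k_ n x) ->
  (forall e : R, 0 < e -> \forall n \near \oo, (\int[mu]_x (k_ n x)%:E < e%:E)%E) ->
  exists2 I, is_bochner mu f I & I_ @ \oo --> I.
Proof.
move=> fI mf mk fk kc.
have k0 n x : 0 <= k_ n x by rewrite (le_trans _ (fk n x))// rnorm_ge0.
have [I hI] : exists I, is_bochner mu f I.
  apply: bochner_approx => // e e0.
  have e2 : 0 < e / 2 by rewrite divr_gt0.
  have [n nP] := filter_ex (kc _ e2).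
  have /is_bochnerP[s [sw ms se _]] := fI n.
  have [m mP] := filter_ex (se _ e2).
  exists (s m) => //.
  have -> : e = e / 2 + e / 2 by field.
  rewrite EFinD; apply: (le_lt_trans _ (lteD nP mP)).
  rewrite -ge0_integralD_real//; last by move=> x; exact: rnorm_ge0.
  apply: ge0_le_integral_real.
  - by have := nmeas_sub_simple mf (sw m) 0; under [X in measurable_fun _ X -> _]eq_fun do rewrite subr0.
  - exact: measurable_funD.
  - by move=> x; exact: rnorm_ge0.
  - move=> x; have := ler_rnormBD (f x) (f_ n x) (stepf (s m) x); have := fk n x.
    rewrite (rnormB (f_ n x) (f x)); lra.
exists I => //; apply/cvg_rnormP => e /kc; apply: filterS => n nP.
rewrite -lte_fin; apply: le_lt_trans nP.
exact: (bochner_dist (fI n) hI).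
Qed.

Lemma bochner_norm f (I : E) (k : T -> R) : is_bochner mu f I ->
  measurable_fun [set: T] k -> (forall x, rnorm (f x) <= k x) ->
  ((rnorm I)%:E <= \int[mu]_x (k x)%:E)%E.
Proof.
move=> fI mk fk.
have b0 : is_bochner mu (fun=> 0 : E) 0.
  apply/is_bochnerP; exists (fun=> [::]); split=> //.
  - move=> n; under [X in measurable_fun _ X]eq_fun do rewrite stepf_nil subr0.
    exact: measurable_cst.
  - move=> e e0; apply: nearW => n; under eq_integral do rewrite stepf_nil subr0 rnorm0.
    by rewrite integral0 lte_fin.
  - by rewrite /stepint; under eq_fun do rewrite big_nil; exact: cvg_cst.
rewrite -[I]subr0; apply: (bochner_dist fI b0) => // x.
by rewrite subr0.
Qed.

(** Measurability of the sum is a hypothesis: measurable distances of f and g to constants do not by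
    themselves give those of f + g when E is not separable. *)
Lemma bochnerD f g (I J : E) : is_bochner mu f I -> is_bochner mu g J ->
  nmeas (fun x => f x + g x) -> is_bochner mu (fun x => f x + g x) (I + J).
Proof.
move=> /is_bochnerP[s [sw ms se sI]] /is_bochnerP[t [tw mt te tJ]] mfg.
have w n : swf (s n ++ t n) by exact: swf_cat.
have m n : measurable_fun [set: T] (err (fun x => f x + g x) (s n ++ t n)).
  by have := nmeas_sub_simple mfg (w n) 0; under [X in measurable_fun _ X -> _]eq_fun do rewrite subr0.
apply/is_bochnerP; exists (fun n => s n ++ t n); split => //.
  move=> e e0; have e2 : 0 < e / 2 by rewrite divr_gt0.
  apply: filterS2 (se _ e2) (te _ e2) => n h1 h2.
  have -> : e = e / 2 + e / 2 by field.
  rewrite EFinD; apply: (le_lt_trans _ (lteD h1 h2)).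
  rewrite -ge0_integralD_real//; last 2 first.
  - by move=> x; exact: rnorm_ge0.
  - by move=> x; exact: rnorm_ge0.
  apply: ge0_le_integral_real => //.
  - exact: measurable_funD.
  - by move=> x; exact: rnorm_ge0.
  - by move=> x; rewrite stepf_cat opprD addrACA ler_rnormD.
by under eq_fun do rewrite stepint_cat; exact: cvgD.
Qed.

Lemma bochner_push (h : T -> T) f (I : E) : measurable_fun [set: T] h ->
  (forall A, measurable A -> mu (h @^-1` A) = mu A) ->
  is_bochner mu f I -> is_bochner mu (f \o h) I.
Proof.
move=> mh hmu /is_bochnerP[s [sw ms se sI]].
pose t n := [seq (h @^-1` p.1, p.2) | p <- s n].
have sE n x : stepf (t n) x = stepf (s n) (h x).
  by rewrite /stepf big_map; exact: eq_bigr.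
apply/is_bochnerP; exists t; split.
- move=> n q /mapP[p ps ->] /=; have [mp pf] := sw _ _ ps.
  by rewrite hmu//; split=> //; rewrite -[X in measurable X]setTI; exact: mh.
- move=> n; under [X in measurable_fun _ X]eq_fun do rewrite sE.
  exact: (measurableT_comp (ms n)).
- move=> e /se; apply: filterS => n; apply: le_lt_trans.
  under eq_integral do rewrite sE.
  rewrite le_eqVlt; apply/orP; left; apply/eqP.
  transitivity (\int[pushforward mu h]_x (rnorm (f x - stepf (s n) x))%:E)%E.
    rewrite ge0_integral_pushforward//; first exact/measurable_EFinP.
    by move=> x _; rewrite lee_fin rnorm_ge0.
  by apply: eq_measure_integral => A mA _; exact: hmu.
- rewrite (_ : (fun n => stepint (t n)) = fun n => stepint (s n))//.
  apply/funext => n; rewrite /stepint big_map; apply: eq_big_seq => p ps /=.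
  by rewrite hmu//; have [] := sw _ _ ps.
Qed.

End Integral.

(** Only real homogeneity is asked of [phi], so that the conjugate-linear involution of B
    qualifies. *)
Lemma bochner_map (E F : completeNormedModType R[i]) (phi : E -> F) (M : R)
    (f : T -> E) (I : E) :
  (forall x y, phi (x + y) = phi x + phi y) ->
  (forall (r : R) x, phi (r%:C *: x) = r%:C *: phi x) ->
  (forall x, rnorm (phi x) <= M * rnorm x) ->
  nmeas (phi \o f) -> is_bochner mu f I -> is_bochner mu (phi \o f) (phi I).
Proof.
move=> phiD phiZ phiM mphi /is_bochnerP[s [sw ms se sI]].
have phi0 : phi 0 = 0 by rewrite -(scale0r 0) -[0 : R[i]]/((0 : R)%:C) phiZ scale0r.
have phiS (J : Type) (r : seq J) (G : J -> E) : phi (\sum_(i <- r) G i) = \sum_(i <- r) phi (G i).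
  by elim: r => [|i r IH]; rewrite ?big_nil// !big_cons phiD IH.
have phiB x y : phi (x - y) = phi x - phi y.
  rewrite phiD; congr (_ + _); rewrite -scaleN1r.
  have -> : -1 = (-1 : R)%:C :> R[i] by rewrite rmorphN1.
  by rewrite phiZ rmorphN1 scaleN1r.
pose M' := `|M| + 1.
have M'0 : 0 < M' by rewrite ltr_wpDl.
have phiM' x : rnorm (phi x) <= M' * rnorm x.
  apply: (le_trans (phiM x)); rewrite ler_wpM2r ?rnorm_ge0//.
  by rewrite (le_trans (ler_norm _))// /M' lerDl.
pose t n := [seq (p.1, phi p.2) | p <- s n].
have sE n x : stepf (t n) x = phi (stepf (s n) x).
  by rewrite /stepf big_map phiS; apply: eq_bigr => p _; rewrite indic_real phiZ.
have sIE n : stepint (t n) = phi (stepint (s n)).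
  by rewrite /stepint big_map phiS; apply: eq_bigr => p _; rewrite phiZ.
have tw n : swf (t n) by move=> q /mapP[p ps ->]; exact: (sw _ _ ps).
have mt n : measurable_fun [set: T] (fun x => rnorm ((phi \o f) x - stepf (t n) x)).
  by have := nmeas_sub_simple mphi (tw n) 0; under [X in measurable_fun _ X -> _]eq_fun do rewrite subr0.
apply/is_bochnerP; exists t; split=> //.
  move=> e e0; have : 0 < e / M' by rewrite divr_gt0.
  move=> /se; apply: filterS => n h.
  apply: (@le_lt_trans _ _ (\int[mu]_x (M' * rnorm (f x - stepf (s n) x))%:E)%E).
    apply: ge0_le_integral_real => //.
    - by apply: measurable_funM => //; exact: measurable_cst.
    - by move=> x; exact: rnorm_ge0.
    - by move=> x; rewrite sE /= -phiB.
  rewrite ge0_integralZ_real//; [|by move=> x; exact: rnorm_ge0|exact: ltW].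
  have -> : e = M' * (e / M') by rewrite mulrC divfK ?gt_eqF.
  by rewrite EFinM lte_pmul2l.
under eq_fun do rewrite sIE.
apply/cvg_rnormP => e e0; have : 0 < e / M' by rewrite divr_gt0.
move: sI => /cvg_rnormP sI /sI; apply: filterS => n h; rewrite -phiB.
by rewrite (le_lt_trans (phiM' _))// mulrC -ltr_pdivlMr.
Qed.

End Bochner.

(** * Riemann sums over compact sets *)

Section BorelGroup.
Context {R : realType} {G : topologicalGroupType}.

Lemma open_borel (U : set G) : open U -> measurable (U : set (borel G)).
Proof. by move=> oU; apply: sub_sigma_algebra. Qed.

Lemma closed_borel (U : set G) : closed U -> measurable (U : set (borel G)).
Proof.
move=> cU; rewrite -[U]setCK; apply: measurableC; apply: open_borel.
exact: closed_openC.
Qed.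

Lemma continuous_borel_real (f : G -> R) : continuous f ->
  measurable_fun [set: borel G] (f : borel G -> R).
Proof.
move=> cf; apply: (measurability _ (RGenOInfty.measurableE R)).
move=> _ [_ [a ->] <-]; rewrite setTI; apply: open_borel.
by apply: open_comp => [x _|]; [exact: cf|exact: interval_open].
Qed.

Lemma continuous_borel (f : G -> G) : continuous f ->
  measurable_fun [set: borel G] (f : borel G -> borel G).
Proof.
move=> cf; apply: (@measurability _ _ (borel G) (borel G) setT f (@open G)) => //.
move=> _ [A oA <-]; rewrite setTI; apply: open_borel.
by apply: open_comp => [x _|]; [exact: cf|].
Qed.

Lemma continuous_mulg2 (T : topologicalType) (f h : T -> G) :
  continuous f -> continuous h -> continuous (fun x => (f x * h x)%g).
Proof.
move=> cf ch x; apply: (@continuous2_cvg _ _ _ _ _ _ f h (fun a b => (a * b)%g)).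
- exact: (@mulg_continuous G (f x, h x)).
- exact: cf.
- exact: ch.
Qed.

Lemma continuous_mulgl (g : G) : continuous (fun x : G => (g * x)%g).
Proof.
by apply: continuous_mulg2 => x; [exact: cvg_cst|exact: cvg_id].
Qed.

Context {E : normedModType R[i]}.

Lemma continuous_rnorm (T : topologicalType) (c : T -> E) : continuous c ->
  continuous (fun x => rnorm (c x)).
Proof. by move=> cc x; apply: cvg_rnorm; exact: cc. Qed.

Lemma nmeas_continuous (c : G -> E) : continuous c -> @nmeas R _ (borel G) E c.
Proof.
move=> cc b; apply: continuous_borel_real; apply: continuous_rnorm => x.
by apply: cvgB; [exact: cc|exact: cvg_cst].
Qed.

(** In the absence of separability the product is not treated as a composite of measurable maps.
    Rounding phi down to multiples of 1/(n+1) leaves countably many values; on each level set the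
    function is continuous, so preimages of open rays are countable unions of measurable sets. *)
Lemma nmeas_scale_continuous (phi : borel G -> R) (c : G -> E) :
  measurable_fun [set: borel G] phi -> continuous c ->
  @nmeas R _ (borel G) E (fun x => (phi x)%:C *: c x).
Proof.
move=> mphi cc b.
pose fl n (x : borel G) : int := Num.floor (n.+1%:R * phi x).
pose phin n (x : borel G) : R := (fl n x)%:~R / n.+1%:R.
have phin_dist n x : `|phin n x - phi x| <= n.+1%:R^-1.
  have n0 : 0 < n.+1%:R :> R by rewrite ltr0n.
  rewrite -(ler_pM2l n0) divff ?gt_eqF// -[X in X * _](gtr0_norm n0) -normrM mulrBr.
  rewrite /phin mulrCA divff ?gt_eqF// mulr1 ler_norml; apply/andP; split.
    have := floorD1_gt (n.+1%:R * phi x); rewrite intrD1 -/(fl n x) => h.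
    by rewrite lerNl opprB lerBlDl ltW.
  have := floor_le (n.+1%:R * phi x); rewrite -/(fl n x) => h.
  by rewrite lerBlDl (le_trans h)// lerDl.
have mfl n (k : int) : measurable [set x : borel G | fl n x = k].
  have -> : [set x : borel G | fl n x = k] =
      (fun x => n.+1%:R * phi x) @^-1` `[k%:~R, (k + 1)%:~R[%classic.
    apply/seteqP; split=> x /=; rewrite in_itv /=.
      by move=> <-; rewrite floor_le floorD1_gt.
    by move=> h; apply: floor_def.
  rewrite -[X in measurable X]setTI.
  have : measurable_fun [set: borel G] (fun x => n.+1%:R * phi x).
    by apply: measurable_funM => //; exact: measurable_cst.
  by apply => //; exact: measurable_itv.
apply: (@measurable_fun_cvg _ _ _ _ (fun n x => rnorm ((phin n x)%:C *: c x - b))).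
  move=> n; apply: (measurability _ (RGenOInfty.measurableE R)).
  move=> _ [_ [a ->] <-]; rewrite setTI.
  have -> : (fun x => rnorm ((phin n x)%:C *: c x - b)) @^-1` `]a, +oo[ =
    \bigcup_(k : int) ([set x : borel G | fl n x = k] `&`
       (fun x => rnorm ((k%:~R / n.+1%:R)%:C *: c x - b)) @^-1` `]a, +oo[%classic).
    apply/seteqP; split=> x.
      by move=> h; exists (fl n x).
    by move=> [k _ [/= hk]]; rewrite /phin hk.
  apply: countable_bigcupT_measurable => [|k]; first exact: countableP.
  apply: measurableI; first exact: mfl.
  apply: open_borel; apply: open_comp => [x _|]; last exact: interval_open.
  apply: continuous_rnorm => {}x; apply: cvgB; last exact: cvg_cst.
  by apply: cvgZr; exact: cc.
move=> x _; apply: cvg_rnorm; apply: cvgB; last exact: cvg_cst.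
apply: (@cvg_rnorm_bound _ _ _ _ _ _ _ (fun n => n.+1%:R^-1 * rnorm (c x))).
  move=> n; rewrite -scalerBl -rmorphB rnormZr ler_wpM2r ?rnorm_ge0//.
rewrite -(mul0r (rnorm (c x))); apply: cvgM; last exact: cvg_cst.
exact: cvg_harmonic.
Qed.

End BorelGroup.

Section Partition.
Context {R : realType} {G : topologicalGroupType}.
Implicit Types (K D : set G) (W : G -> set G) (s : seq (set (borel G) * G)).

(** [W] is a gauge: the piece containing x must have a tag whose neighbourhood contains x. The
    unique piece is singled out by its position in the list, because [stepf] adds up the entries
    with multiplicity. *)
Definition tagged_partition K W s : Prop :=
  (forall p, p \in s -> [/\ measurable p.1, p.1 `<=` K & K p.2]) /\
  (forall x, K x -> exists s1 p s2,
    [/\ s = s1 ++ p :: s2, p.1 x, W p.2 x & forall q, q \in s1 ++ s2 -> ~ q.1 x]).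

Fixpoint tagged_pieces W (xs : seq G) D : seq (set (borel G) * G) :=
  if xs is x :: xs' then
    (D `&` (W x)^°, x) :: tagged_pieces W xs' (D `\` (W x)^°)
  else [::].

Lemma tagged_pieces_sub W xs D p : p \in tagged_pieces W xs D ->
  p.1 `<=` D /\ p.2 \in xs.
Proof.
elim: xs D => [//|x xs IH] D /=; rewrite inE => /orP[/eqP -> /=|/IH[h1 h2]].
  by rewrite mem_head; split=> // y [].
by rewrite inE h2 orbT; split=> // y /h1 [].
Qed.

Lemma tagged_pieces_measurable W xs (D : set (borel G)) p : measurable D ->
  p \in tagged_pieces W xs D -> measurable p.1.
Proof.
elim: xs D => [//|x xs IH] D /= mD; rewrite inE => /orP[/eqP -> /=|].
  by apply: measurableI => //; apply: open_borel; exact: open_interior.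
by apply: IH; apply: measurableD => //; apply: open_borel; exact: open_interior.
Qed.

Lemma tagged_pieces_cover W xs D y : D y -> (exists2 x, x \in xs & (W x)^° y) ->
  exists s1 p s2, [/\ tagged_pieces W xs D = s1 ++ p :: s2, p.1 y, W p.2 y
     & forall q, q \in s1 ++ s2 -> ~ q.1 y].
Proof.
elim: xs D => [D _ []//|x xs IH] D Dy [z zxs Wzy] /=.
have [Wxy|nWxy] := pselect ((W x)^° y).
  exists [::], (D `&` (W x)^°, x), (tagged_pieces W xs (D `\` (W x)^°)).
  split=> //=; first exact: interior_subset.
  by move=> q /tagged_pieces_sub[h _] /h [].
have [||s1 [p [s2 [-> py Wpy nq]]]] := IH (D `\` (W x)^°).
- by split.
- exists z => //; move: zxs; rewrite inE => /orP[/eqP zx|//].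
  by rewrite zx in Wzy.
- exists ((D `&` (W x)^°, x) :: s1), p, s2; split=> // q.
  by rewrite inE => /orP[/eqP -> []|]; [|exact: nq].
Qed.

Hypothesis G_hausdorff : hausdorff_space G.

Lemma tagged_partition_exists K W : compact K -> (forall x, K x -> nbhs x (W x)) ->
  exists s, tagged_partition K W s.
Proof.
move=> cK KW; have := cK; rewrite compact_cover => /(_ G K (fun x => (W x)^°)).
case=> [x _|x Kx|D' D'K cov]; first exact: open_interior.
  by exists x => //; exact: KW.
exists (tagged_pieces W (finmap.enum_fset D') K); split=> [p ps|x Kx].
  have [h1 h2] := tagged_pieces_sub ps; split=> //.
    apply: tagged_pieces_measurable ps; apply: closed_borel.
    exact: compact_closed.
  by have := D'K _ h2; rewrite inE.
by apply: tagged_pieces_cover => //; have [y] := cov _ Kx; exists y.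
Qed.

(* The partitions subordinate to ever finer assignments of neighbourhoods: the
   filter along which Riemann sums over [K] converge. *)
Definition partition_filter K : set_system (seq (set (borel G) * G)) :=
  filter_from [set W : G -> set G | forall x, K x -> nbhs x (W x)]
    (fun W => tagged_partition K W).

Lemma partition_filter_proper K : compact K -> ProperFilter (partition_filter K).
Proof.
move=> cK; apply: filter_from_proper; last first.
  by move=> W KW; exact: tagged_partition_exists.
apply: filter_from_filter; first by exists (fun=> setT) => x _; exact: filterT.
move=> W1 W2 h1 h2; exists (fun x => W1 x `&` W2 x).
  by move=> x Kx; apply: filterI; [exact: h1|exact: h2].
move=> s [hs hx]; split; split=> // x /hx[s1 [p [s2 [-> px [Wp1 Wp2] nq]]]];
  by exists s1, p, s2.
Qed.

Definition tagmap (E : Type) (f : G -> E) s : seq (set (borel G) * E) :=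
  [seq (p.1, f p.2) | p <- s].

Section Eval.
Context {E : normedModType R[i]}.
Context (mu : {measure set (borel G) -> \bar R}).

Lemma tagged_stepf_in K W s x : tagged_partition K W s -> K x ->
  exists2 y, K y /\ W y x & forall (f : G -> E), stepf (tagmap f s) x = f y.
Proof.
move=> [hs hx] Kx; have [s1 [p [s2 [sE px Wx nq]]]] := hx _ Kx.
exists p.2; first by have [] := hs p; rewrite ?sE ?mem_cat ?mem_head ?orbT.
move=> f; rewrite /stepf big_map sE big_cat big_cons /= indicE mem_set// scale1r.
rewrite big_seq big1 => [|q qs]; last first.
  by rewrite indicE memNset ?scale0r//; apply: nq; rewrite mem_cat qs.
rewrite big_seq big1 ?addr0 ?add0r// => q qs.
by rewrite indicE memNset ?scale0r//; apply: nq; rewrite mem_cat qs orbT.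
Qed.

Lemma tagged_stepf_out K W s x (f : G -> E) : tagged_partition K W s -> ~ K x ->
  stepf (tagmap f s) x = 0.
Proof.
move=> [hs _] Kx; rewrite /stepf big_map big_seq big1// => p ps /=.
by rewrite indicE memNset ?scale0r// => px; apply: Kx; have [_ + _] := hs _ ps; apply.
Qed.

Lemma tagged_swf K W s (f : G -> E) : tagged_partition K W s ->
  measurable (K : set (borel G)) -> (mu K < +oo)%E -> swf mu (tagmap f s).
Proof.
move=> [hs _] mK Kf q /mapP[p ps ->] /=; have [mp pK _] := hs _ ps; split=> //.
by rewrite (le_lt_trans _ Kf)// le_measure// inE.
Qed.

End Eval.

Lemma is_bochner_simple (E : completeNormedModType R[i]) d (T : measurableType d)
    (mu : {measure set T -> \bar R}) (s : seq (set T * E)) : swf mu s ->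
  is_bochner mu (stepf s) (stepint mu s).
Proof.
move=> sw; apply/is_bochnerP; exists (fun=> s); split=> //.
- move=> n; under [X in measurable_fun _ X]eq_fun do rewrite subrr rnorm0.
  exact: measurable_cst.
- move=> e e0; apply: nearW => n; under eq_integral do rewrite subrr rnorm0.
  by rewrite integral0 lte_fin.
- exact: cvg_cst.
Qed.

Section Riemann.
Context (mu : {measure set (borel G) -> \bar R}) (K : set G).
Context (cK : compact K) (Kfin : (mu K < +oo)%E).
Context {E : completeNormedModType R[i]}.

Lemma compact_borel : measurable (K : set (borel G)).
Proof. by apply: closed_borel; exact: compact_closed. Qed.

Lemma integral_cst_indic (e : R) : 0 <= e ->
  (\int[mu]_x (e * \1_K (x : borel G))%:E = (e * fine (mu K))%:E)%E.
Proof.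
move=> e0; rewrite ge0_integralZ_real//.
  rewrite integral_indic//; last exact: compact_borel.
  by rewrite setIT EFinM fineK// ge0_fin_numE.
by apply: measurable_indic; exact: compact_borel.
Qed.

Lemma measurable_cst_indic (e : R) :
  measurable_fun [set: borel G] (fun x => e * \1_K (x : borel G)).
Proof.
apply: measurable_funM; first exact: measurable_cst.
by apply: measurable_indic; exact: compact_borel.
Qed.

Lemma riemann_sum_dist (W : G -> set G) s (f : G -> E) (I : E) (e : R) : 0 <= e ->
  tagged_partition K W s -> is_bochner mu (f : borel G -> E) I ->
  (forall x, ~ K x -> f x = 0) ->
  (forall y x, K y -> K x -> W y x -> rnorm (f x - f y) <= e) ->
  rnorm (I - stepint mu (tagmap f s)) <= e * fine (mu K).
Proof.
move=> e0 ts fI fK fW; rewrite -lee_fin -integral_cst_indic//.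
apply: (bochner_dist fI (is_bochner_simple (tagged_swf (f := f) ts compact_borel Kfin))).
  exact: measurable_cst_indic.
move=> x; have [Kx|nKx] := pselect (K x).
  have [y [Ky Wy] ->] := tagged_stepf_in (E := E) ts Kx.
  by rewrite indicE mem_set// mulr1 fW.
by rewrite (tagged_stepf_out _ ts nKx) fK// subrr rnorm0 indicE memNset// mulr0.
Qed.

(** The sum of the masses is the integral of the scalar step function with all values 1, so
    [stepint_triangle] bounds it by the integral of the indicator of K. *)
Lemma tagged_mass W s : tagged_partition K W s ->
  \sum_(p <- s) fine (mu p.1) <= fine (mu K).
Proof.
move=> ts.
have := stepint_triangle (tagged_swf (f := fun=> 1 : R[i]^o) ts compact_borel Kfin).
have -> : stepint mu (tagmap (fun=> 1 : R[i]^o) s) = (\sum_(p <- s) fine (mu p.1))%:C.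
  rewrite /stepint big_map rmorph_sum /=; apply: eq_bigr => p _.
  by rewrite /GRing.scale /= mulr1.
rewrite {1}/rnorm normC_real ger0_norm ?sumr_ge0// => h.
rewrite -lee_fin; apply: (le_trans h).
rewrite -[fine _]mul1r -integral_cst_indic//; apply: ge0_le_integral_real.
- have := measurable_stepf 0 (tagged_swf (f := fun=> 1 : R[i]^o) ts compact_borel Kfin).
  by under [X in measurable_fun _ X -> _]eq_fun do rewrite add0r.
- exact: measurable_cst_indic.
- by move=> x; exact: rnorm_ge0.
- move=> x; have [Kx|nKx] := pselect (K x).
    have [y _ ->] := tagged_stepf_in (E := R[i]^o) ts Kx.
    by rewrite /rnorm normr1 mul1r indicE mem_set.
  by rewrite (tagged_stepf_out _ ts nKx) rnorm0 mulr_ge0.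
Qed.

Lemma bochner_continuous (f : G -> E) : continuous f -> (forall x, ~ K x -> f x = 0) ->
  exists I, is_bochner mu (f : borel G -> E) I.
Proof.
move=> cf fK; apply: bochner_approx; first exact: nmeas_continuous.
(* The added 1 keeps the denominator positive when K is a null set; the same device recurs in later
   estimates. *)
move=> e e0; pose e' := e / (fine (mu K) + 1).
have mK0 : 0 <= fine (mu K) by exact: fine_ge0.
have e'0 : 0 < e' by rewrite divr_gt0// ltr_wpDl.
pose W y := [set x | rnorm (f x - f y) < e'].
have KW x : K x -> nbhs x (W x) by move=> _; move/cvg_rnormP : (cf x); exact.
have [s ts] := tagged_partition_exists cK KW.
have sw := tagged_swf (f := f) ts compact_borel Kfin.
exists (tagmap f s) => //.
apply: (@le_lt_trans _ _ (e' * fine (mu K))%:E).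
  rewrite -integral_cst_indic//; last exact: ltW.
  apply: ge0_le_integral_real.
  - have := nmeas_sub_simple (nmeas_continuous cf) sw 0.
    by under [X in measurable_fun _ X -> _]eq_fun do rewrite subr0.
  - exact: measurable_cst_indic.
  - by move=> x; exact: rnorm_ge0.
  - move=> x; have [Kx|nKx] := pselect (K x).
      have [y [_ Wy] ->] := tagged_stepf_in (E := E) ts Kx.
      by rewrite indicE mem_set// mulr1 ltW.
    by rewrite (tagged_stepf_out _ ts nKx) fK// subrr rnorm0 mulr_ge0// ltW.
rewrite lte_fin /e' mulrAC ltr_pdivrMr ?ltr_wpDl// ltr_pM2l//.
by rewrite ltrDl.
Qed.

End Riemann.
End Partition.

(** * Haar measure and length functions *)

Section LocallyBounded.
Context {R : realType} {T : topologicalType}.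

(** No continuity is asked of f: the lemma is meant for length functions, which are only Borel
    measurable. Compactness is applied to the bounds f x <= n as n tends to infinity. *)
Lemma locally_bounded_compact (f : T -> R) (K : set T) :
  (forall x : T, exists M : R, \forall y \near x, f y <= M) -> compact K ->
  exists2 M : R, 0 < M & forall x, K x -> f x <= M.
Proof.
move=> fM /compact_near_coveringP cK.
have := cK nat \oo (fun n x => f x <= n%:R) _ => /(_ _)[x Kx|].
  have [M hM] := fM x; pose n0 := (Num.truncn M).+1.
  have hn0 : M <= n0%:R by have := truncnS_gt M => /ltW.
  exists ([set y | f y <= M], [set n | (n0 <= n)%N]); first by split=> //=; exists n0.
  move=> [y n] /= [fy n0n]; rewrite (le_trans fy)// (le_trans hn0)// ler_nat//.
move=> N _ /(_ N (leqnn N)) h; exists (N%:R + 1); first by rewrite ltr_wpDl.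
by move=> x /h /= lx; rewrite (le_trans lx)// lerDl.
Qed.

End LocallyBounded.

Section Haar.
Context {R : realType} {G : topologicalGroupType}.
Hypothesis G_hausdorff : hausdorff_space G.
Hypothesis G_lc : locally_compact [set: G].
Context (mu : {measure set (borel G) -> \bar R}).
Hypothesis mu_haar : is_haar mu.

Lemma haar_compact_fin (K : set G) : compact K -> (mu K < +oo)%E.
Proof. by case: mu_haar => _ + _ _ _; exact. Qed.

Lemma haar_preimage (g : G) (A : set (borel G)) : measurable A ->
  mu ((fun x : G => (g * x)%g) @^-1` A) = mu A.
Proof.
move=> mA; case: mu_haar => + _ _ _ _ => /(_ (g^-1)%g A mA) <-.
congr (mu _); apply/seteqP; split=> x /=.
  by move=> Ax; exists (g * x)%g => //; rewrite mulKg.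
by move=> [y Ay <-]; rewrite mulVKg.
Qed.

Lemma near_mulg_sub (K U : set G) : compact K -> open U -> K `<=` U ->
  \forall w \near (1%g : G), forall k, K k -> U (w * k)%g.
Proof.
move=> /compact_near_coveringP cK oU KU.
apply: (cK G (nbhs (1%g : G)) (fun w k => U (w * k)%g)) => x Kx.
have := @mulg_continuous G (1%g, x) U; rewrite /= mul1g => /(_ _)[].
  by apply: open_nbhs_nbhs; split=> //; exact: KU.
move=> [P Q] /= [P1 Qx] PQ; exists (Q, P); first by split.
by move=> [k w] /= [Qk Pw]; apply: (PQ (w, k)).
Qed.

(** Inner regularity is available for open sets only, so E is first enclosed in an open U of measure
    below 4/3 m, and a compact K fills U up to m/6. Then F = E meet K has measure above 5/6 m. For w
    near 1 the set w K stays in U; if F and w F were disjoint, U would have measure above 5/3 m. *)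
Lemma steinhaus (E : set (borel G)) : measurable E -> (0 < mu E)%E -> (mu E < +oo)%E ->
  \forall w \near (1%g : G), exists2 x, E x & E (w * x)%g.
Proof.
move=> mE E0 Efin.
have EE : (fine (mu E))%:E = mu E by rewrite fineK// ge0_fin_numE.
set m := fine (mu E) in EE; have m0 : 0 < m by rewrite -lte_fin EE.
have [U [oU EU] Um] : exists2 U : set G, open U /\ E `<=` U & (mu U < (4 / 3 * m)%:E)%E.
  have [_ _ _ /(_ E mE) + _] := mu_haar => Eo.
  have : (mu E < (4 / 3 * m)%:E)%E by rewrite -EE lte_fin; lra.
  by rewrite {1}Eo => /ereal_inf_lt[_ [U hU <-] h]; exists U.
have mU := open_borel oU.
have Ufin : (mu U < +oo)%E by rewrite (lt_trans Um)// ltry.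
have EUm : (mu E <= mu U)%E by rewrite le_measure ?inE.
have [K [cK KU] Km] : exists2 K : set G, compact K /\ K `<=` U & (mu U - (m / 6)%:E < mu K)%E.
  have [_ _ _ _ /(_ U oU) Uo] := mu_haar.
  have : (mu U - (m / 6)%:E < mu U)%E.
    by rewrite lteBlDr// lteDl// ?lte_fin ?divr_gt0// ge0_fin_numE.
  by rewrite {2}Uo => /ereal_sup_gt[_ [K hK <-] h]; exists K.
have mK : measurable (K : set (borel G)) by exact: compact_borel.
pose F : set (borel G) := E `&` K.
have mF : measurable F by exact: measurableI.
have Ffin : (mu F < +oo)%E by rewrite (le_lt_trans _ Efin)// le_measure ?inE// => x [].
have Fm : 5 / 6 * m < fine (mu F).
  have h1 : (mu E <= mu F + mu (U `\` K))%E.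
    rewrite (measureDI mu mE mK) addeC leeD2l// le_measure ?inE//.
    - exact: measurableD.
    - exact: measurableD.
    - by move=> x [Ex nKx]; split=> //; exact: EU.
  have h2 : (mu U = mu (U `\` K) + mu K)%E.
    by rewrite {1}(measureDI mu mU mK) (setIidr KU).
  have UKfin : (mu (U `\` K) < +oo)%E.
    by rewrite (le_lt_trans _ Ufin)// le_measure ?inE//; exact: measurableD.
  have Kfin := haar_compact_fin cK.
  move: h1 h2 Km; rewrite -EE.
  have -> : mu F = (fine (mu F))%:E by rewrite fineK// ge0_fin_numE.
  have -> : mu (U `\` K) = (fine (mu (U `\` K)))%:E by rewrite fineK// ge0_fin_numE.
  have -> : mu K = (fine (mu K))%:E by rewrite fineK// ge0_fin_numE.
  have -> : mu U = (fine (mu U))%:E by rewrite fineK// ge0_fin_numE.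
  rewrite -EFinB -!EFinD !lee_fin !lte_fin /= => h1 [h2] h3; lra.
have := near_mulg_sub cK oU KU; apply: filterS => w wKU.
apply: contrapT => nE.
pose wF : set (borel G) := (fun x : G => (w^-1 * x)%g) @^-1` F.
have mwF : measurable wF.
  rewrite -[wF]setTI; apply: (continuous_borel (f := fun x => (w^-1 * x)%g)) => //.
  exact: continuous_mulgl.
have disj : F `&` wF = set0.
  apply/seteqP; split=> // x [[Ex Kx] [Ewx Kwx]]; apply: nE.
  by exists (w^-1 * x)%g => //; rewrite mulVKg.
have sub : F `|` wF `<=` U.
  move=> x [[Ex _]|[_ Kwx]]; first exact: EU.
  by have := wKU _ Kwx; rewrite mulVKg.
have : (mu (F `|` wF) <= mu U)%E by rewrite le_measure ?inE//; exact: measurableU.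
have -> : (mu (F `|` wF) = mu F + mu F)%E.
  by rewrite measureU//; congr (_ + _)%E; exact: haar_preimage.
have -> : mu F = (fine (mu F))%:E by rewrite fineK// ge0_fin_numE.
move=> /le_lt_trans/(_ Um); rewrite -EFinD lte_fin; lra.
Qed.

Section Length.
Context (l : G -> R) (l_length : is_length l).
Hypothesis l_meas : measurable_fun [set: borel G] (l : borel G -> R).
Hypothesis l_sym : forall g : G, l g = l (g^-1)%g.

(** A compact set of positive measure is the union of its parts where l <= n, so one part E_n has
    positive measure. By Steinhaus every w near 1 is a quotient of two points of E_n, and l w <= 2 n
    by symmetry and subadditivity. *)
Lemma length_bounded_near1 : exists M : R, \forall w \near (1%g : G), l w <= M.
Proof.
have [K cK K0] : exists2 K : set G, compact K & (0 < mu K)%E.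
  have [_ _ muT _ /(_ setT openT)] := mu_haar.
  have : (0 < mu [set: borel G])%E by rewrite lt0e muT measure_ge0.
  by move=> + Teq; rewrite Teq => /ereal_sup_gt[_ [K [cK _] <-] h]; exists K.
have mK : measurable (K : set (borel G)) by exact: compact_borel.
pose E n : set (borel G) := K `&` [set x | l x <= n%:R].
have mE n : measurable (E n).
  apply: measurableI => //.
  have -> : [set x | l x <= n%:R] = l @^-1` `]-oo, n%:R].
    by apply/seteqP; split=> x /=; rewrite in_itv.
  by rewrite -[X in measurable X]setTI; apply: l_meas => //; exact: measurable_itv.
have [n En] : exists n, (0 < mu (E n))%E.
  apply: contrapT => nE.
  have E0 n : mu.-negligible (E n).
    apply/negligibleP => //; apply/eqP; rewrite eq_le measure_ge0 andbT leNgt.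
    by apply/negP => h; apply: nE; exists n.
  have := negligible_bigcup E0.
  have -> : \bigcup_k E k = K.
    apply/seteqP; split=> [x [k _ []]//|x Kx].
    exists (Num.truncn (l x)).+1 => //; split=> //=.
    by have := truncnS_gt (l x) => /ltW.
  by move/negligibleP => /(_ mK) K00; rewrite K00 ltxx in K0.
have Efin : (mu (E n) < +oo)%E.
  by rewrite (le_lt_trans _ (haar_compact_fin cK))// le_measure ?inE// => x [].
exists (n%:R + n%:R); have := steinhaus (mE n) En Efin.
apply: filterS => w [x [_ /= lx] [_ /= lwx]].
have [_ _ lM] := l_length; have := lM (w * x)%g (x^-1)%g; rewrite mulgK -l_sym.
by move=> /le_trans; apply; exact: lerD.
Qed.

(** Subadditivity carries the bound near 1 to a bound near any x, because l y <= l (y x^-1) + l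
    x. *)
Lemma length_bounded_compact (K : set G) : compact K ->
  exists2 M : R, 0 < M & forall x, K x -> l x <= M.
Proof.
have [M Mw] := length_bounded_near1; have [_ _ lM] := l_length.
apply: locally_bounded_compact => x; exists (M + l x).
have cx : continuous (fun y : G => (y * x^-1)%g).
  by apply: continuous_mulg2 => y; [exact: cvg_id|exact: cvg_cst].
have := cx x; rewrite /continuous_at mulgV => /(_ _ Mw) hx.
have {hx} : \forall y \near x, l (y * x^-1)%g <= M := hx; apply: filterS => y ly.
by have := lM (y * x^-1)%g x; rewrite mulgVK => /le_trans; apply; exact: lerD.
Qed.

End Length.

(** Complete regularity separates a point from a closed set only. A minimum of finitely many such
    functions, chosen by compactness, is below 1/2 on K and equal to 1 off U. *)
Lemma compact_urysohn (K U : set G) : compact K -> open U -> K `<=` U ->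
  exists f : G -> R, [/\ continuous f, forall x, 0 <= f x <= 1,
    forall x, K x -> f x = 1 & forall x, ~ U x -> f x = 0].
Proof.
move=> cK oU KU.
have crs := @locally_compact_completely_regular G R G_lc G_hausdorff.
have [F hF] : exists F : G -> G -> R, forall k, K k ->
    [/\ continuous (F k), forall x, 0 <= F k x <= 1, F k k = 0 & forall x, ~ U x -> F k x = 1].
  suff : forall k, exists f : G -> R, K k -> [/\ continuous f, forall x, 0 <= f x <= 1,
     f k = 0 & forall x, ~ U x -> f x = 1].
    by move=> /choice[F hF]; exists F.
  move=> k; have [Kk|nKk] := pselect (K k); last by exists (fun=> 0).
  have := crs k (~` U) (open_closedC oU) (fun h => h (KU _ Kk)).
  move=> /(@uniform_separatorP _ R)[f [cf f01 f0 f1]]; exists f => _; split=> //.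
  - by move=> x; have := f01 (f x); rewrite /= in_itv /=; apply; exists x.
  - by apply: f0; exists k.
  - by move=> x nUx; apply: f1; exists x.
have := cK; rewrite compact_cover.
move=> /(_ G K (fun k => [set x | K k /\ F k x < 1 / 2])).
case=> [k Kk|x Kx|D' D'K cov].
- have [cFk _ _ _] := hF _ Kk.
  have -> : [set x | K k /\ F k x < 1 / 2] = F k @^-1` [set y | y < 1 / 2].
    by apply/seteqP; split=> x /=; [case|split].
  by apply: open_comp => [x _|]; [exact: cFk|exact: open_lt].
- by exists x => //=; split=> //; have [_ _ -> _] := hF _ Kx; rewrite divr_gt0.
pose h x := \big[Num.min/(1 : R)]_(k <- finmap.enum_fset D') F k x.
have D'K' k : k \in finmap.enum_fset D' -> K k by move=> /D'K; rewrite inE.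
have ch : continuous h.
  rewrite /h; elim: (finmap.enum_fset D') D'K' => [_|k s IH sK].
    by under eq_fun do rewrite big_nil; move=> x; exact: cvg_cst.
  under eq_fun do rewrite big_cons.
  move=> x; apply: (@continuous_min R G (F k)).
    by have [+ _ _ _] := hF k (sK _ (mem_head _ _)); exact.
  by apply: IH => j js; apply: sK; rewrite inE js orbT.
have h01 x : 0 <= h x <= 1.
  rewrite /h; elim: (finmap.enum_fset D') D'K' => [_|k s IH sK].
    by rewrite big_nil lexx ler01.
  have /andP[a b] := IH (fun j js => sK j (mem_behead (s := k :: s) js)).
  have [_ /(_ x)/andP[c d] _ _] := hF k (sK _ (mem_head _ _)).
  by rewrite big_cons le_min a c ge_min d.
have h1 x : ~ U x -> h x = 1.
  move=> nUx; rewrite /h; elim: (finmap.enum_fset D') D'K' => [_|k s IH sK].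
    by rewrite big_nil.
  rewrite big_cons IH; last by move=> j js; apply: sK; rewrite inE js orbT.
  by have [_ _ _ ->//] := hF k (sK _ (mem_head _ _)); rewrite minxx.
have hK x : K x -> h x < 1 / 2.
  move=> /cov[k /= kD [Kk Fk]]; rewrite /h.
  have {}kD : k \in finmap.enum_fset D' := kD.
  elim: (finmap.enum_fset D') kD => [//|j s IH]; rewrite inE big_cons gt_min.
  by move=> /orP[/eqP <-|/IH ->]; rewrite ?Fk ?orbT.
(* Values of h below 1/2 are sent to 1, and the value 1 is sent to 0. *)
exists (fun x => Num.min 1 (2 * (1 - h x))); split.
- move=> x; apply: (@continuous_min R G (fun=> 1)); first exact: cvg_cst.
  apply: cvgM; first exact: cvg_cst.
  by apply: cvgB; [exact: cvg_cst|exact: ch].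
- move=> x; have /andP[a b] := h01 x.
  by rewrite le_min ler01 ge_min lexx /= andbT mulr_ge0// subr_ge0.
- by move=> x /hK hx; apply/min_idPl; lra.
- by move=> x /h1 ->; rewrite subrr mulr0; apply/min_idPr.
Qed.

(** With E' = E meet K of finite measure, choose C compact in U open, U containing E'. A Urysohn
    function for C and U differs from the indicator of E' only on U minus C and U minus E', each of
    measure at most e/2. *)
Lemma approx_indic (K : set G) (E : set (borel G)) (e : R) :
  compact K -> measurable E -> 0 < e ->
  exists f : G -> R, [/\ continuous f, forall x, 0 <= f x <= 1 &
    (\int[mu]_x (\1_K (x : borel G) * `|f x - \1_E x|)%:E <= e%:E)%E].
Proof.
move=> cK mE e0.
have mK : measurable (K : set (borel G)) by exact: compact_borel.
pose E' : set (borel G) := E `&` K.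
have mE' : measurable E' by exact: measurableI.
have E'fin : (mu E' < +oo)%E.
  by rewrite (le_lt_trans _ (haar_compact_fin cK))// le_measure ?inE// => x [].
have e2 : 0 < e / 2 by rewrite divr_gt0.
have [U [oU EU] Um] : exists2 U : set G, open U /\ E' `<=` U & (mu U < mu E' + (e / 2)%:E)%E.
  have [_ _ _ /(_ E' mE') + _] := mu_haar => Eo.
  have : (mu E' < mu E' + (e / 2)%:E)%E by rewrite lteDl// ge0_fin_numE.
  by rewrite {1}Eo => /ereal_inf_lt[_ [U hU <-] h]; exists U.
have mU := open_borel oU.
have Ufin : (mu U < +oo)%E.
  by rewrite (lt_trans Um)// lte_add_pinfty// ltry.
have [C [cC CU] Cm] : exists2 C : set G, compact C /\ C `<=` U & (mu U - (e / 2)%:E < mu C)%E.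
  have [_ _ _ _ /(_ U oU) Uo] := mu_haar.
  have : (mu U - (e / 2)%:E < mu U)%E.
    by rewrite lteBlDr// lteDl// ?lte_fin// ge0_fin_numE.
  by rewrite {2}Uo => /ereal_sup_gt[_ [C hC <-] h]; exists C.
have mC : measurable (C : set (borel G)) by exact: compact_borel.
have [f [cf f01 fC fU]] := compact_urysohn cC oU CU.
exists f; split=> //.
have mUC : measurable (U `\` C : set (borel G)) by exact: measurableD.
have mUE : measurable (U `\` E' : set (borel G)) by exact: measurableD.
have mf := continuous_borel_real cf.
have mI (A : set (borel G)) : measurable A -> measurable_fun [set: borel G] (\1_A : _ -> R).
  by move=> mA; exact: measurable_indic.
apply: (@le_trans _ _ (\int[mu]_x (\1_(U `\` C) (x : borel G) + \1_(U `\` E') x)%:E)%E).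
  apply: ge0_le_integral_real.
  - apply: measurable_funM; first exact: mI.
    by apply: measurableT_comp => //; apply: measurable_funB => //; exact: mI.
  - by apply: measurable_funD; exact: mI.
  - by move=> x; rewrite mulr_ge0.
  - move=> x; have [Kx|nKx] := pselect (K x); last first.
      by rewrite indicE memNset// mul0r addr_ge0.
    rewrite indicE mem_set// mul1r.
    have -> : \1_E x = \1_E' x :> R.
      by rewrite !indicE /E' in_setI (mem_set Kx) andbT.
    have /andP[f0 f1] := f01 x.
    have [Ux|nUx] := pselect (U x); last first.
      by rewrite fU// sub0r normrN !indicE (memNset (A := E'))// ?normr0 ?addr_ge0// => /EU.
    have [Cx|nCx] := pselect (C x).
      rewrite fC// [\1_(U `\` C) x]indicE (memNset (A := U `\` C)); last by case.
      rewrite add0r !indicE in_setD (mem_set Ux) /=.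
      by case: (x \in E'); rewrite ?subrr ?normr0 ?subr0 ?normr1.
    rewrite [\1_(U `\` C) x]indicE (mem_set (A := U `\` C))//.
    rewrite ler_wpDr// ler_norml; rewrite indicE; case: (x \in E') => /=; lra.
rewrite (ge0_integralD_real mu (mI _ mUC) (mI _ mUE))//.
rewrite !integral_indic// !setIT.
have -> : e = e / 2 + e / 2 by field.
rewrite EFinD; apply: leeD.
  have h2 : (mu U = mu (U `\` C) + mu C)%E.
    by rewrite {1}(measureDI mu mU mC) (setIidr CU).
  have UCfin : (mu (U `\` C) < +oo)%E by rewrite (le_lt_trans _ Ufin)// le_measure ?inE.
  have Cfin := haar_compact_fin cC.
  move: Cm; rewrite h2 -[mu (_ `\` _)]fineK ?ge0_fin_numE// -[mu C]fineK ?ge0_fin_numE//.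
  by rewrite -EFinD -?EFinB lte_fin lee_fin; lra.
have h2 : (mu U = mu (U `\` E') + mu E')%E.
  by rewrite {1}(measureDI mu mU mE') (setIidr EU).
have UEfin : (mu (U `\` E') < +oo)%E by rewrite (le_lt_trans _ Ufin)// le_measure ?inE.
move: Um; rewrite h2 -[mu (_ `\` _)]fineK ?ge0_fin_numE// -[mu E']fineK ?ge0_fin_numE//.
by rewrite -!EFinD lte_fin lee_fin; lra.
Qed.

(* The binary digits of [tau], peeled off one at a time, are indicator functions. *)
Lemma approx_unit (K : set G) (n : nat) (tau : borel G -> R) (e : R) :
  compact K -> measurable_fun [set: borel G] tau -> (forall x, 0 <= tau x <= 1) -> 0 < e ->
  exists f : G -> R, [/\ continuous f, forall x, 0 <= f x <= 1 &
    (\int[mu]_x (\1_K (x : borel G) * `|f x - tau x|)%:E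
      <= ((1 / 2) ^+ n * fine (mu K) + e)%:E)%E].
Proof.
move=> cK; have mK : measurable (K : set (borel G)) by exact: compact_borel.
have mI (A : set (borel G)) : measurable A -> measurable_fun [set: borel G] (\1_A : _ -> R).
  by move=> mA; exact: measurable_indic.
have mint (f : G -> R) (t : borel G -> R) : continuous f -> measurable_fun [set: borel G] t ->
    measurable_fun [set: borel G] (fun x => \1_K (x : borel G) * `|f x - t x|).
  move=> cf mt; apply: measurable_funM; first exact: mI.
  apply: measurableT_comp => //; apply: measurable_funB => //.
  exact: continuous_borel_real.
elim: n tau e => [|n IH] tau e mtau t01 e0.
  exists (fun=> 0); split=> [x|x|]; [exact: cvg_cst|by rewrite lexx ler01|].
  apply: (@le_trans _ _ (\int[mu]_x (\1_K (x : borel G))%:E)%E).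
    apply: ge0_le_integral_real; [by apply: mint => // x; exact: cvg_cst|exact: mI|by move=> x; rewrite mulr_ge0|].
    move=> x; have /andP[t0 t1] := t01 x.
    by rewrite sub0r normrN ger0_norm// ler_piMr.
  rewrite integral_indic// setIT expr0 mul1r -[mu K]fineK ?ge0_fin_numE ?haar_compact_fin//.
  by rewrite lee_fin lerDl ltW.
pose E : set (borel G) := tau @^-1` `[1 / 2, +oo[.
have mE : measurable E.
  by rewrite -[E]setTI; apply: mtau => //; exact: measurable_itv.
have EP x : (x \in E) = (1 / 2 <= tau x).
  by apply/idP/idP; rewrite inE /E /= in_itv /= andbT.
(* E is the set where the first digit of tau is 1, and tau = 1_E / 2 + tau' / 2 with tau' again in
   [0, 1]. The errors are averaged, so e does not grow while the truncation error is halved. *)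
pose tau' x := 2 * tau x - \1_E x.
have mtau' : measurable_fun [set: borel G] tau'.
  by apply: measurable_funB; [apply: measurable_funM => //; exact: measurable_cst|exact: mI].
have t'01 x : 0 <= tau' x <= 1.
  have /andP[t0 t1] := t01 x; rewrite /tau' indicE EP.
  by case: (leP (1 / 2) (tau x)) => /= h; apply/andP; split; lra.
have [f' [cf' f'01 hf']] := IH tau' e mtau' t'01 e0.
have [f [cf f01 hf]] := approx_indic cK mE e0.
exists (fun x => 1 / 2 * f x + 1 / 2 * f' x); split.
- by move=> x; apply: cvgD; apply: cvgM; [exact: cvg_cst|exact: cf|exact: cvg_cst|exact: cf'].
- move=> x; have /andP[a b] := f01 x; have /andP[c d] := f'01 x.
  by apply/andP; split; lra.
apply: (@le_trans _ _ (\int[mu]_x (1 / 2 * (\1_K (x : borel G) * `|f x - \1_E x|) +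
   1 / 2 * (\1_K (x : borel G) * `|f' x - tau' x|))%:E)%E).
  apply: ge0_le_integral_real.
  - apply: mint => // x.
    by apply: cvgD; apply: cvgM; [exact: cvg_cst|exact: cf|exact: cvg_cst|exact: cf'].
  - by apply: measurable_funD; apply: measurable_funM => //; apply: mint => //; exact: mI.
  - by move=> x; rewrite mulr_ge0.
  - move=> x; rewrite [X in _ <= X + _]mulrCA [X in _ <= _ + X]mulrCA -[X in _ <= X]mulrDr ler_wpM2l//.
    have -> : 1 / 2 * f x + 1 / 2 * f' x - tau x =
      1 / 2 * (f x - \1_E x) + 1 / 2 * (f' x - tau' x) by rewrite /tau'; field.
    by rewrite (le_trans (ler_normD _ _))// !(normrM (1 / 2)) ger0_norm.
have m1 : measurable_fun [set: borel G] (fun x => \1_K (x : borel G) * `|f x - \1_E x|).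
  by apply: mint => //; exact: mI.
have m2 := mint _ _ cf' mtau'.
have n1 x : 0 <= \1_K (x : borel G) * `|f x - \1_E x| by rewrite mulr_ge0.
have n2 x : 0 <= \1_K (x : borel G) * `|f' x - tau' x| by rewrite mulr_ge0.
have h0 : 0 <= 1 / 2 :> R by [].
rewrite ge0_integralD_real; [|by apply: measurable_funM|by apply: measurable_funM|by move=> x; rewrite mulr_ge0|by move=> x; rewrite mulr_ge0].
rewrite !ge0_integralZ_real//.
have -> : (1 / 2) ^+ n.+1 * fine (mu K) + e =
   1 / 2 * e + 1 / 2 * ((1 / 2) ^+ n * fine (mu K) + e).
  by rewrite exprS; field.
by rewrite EFinD !(EFinM (1 / 2)) leeD// lee_wpmul2l// lee_fin.
Qed.

Lemma approx_bounded (K : set G) (N : R) (tau : borel G -> R) (e : R) :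
  compact K -> measurable_fun [set: borel G] tau -> 0 < N -> (forall x, `|tau x| <= N) ->
  0 < e ->
  exists f : G -> R, [/\ continuous f, forall x, `|f x| <= N &
    (\int[mu]_x (\1_K (x : borel G) * `|f x - tau x|)%:E < e%:E)%E].
Proof.
move=> cK mtau N0 tN e0.
have mK : measurable (K : set (borel G)) by exact: compact_borel.
pose tau' x := (tau x / N + 1) / 2.
have mtau' : measurable_fun [set: borel G] tau'.
  apply: measurable_funM; last exact: measurable_cst.
  apply: measurable_funD; last exact: measurable_cst.
  by apply: measurable_funM => //; exact: measurable_cst.
have t'01 x : 0 <= tau' x <= 1.
  have := tN x; rewrite -(ler_pM2r (x := N^-1)) ?invr_gt0// mulfV ?gt_eqF//.
  have Nn : N^-1 = `|N^-1| by rewrite gtr0_norm// invr_gt0.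
  rewrite {1}Nn -normrM ler_norml.
  by move=> /andP[a b]; rewrite /tau'; apply/andP; split; lra.
(* Undoing the affine map from [-N, N] to [0, 1] multiplies the error by 2 N, and two errors d make
   e/2 in total. *)
pose d := e / (8 * N).
have d0 : 0 < d by rewrite divr_gt0// mulr_gt0.
have [n nP] : exists n, (1 / 2) ^+ n * fine (mu K) < d.
  have : (fun n => (1 / 2) ^+ n * fine (mu K)) @ \oo --> (0 * fine (mu K) : R).
    apply: cvgM; last exact: cvg_cst.
    by apply: cvg_expr; rewrite ger0_norm//; lra.
  rewrite mul0r => /cvgrPdist_lt/(_ d d0)[n _ /(_ n (leqnn n))] /=.
  by rewrite sub0r normrN => h; exists n; apply: le_lt_trans h; rewrite ler_norm.
have [f [cf f01 hf]] := approx_unit n cK mtau' t'01 d0.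
exists (fun x => N * (2 * f x - 1)); split.
- move=> x; apply: cvgM; first exact: cvg_cst.
  apply: cvgB; last exact: cvg_cst.
  by apply: cvgM; [exact: cvg_cst|exact: cf].
- move=> x; rewrite normrM gtr0_norm//; apply: ler_piMr; first exact: ltW.
  by have /andP[a b] := f01 x; rewrite ler_norml; apply/andP; split; lra.
have -> : (fun x : borel G => (\1_K x * `|N * (2 * f x - 1) - tau x|)%:E) =
    (fun x => ((2 * N) * (\1_K x * `|f x - tau' x|))%:E).
  apply/funext => x; rewrite mulrCA; congr (_ * _)%:E.
  have -> : 2 * N = `|2 * N| by rewrite gtr0_norm// mulr_gt0.
  rewrite -normrM /tau'; congr `|_|.
  by field; rewrite gt_eqF.
rewrite ge0_integralZ_real; [|..]; last 3 first.
- apply: measurable_funM; first exact: measurable_indic.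
  apply: measurableT_comp => //; apply: measurable_funB => //.
  exact: continuous_borel_real.
- by move=> x; rewrite mulr_ge0.
- by rewrite mulr_ge0// ltW.
apply: (@le_lt_trans _ _ ((2 * N)%:E * (d + d)%:E)%E).
  apply: lee_wpmul2l; first by rewrite lee_fin mulr_ge0// ltW.
  by apply: (le_trans hf); rewrite lee_fin lerD// ltW.
rewrite -EFinM lte_fin /d.
have -> : 2 * N * (e / (8 * N) + e / (8 * N)) = e / 2 by field; rewrite gt_eqF.
lra.
Qed.

End Haar.

Lemma cvg_scale_real {R : realType} {E : normedModType R[i]} (I : Type)
    (F : set_system I) {FF : Filter F} (f : I -> R) (u : I -> E) (r : R) (x : E) :
  f @ F --> r -> u @ F --> x -> (fun i => (f i)%:C *: u i) @ F --> r%:C *: x.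
Proof.
move=> fr ux; apply: (@cvg_rnorm_bound _ _ _ _ _ _ _
   (fun i => `|f i| * rnorm (u i - x) + `|f i - r| * rnorm x)) => [i|].
  rewrite (_ : _ - _ = (f i)%:C *: (u i - x) + (f i - r)%:C *: x); last first.
    by rewrite scalerBr rmorphB scalerBl addrA subrK.
  by rewrite (le_trans (ler_rnormD _ _))// !rnormZr.
have -> : 0 = `|r| * rnorm (x - x) + `|r - r| * rnorm x.
  by rewrite !subrr rnorm0 normr0 mulr0 mul0r addr0.
apply: cvgD; apply: cvgM.
- exact: cvg_norm.
- by apply: cvg_rnorm; apply: cvgB => //; exact: cvg_cst.
- by apply: cvg_norm; apply: cvgB => //; exact: cvg_cst.
- exact: cvg_cst.
Qed.

(** * The Hilbert module *)

Section BoundedOperators.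
Context {R : realType} {E : normedModType R[i]}.
Implicit Types (A : E -> E) (x y : E).

Lemma blinD A : bounded_op A -> forall x y, A (x + y) = A x + A y.
Proof. by move=> [lA _] x y; have := lA 1 x y; rewrite !scale1r. Qed.

Lemma blin0 A : bounded_op A -> A 0 = 0.
Proof.
by move=> bA; have := blinD bA 0 0; rewrite addr0 => /eqP; rewrite addrC -subr_eq subrr => /eqP.
Qed.

Lemma blinZ A : bounded_op A -> forall (k : R[i]) x, A (k *: x) = k *: A x.
Proof. by move=> bA k x; have [lA _] := bA; have := lA k x 0; rewrite !addr0 blin0// addr0. Qed.

Lemma blinN A : bounded_op A -> forall x, A (- x) = - A x.
Proof. by move=> bA x; rewrite -scaleN1r blinZ// scaleN1r. Qed.

Lemma blinB A : bounded_op A -> forall x y, A (x - y) = A x - A y.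
Proof. by move=> bA x y; rewrite blinD// blinN. Qed.

Lemma bop_bound A : bounded_op A -> exists2 M : R, 0 < M & forall x, rnorm (A x) <= M * rnorm x.
Proof.
move=> [_ [M hM]]; exists (`|M| + 1); first by rewrite ltr_wpDl.
move=> x; apply: (le_trans (hM x)); rewrite ler_wpM2r ?rnorm_ge0//.
by rewrite (le_trans (ler_norm _))// lerDl.
Qed.

Lemma cvg_bop A (I : Type) (F : set_system I) {FF : Filter F} (u : I -> E) x :
  bounded_op A -> u @ F --> x -> (fun i => A (u i)) @ F --> A x.
Proof.
move=> bA /cvg_rnormP ux; have [M M0 hM] := bop_bound bA; apply/cvg_rnormP => e e0.
have /ux : 0 < e / M by rewrite divr_gt0.
apply: filterS => i h; rewrite -blinB//; apply: (le_lt_trans (hM _)).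
by rewrite mulrC -ltr_pdivlMr.
Qed.

Lemma bop_intro A (M : R) : (forall x y, A (x + y) = A x + A y) ->
  (forall (k : R[i]) x, A (k *: x) = k *: A x) ->
  (forall x, rnorm (A x) <= M * rnorm x) -> bounded_op A.
Proof. by move=> AD AZ AM; split; [move=> k x y; rewrite AD AZ|exists M]. Qed.

Lemma bop_id : bounded_op (@id E).
Proof. by apply: (@bop_intro _ 1) => // x; rewrite mul1r. Qed.

Lemma bop0 : bounded_op (fun=> 0 : E).
Proof. by apply: (@bop_intro _ 0) => *; rewrite ?addr0 ?scaler0 ?rnorm0 ?mul0r. Qed.

Lemma bop_comp A A' : bounded_op A -> bounded_op A' -> bounded_op (A \o A').
Proof.
move=> bA bA'; have [M M0 hM] := bop_bound bA; have [M' M'0 hM'] := bop_bound bA'.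
apply: (@bop_intro _ (M * M')) => [x y|k x|x] /=.
- by rewrite (blinD bA') (blinD bA).
- by rewrite (blinZ bA') (blinZ bA).
- by rewrite (le_trans (hM _))// -mulrA ler_wpM2l// ltW.
Qed.

Lemma bopD A A' : bounded_op A -> bounded_op A' -> bounded_op (fun x => A x + A' x).
Proof.
move=> bA bA'; have [M M0 hM] := bop_bound bA; have [M' M'0 hM'] := bop_bound bA'.
apply: (@bop_intro _ (M + M')) => [x y|k x|x] /=.
- by rewrite (blinD bA) (blinD bA') addrACA.
- by rewrite (blinZ bA) (blinZ bA') scalerDr.
- by rewrite (le_trans (ler_rnormD _ _))// mulrDl lerD.
Qed.

Lemma bopZ (k : R[i]) A : bounded_op A -> bounded_op (fun x => k *: A x).
Proof.
move=> bA; have [M M0 hM] := bop_bound bA.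
apply: (@bop_intro _ (complex.Re `|k| * M)) => [x y|j x|x] /=.
- by rewrite (blinD bA) scalerDr.
- by rewrite (blinZ bA) !scalerA mulrC.
- by rewrite rnormZ -mulrA ler_wpM2l// Re_norm_ge0.
Qed.

Lemma bopN A : bounded_op A -> bounded_op (fun x => - A x).
Proof. by move=> /(bopZ (-1)); under eq_fun do rewrite scaleN1r. Qed.

Lemma bopB A A' : bounded_op A -> bounded_op A' -> bounded_op (fun x => A x - A' x).
Proof. by move=> bA bA'; apply: bopD => //; exact: bopN. Qed.

End BoundedOperators.

Section CompactSupport.
Context {R : realType} {G : topologicalGroupType} (B : GCstarAlgebra R G).
Hypothesis G_hausdorff : hausdorff_space G.
Implicit Types (u v : G -> B).

Lemma Cc_continuous v : Cc v -> continuous v. Proof. by case. Qed.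

Lemma Cc_support v : Cc v -> exists2 K, compact K & forall x, ~ K x -> v x = 0.
Proof.
move=> [_ cK]; exists (closure [set g | v g != 0]) => // x nx.
by apply: contrapT => /eqP vx; apply: nx; exact: subset_closure.
Qed.

Lemma Cc_intro v (K : set G) : continuous v -> compact K -> (forall x, ~ K x -> v x = 0) -> Cc v.
Proof.
move=> cv cK vK; split=> //; apply: (subclosed_compact _ cK).
  exact: closed_closure.
have clK : closed K by exact: compact_closed.
rewrite closureE; apply: smallest_sub => // x /= /eqP vx.
by apply: contrapT => /vK.
Qed.

Lemma Cc_bounded v : Cc v -> exists2 M : R, 0 < M & forall x, rnorm (v x) <= M.
Proof.
move=> cv; have [K cK vK] := Cc_support cv.
have [x|M M0 hM] := @locally_bounded_compact R G (fun x => rnorm (v x)) K _ cK.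
  exists (rnorm (v x) + 1).
  have /cvg_rnormP/(_ 1 ltr01) := Cc_continuous cv (x := x); apply: filterS => y h.
  have := ler_rnormBD (v y) (v x) 0; rewrite !subr0 => /le_trans; apply.
  by rewrite addrC lerD2l ltW.
exists M => // x; have [Kx|nKx] := pselect (K x); first exact: hM.
by rewrite vK// rnorm0 ltW.
Qed.

Lemma Cc0 : @Cc R G B (fun=> 0).
Proof. by apply: (@Cc_intro _ set0) => [x||//]; [exact: cvg_cst|exact: compact0]. Qed.

Lemma CcD u v : Cc u -> Cc v -> Cc (fun x => u x + v x).
Proof.
move=> cu cv; have [K cK uK] := Cc_support cu; have [K' cK' vK'] := Cc_support cv.
apply: (@Cc_intro _ (K `|` K')) => [x||x nK].
- by apply: cvgD; [exact: (Cc_continuous cu)|exact: (Cc_continuous cv)].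
- exact: compactU.
- by rewrite uK ?vK' ?addr0// => h; apply: nK; [right|left].
Qed.

Lemma Cc_map (phi : G -> B -> B) v : Cc v ->
  (forall x, phi x 0 = 0) -> continuous (fun x => phi x (v x)) -> Cc (fun x => phi x (v x)).
Proof.
move=> cv phi0 cphi; have [K cK vK] := Cc_support cv.
by apply: (@Cc_intro _ K) => // x nK; rewrite vK.
Qed.

Lemma CcZ (k : R[i]) v : Cc v -> Cc (fun x => k *: v x).
Proof.
move=> cv; apply: (@Cc_map (fun _ b => k *: b)) => // [x|x]; first by rewrite scaler0.
by apply: cvgZr; exact: (Cc_continuous cv).
Qed.

Lemma CcN v : Cc v -> Cc (fun x => - v x).
Proof. by move=> /(CcZ (-1)); under eq_fun do rewrite scaleN1r. Qed.

Lemma CcB u v : Cc u -> Cc v -> Cc (fun x => u x - v x).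
Proof. by move=> cu cv; apply: CcD => //; exact: CcN. Qed.

Lemma Cc_scale (f : G -> R) v : continuous f -> Cc v -> Cc (fun x => (f x)%:C *: v x).
Proof.
move=> cf cv; apply: (@Cc_map (fun x b => (f x)%:C *: b)) => // [x|x]; first by rewrite scaler0.
by apply: cvg_scale_real; [exact: cf|exact: (Cc_continuous cv)].
Qed.

Lemma Cc_cmul (b : B) v : Cc v -> Cc (fun x => cmul b (v x)).
Proof.
move=> cv; apply: (@Cc_map (fun _ c => cmul b c)) => // [x|x]; first by rewrite cmul0r.
by apply: cvg_cmul; [exact: cvg_cst|exact: (Cc_continuous cv)].
Qed.

Lemma gactB (g : G) (b c : B) : gact g (b - c) = gact g b - gact g c.
Proof. by rewrite gactD -scaleN1r gactZ scaleN1r. Qed.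

Lemma gact0 (g : G) : gact g (0 : B) = 0.
Proof. by have := gactZ g 0 (0 : B); rewrite !scale0r. Qed.

(** Strong continuity of the action becomes joint continuity because the automorphisms share the
    bound of [gact_bound]. *)
Lemma cvg_gact (I : Type) (F : set_system I) {FF : Filter F} (g : I -> G) (b : I -> B) g0 b0 :
  g @ F --> g0 -> b @ F --> b0 -> (fun i => gact (g i) (b i)) @ F --> gact g0 b0.
Proof.
move=> gg bb; apply: (@cvg_rnorm_bound _ _ _ _ _ _ _
   (fun i => 2 * rnorm (b i - b0) + rnorm (gact (g i) b0 - gact g0 b0))).
  move=> i; rewrite (_ : _ - _ = gact (g i) (b i - b0) + (gact (g i) b0 - gact g0 b0)).
    by rewrite (le_trans (ler_rnormD _ _))// lerD2r gact_bound.
  by rewrite gactB addrA subrK.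
rewrite -[X in _ --> X]addr0 -{1}(mulr0 2) -{1}(rnorm0 (E := B)) -(subrr b0).
rewrite -[X in _ + X](rnorm0 (E := B)) -(subrr (gact g0 b0)).
apply: cvgD.
  apply: cvgM; first exact: cvg_cst.
  by apply: cvg_rnorm; apply: cvgB => //; exact: cvg_cst.
apply: cvg_rnorm; apply: cvgB; last exact: cvg_cst.
apply: (@cvg_comp _ _ _ g (fun h => gact h b0) F (nbhs g0)) => //.
exact: gact_continuous.
Qed.

(* The operator [v |-> b (g v)]: the value at [g] of the integrand of [lambda (a)]
   when [b = a g]. *)
Definition shift_op (b : B) (g : G) (v : G -> B) : G -> B :=
  fun h => cmul b (gact g (v (g^-1 * h)%g)).

Lemma Cc_shift b g v : Cc v -> Cc (shift_op b g v).
Proof.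
move=> cv; have [K cK vK] := Cc_support cv.
apply: (@Cc_intro _ ((fun x => (g * x)%g) @` K)) => [x||x nK].
- apply: cvg_cmul; first exact: cvg_cst.
  apply: cvg_gact; first exact: cvg_cst.
  apply: (@cvg_comp _ _ _ (fun i => (g^-1 * i)%g) v _ (nbhs (g^-1 * x)%g)).
    exact: continuous_mulgl.
  exact: (Cc_continuous cv).
- apply: continuous_compact => //; apply: continuous_subspaceT.
  exact: continuous_mulgl.
- rewrite /shift_op vK ?gact0 ?cmul0r// => Kx; apply: nK.
  by exists (g^-1 * x)%g => //; rewrite mulVKg.
Qed.

Section Module.
Hypothesis G_lc : locally_compact [set: G].
Context (mu : {measure set (borel G) -> \bar R}).
Hypothesis mu_haar : is_haar mu.
Context (L : L2_completion mu B).

Definition pairing (u h : G -> B) : borel G -> B :=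
  fun g => gact (g : G)^-1%g (cmul (cadj (u g)) (h g)).

Lemma continuous_pairing u v : continuous u -> continuous v ->
  continuous (pairing u v : G -> B).
Proof.
move=> cu cv x; apply: cvg_gact; first exact: invg_continuous.
by apply: cvg_cmul; [apply: cvg_cadj; exact: cu|exact: cv].
Qed.

Lemma pairing_bound u v x : rnorm (pairing u v x) <= 2 * (rnorm (u x) * rnorm (v x)).
Proof.
rewrite (le_trans (gact_bound _ _))// ler_wpM2l//.
by rewrite (le_trans (rnormM_le _ _))// rnorm_adj.
Qed.

Lemma inner_Cc u v : Cc u -> Cc v -> is_bochner mu (pairing u v) (inner (L2_of L u) (L2_of L v)).
Proof.
move=> cu cv; rewrite L2_of_inner//.
have [K cK vK] := Cc_support cv.
have [] := @bochner_continuous R G G_hausdorff mu K cK (haar_compact_fin mu_haar cK) B (pairing u v).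
- by apply: continuous_pairing; exact: Cc_continuous.
- by move=> x nK; rewrite /pairing vK// cmul0r gact0.
by move=> I hI; exact: bochnerP hI.
Qed.

Lemma L2_of_bound (K : set G) : compact K ->
  exists2 C : R, 0 < C & forall v M, Cc v -> (forall x, ~ K x -> v x = 0) ->
    (forall x, rnorm (v x) <= M) -> rnorm (L2_of L v) <= C * M.
Proof.
move=> cK; have Kfin := haar_compact_fin mu_haar cK.
have m0 : 0 <= fine (mu K) by exact: fine_ge0.
(* The square of the L^2 norm is at most 2 mu(K) M^2; this constant exceeds the square root of 2
   mu(K) and is positive even if K is null. *)
exists (2 * fine (mu K) + 1); first by rewrite ltr_wpDl// mulr_ge0.
move=> v M cv vK vM.
have M0 : 0 <= M by rewrite (le_trans _ (vM 1%g))// rnorm_ge0.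
have : rnorm (L2_of L v) ^+ 2 <= 2 * M ^+ 2 * fine (mu K).
  rewrite -rnorm_inner -lee_fin -integral_cst_indic//; last by rewrite mulr_ge0// sqr_ge0.
  apply: (bochner_norm (inner_Cc cv cv)); first exact: measurable_cst_indic.
  move=> x; have [Kx|nKx] := pselect (K x).
    rewrite indicE mem_set// mulr1 (le_trans (pairing_bound _ _ _))// ler_wpM2l//.
    by rewrite expr2 ler_pM// rnorm_ge0.
  by rewrite /pairing vK// cmul0r gact0 rnorm0 mulr_ge0// mulr_ge0// sqr_ge0.
have := rnorm_ge0 (L2_of L v); set a := rnorm _; set m := fine _ in m0 *.
move=> a0 h; rewrite -(@ler_pXn2r _ 2)// ?nnegrE//; last first.
  by rewrite mulr_ge0// ltW// ltr_wpDl// mulr_ge0.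
rewrite (le_trans h)// exprMn; have : 0 <= M ^+ 2 by rewrite sqr_ge0.
set q := M ^+ 2 => q0; nra.
Qed.

(** If x 0 exceeded 1, then (1 + t)^2 >= 1 + 2 t would give x n at least linear growth, against the
    bound K. *)
Lemma power_growth (x : nat -> R) (K : R) : (forall n, x n ^+ 2 <= x n.+1) ->
  (forall n, x n <= K) -> x 0%N <= 1.
Proof.
move=> xS xK; rewrite leNgt; apply/negP => x1.
have d0 : 0 < x 0%N - 1 by rewrite subr_gt0.
have h n : 1 + n.+1%:R * (x 0%N - 1) <= x n.
  elim: n => [|n IH]; first by rewrite mul1r addrC subrK.
  apply: le_trans (xS n); rewrite (@le_trans _ _ ((1 + n.+1%:R * (x 0%N - 1)) ^+ 2))//.
    rewrite sqrrD expr1n mul1r -addrA lerD2l -[n.+2%:R]natr1 mulrDl mul1r mulr2n -addrA lerD2l.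
    have n1 : 1 <= n.+1%:R :> R by rewrite ler1n.
    have := sqr_ge0 (n.+1%:R * (x 0%N - 1)); nra.
  have p : 0 <= 1 + n.+1%:R * (x 0%N - 1) by rewrite addr_ge0// mulr_ge0// ltW.
  by rewrite ler_pXn2r// nnegrE// (le_trans p IH).
have := truncnS_gt (K / (x 0%N - 1)); rewrite ltr_pdivrMr// => hK.
have := le_trans (h _) (xK (Num.truncn (K / (x 0%N - 1)))).
by move=> /le_lt_trans/(_ hK); rewrite gtrDr ltr10.
Qed.

(* A bound for [v |-> t v] without functional calculus: [S = t^* t] is symmetric,
   so [||S^(2^n) v||^2 <= 4 ||v|| ||S^(2^(n+1)) v||], while [S^k v] grows at most
   like [N^(2 k)] by the crude sup-norm estimate. *)
Lemma pointwise_bound (t t' : G -> B -> B) (N : R) : 0 < N ->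
  (forall h x y, cmul (cadj (t h x)) y = cmul (cadj x) (t' h y)) ->
  (forall h x, rnorm (t h x) <= N * rnorm x) ->
  (forall h x, rnorm (t' h x) <= N * rnorm x) ->
  (forall v, Cc v -> Cc (fun h => t h (v h))) ->
  (forall v, Cc v -> Cc (fun h => t' h (v h))) ->
  forall v, Cc v -> rnorm (L2_of L (fun h => t h (v h))) <= 4 * N * rnorm (L2_of L v).
Proof.
move=> N0 adj tN t'N ct ct' v cv.
pose S h x := t' h (t h x).
have adjS h x y : cmul (cadj (S h x)) y = cmul (cadj x) (S h y).
  have -> : cmul (cadj (t' h (t h x))) y = cmul (cadj (t h x)) (t h y).
    by rewrite -[LHS]cadjK cadjM cadjK -adj cadjM cadjK.
  by rewrite adj.
have adjSk k h x y : cmul (cadj (iter k (S h) x)) y = cmul (cadj x) (iter k (S h) y).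
  by elim: k x y => [//|k IH] x y; rewrite iterSr IH adjS.
pose Sv k h := iter k (S h) (v h).
have cSv k : Cc (Sv k).
  elim: k => [//|k IH]; have := ct' _ (ct _ IH).
  by congr Cc; apply/funext => h.
have innerS k m : inner (L2_of L (Sv k)) (L2_of L (Sv m)) = inner (L2_of L v) (L2_of L (Sv (k + m)%N)).
  have h1 := inner_Cc (cSv k) (cSv m); have h2 := inner_Cc cv (cSv (k + m)%N).
  apply: (bochner_unique h1); suff -> : pairing (Sv k) (Sv m) = pairing v (Sv (k + m)%N) by [].
  by apply/funext => g; rewrite /pairing /Sv adjSk iterD.
pose a := rnorm (L2_of L v).
(* The null vector is settled first, since the normalization below divides by a. *)
have [a0|a0] := eqVneq a 0.
  have ctv := ct _ cv.
  have : inner (L2_of L (fun h => t h (v h))) (L2_of L (fun h => t h (v h))) = inner (L2_of L v) (L2_of L (Sv 1%N)).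
    have h1 := inner_Cc ctv ctv; have h2 := inner_Cc cv (cSv 1%N).
    apply: (bochner_unique h1).
    suff -> : pairing (fun h => t h (v h)) (fun h => t h (v h)) = pairing v (Sv 1%N) by [].
    by apply/funext => g; rewrite /pairing adj.
  rewrite (rnorm0_eq0 a0) inner0l => /(congr1 (@rnorm _ _)).
  rewrite rnorm_inner !rnorm0 mulr0 => /eqP; rewrite sqrf_eq0 => /eqP ->.
  exact: lexx.
have ap : 0 < a by rewrite lt_neqAle eq_sym a0 rnorm_ge0.
have [K cK vK] := Cc_support cv.
have [C C0 hC] := L2_of_bound cK.
have [M M0 vM] := Cc_bounded cv.
have t0 h : t h 0 = 0 by apply: rnorm0_eq0; apply/eqP; rewrite eq_le rnorm_ge0 (le_trans (tN _ _))// rnorm0 mulr0.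
have t'0 h : t' h 0 = 0 by apply: rnorm0_eq0; apply/eqP; rewrite eq_le rnorm_ge0 (le_trans (t'N _ _))// rnorm0 mulr0.
have growth k h : rnorm (Sv k h) <= (N ^+ 2) ^+ k * M.
  elim: k => [|k IH]; first by rewrite expr0 mul1r.
  rewrite /Sv /= -/(Sv k h) (le_trans (t'N _ _))// exprS -mulrA expr2 -mulrA.
  rewrite ler_pM2l// (le_trans (tN _ _))// ler_pM2l//.
have SvK k h : ~ K h -> Sv k h = 0.
  by move=> nK; rewrite /Sv vK//; elim: k => [//|k IH]; rewrite /= IH /S t0 t'0.
have bound k : rnorm (L2_of L (Sv k)) <= C * ((N ^+ 2) ^+ k * M).
  exact: (hC _ _ (cSv k) (SvK k) (growth k)).
have N2 : 0 < N ^+ 2 by rewrite exprn_gt0.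
(* The factor 4 a turns the Cauchy-Schwarz estimate s^2 <= 4 a s' into x_n^2 <= x_(n+1), and the
   power of N makes the sup-norm estimate a bound independent of n. *)
pose x n := rnorm (L2_of L (Sv (2 ^ n)%N)) / (4 * a * (N ^+ 2) ^+ (2 ^ n)%N).
have x0 : x 0%N <= 1.
  apply: (@power_growth _ (C * M / (4 * a))) => n; rewrite /x.
    have := CS_inner (L2_of L v) (L2_of L (Sv (2 ^ n + 2 ^ n)%N)).
    rewrite -innerS rnorm_inner addnn -mul2n -expnS.
    rewrite [in (N ^+ 2) ^+ (2 ^ n.+1)]expnS mulnC exprM -/a.
    set P := (N ^+ 2) ^+ (2 ^ n).
    have P0 : 0 < P by rewrite exprn_gt0.
    set s := rnorm _; set s' := rnorm _ => hs.
    have -> : (s / (4 * a * P)) ^+ 2 = s ^+ 2 / (16 * a ^+ 2 * P ^+ 2).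
      by field; rewrite !gt_eqF.
    have -> : s' / (4 * a * P ^+ 2) = (4 * (a * s')) / (16 * a ^+ 2 * P ^+ 2).
      by field; rewrite !gt_eqF.
    by rewrite ler_pM2r// invr_gt0 !mulr_gt0// exprn_gt0.
  rewrite ler_pdivrMr ?mulr_gt0// ?exprn_gt0//.
  have := bound (2 ^ n)%N; set P := (N ^+ 2) ^+ (2 ^ n) => /le_trans; apply.
  rewrite le_eqVlt; apply/orP; left; apply/eqP.
  by field; rewrite gt_eqF.
(* With x_0 <= 1, the square of the norm of t v is at most 4 a (4 a N^2) = (4 N a)^2. *)
have s0 : rnorm (L2_of L (Sv 1%N)) <= 4 * a * N ^+ 2.
  by move: x0; rewrite /x expn0 expr1 ler_pdivrMr ?mul1r// !mulr_gt0.
have ctv := ct _ cv.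
have h : rnorm (L2_of L (fun h => t h (v h))) ^+ 2 <= 4 * (a * rnorm (L2_of L (Sv 1%N))).
  rewrite -rnorm_inner.
  have -> : inner (L2_of L (fun h => t h (v h))) (L2_of L (fun h => t h (v h))) = inner (L2_of L v) (L2_of L (Sv 1%N)).
    have h1 := inner_Cc ctv ctv; have h2 := inner_Cc cv (cSv 1%N).
    apply: (bochner_unique h1).
    suff -> : pairing (fun h => t h (v h)) (fun h => t h (v h)) = pairing v (Sv 1%N) by [].
    by apply/funext => g; rewrite /pairing adj.
  exact: CS_inner.
have aN0 : 0 <= 4 * N * a by rewrite !mulr_ge0// ltW.
rewrite -(@ler_pXn2r _ 2)// ?nnegrE ?rnorm_ge0//.
rewrite (le_trans h)// -/a.
have := ler_wpM2l (ltW ap) s0; rewrite !exprMn; nra.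
Qed.

Lemma L2_of_seq (x : L) : exists2 u : nat -> G -> B, forall n, Cc (u n) &
  (fun n => L2_of L (u n)) @ \oo --> x.
Proof.
have h n : exists u, Cc u /\ rnorm (L2_of L u - x) < n.+1%:R^-1.
  have : closure [set L2_of L v | v in @Cc R G B] x by rewrite L2_of_dense.
  move=> /(_ [set y | rnorm (y - x) < n.+1%:R^-1])[].
    have /cvg_rnormP := @cvg_id L (nbhs x); apply.
    by rewrite invr_gt0.
  by move=> _ [[u cu <-] h]; exists u.
have [u hu] := choice h; exists u; first by move=> n; have [] := hu n.
apply: (@cvg_rnorm_bound _ _ _ _ _ _ _ (fun n => n.+1%:R^-1)).
  by move=> n; rewrite ltW//; have [] := hu n.
exact: cvg_harmonic.
Qed.

Lemma L2_of_sub u v : Cc u -> Cc v -> L2_of L (fun x => u x - v x) = L2_of L u - L2_of L v.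
Proof.
move=> cu cv; rewrite (L2_ofD L cu (CcN cv)); congr (_ + _).
rewrite -scaleN1r -L2_ofZ//; congr L2_of; apply/funext => g.
by rewrite scaleN1r.
Qed.

Lemma bop_eq (A A' : L -> L) : bounded_op A -> bounded_op A' ->
  (forall u, Cc u -> A (L2_of L u) = A' (L2_of L u)) -> A = A'.
Proof.
move=> bA bA' h; apply/funext => x; have [u cu ux] := L2_of_seq x.
apply: (@cvg_rnorm_unique _ _ _ \oo _ (fun n => A (L2_of L (u n)))).
  exact: cvg_bop.
under eq_fun do rewrite h//.
exact: cvg_bop.
Qed.

Lemma inner_L2_eq (x y : L) :
  (forall u, Cc u -> inner (L2_of L u) x = inner (L2_of L u) y) -> x = y.
Proof.
move=> h; apply/subr0_eq/rnorm0_eq0.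
have [u cu ux] := L2_of_seq (x - y).
have : inner (x - y) (x - y) = 0.
  apply: (@cvg_rnorm_unique _ _ _ \oo _ (fun n => inner (L2_of L (u n)) (x - y))).
    by apply: cvg_inner => //; exact: cvg_cst.
  by under eq_fun do rewrite innerBr h// subrr; exact: cvg_cst.
move=> /(congr1 (@rnorm _ _)); rewrite rnorm_inner rnorm0 => /eqP.
by rewrite sqrf_eq0 => /eqP.
Qed.

(** [T0] is defined on functions rather than on their images in L^2. That it descends to the images
    is a consequence of the bound, applied to a difference of two functions. *)
Lemma dense_extension (T0 : (G -> B) -> L) (M : R) : 0 < M ->
  (forall u v, Cc u -> Cc v -> T0 (fun x => u x + v x) = T0 u + T0 v) ->
  (forall (k : R[i]) u, Cc u -> T0 (fun x => k *: u x) = k *: T0 u) ->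
  (forall u, Cc u -> rnorm (T0 u) <= M * rnorm (L2_of L u)) ->
  exists T : L -> L, [/\ bounded_op T, forall u, Cc u -> T (L2_of L u) = T0 u
    & forall x, rnorm (T x) <= M * rnorm x].
Proof.
move=> M0 TD TZ TM.
have TB u v : Cc u -> Cc v -> rnorm (T0 u - T0 v) <= M * rnorm (L2_of L u - L2_of L v).
  move=> cu cv; rewrite -L2_of_sub//.
  have -> : T0 u - T0 v = T0 (fun x => u x - v x).
    rewrite (TD _ _ cu (CcN cv)); congr (_ + _).
    rewrite -scaleN1r -TZ//; congr T0; apply/funext => g.
    by rewrite scaleN1r.
  by apply: TM; exact: CcB.
(* Quantifying over all approximating sequences makes the value independent of the choice, so
   linearity follows by adding and scaling sequences. *)
pose ext (x y : L) := forall u : nat -> G -> B, (forall n, Cc (u n)) ->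
  (fun n => L2_of L (u n)) @ \oo --> x -> (fun n => T0 (u n)) @ \oo --> y.
have extE x : exists y, ext x y.
  have [u cu ux] := L2_of_seq x.
  have [y uy] : exists y : L, (fun n => T0 (u n)) @ \oo --> y.
    apply: cauchy_seq_cvg => e e0.
    have e2 : 0 < e / (2 * M) by rewrite divr_gt0// mulr_gt0.
    move/cvg_rnormP : (ux) => /(_ _ e2)[N _ NP]; exists N => m n /NP h1 /NP h2.
    rewrite (le_lt_trans (TB _ _ _ _))// mulrC -ltr_pdivlMr//.
    have := ler_rnormBD (L2_of L (u m)) x (L2_of L (u n)); rewrite (rnormB x) => /le_lt_trans; apply.
    have -> : e / M = e / (2 * M) + e / (2 * M) by field; rewrite gt_eqF.
    exact: ltrD.
  exists y => w cw wx; apply/cvg_rnormP => e e0.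
  have e3 : 0 < e / (3 * M) by rewrite divr_gt0// mulr_gt0.
  have e4 : 0 < e / 3 by rewrite divr_gt0.
  move/cvg_rnormP : wx => /(_ _ e3); move/cvg_rnormP : ux => /(_ _ e3).
  move/cvg_rnormP : uy => /(_ _ e4) h1 h2 h3.
  apply: filterS3 h1 h2 h3 => n h1 h2 h3.
  have := ler_rnormBD (T0 (w n)) (T0 (u n)) y => /le_lt_trans; apply.
  have := ler_rnormBD (L2_of L (w n)) x (L2_of L (u n)); rewrite (rnormB x) => h4.
  have h5 : M * rnorm (L2_of L (w n) - L2_of L (u n)) < M * (e / (3 * M) + e / (3 * M)).
    by rewrite ltr_pM2l// (le_lt_trans h4)// ltrD.
  have h6 := TB _ _ (cw n) (cu n).
  have eE : M * (e / (3 * M) + e / (3 * M)) + e / 3 = e by field; rewrite gt_eqF.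
  by rewrite -[ltRHS]eE ltrD// (le_lt_trans h6).
have [T hT] := choice extE.
have Tu u : Cc u -> T (L2_of L u) = T0 u.
  move=> cu; apply: (@cvg_rnorm_unique _ _ _ \oo _ (fun n => T0 u)); last exact: cvg_cst.
  by apply: (hT _ (fun=> u)) => //; exact: cvg_cst.
have TM' x : rnorm (T x) <= M * rnorm x.
  have [u cu ux] := L2_of_seq x.
  have h1 : (fun n => rnorm (T0 (u n))) @ \oo --> rnorm (T x).
    by apply: cvg_rnorm; exact: hT.
  have h2 : (fun n => M * rnorm (L2_of L (u n))) @ \oo --> M * rnorm x.
    by apply: cvgM; [exact: cvg_cst|exact: cvg_rnorm].
  by apply: (ler_cvg_to h1 h2); apply: nearW => n; exact: TM.
exists T; split=> //; apply: (bop_intro _ _ TM').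
- move=> x y; have [u cu ux] := L2_of_seq x; have [v cv vy] := L2_of_seq y.
  have xy : (fun n => L2_of L (fun g => u n g + v n g)) @ \oo --> x + y.
    by under eq_fun do rewrite L2_ofD//; exact: cvgD.
  apply: (@cvg_rnorm_unique _ _ _ \oo _ (fun n => T0 (fun g => u n g + v n g))).
    by apply: (hT _ (fun n => (fun g => u n g + v n g))) => // n; exact: CcD.
  by under eq_fun do rewrite TD//; apply: cvgD; exact: hT.
- move=> k x; have [u cu ux] := L2_of_seq x.
  have kx : (fun n => L2_of L (fun g => k *: u n g)) @ \oo --> k *: x.
    by under eq_fun do rewrite L2_ofZ//; exact: cvgZr.
  apply: (@cvg_rnorm_unique _ _ _ \oo _ (fun n => T0 (fun g => k *: u n g))).
    by apply: (hT _ (fun n => (fun g => k *: u n g))) => // n; exact: CcZ.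
  by under eq_fun do rewrite TZ//; apply: cvgZr; exact: hT.
Qed.

End Module.
End CompactSupport.

(** * Shifts and multipliers *)

Section Multipliers.
Context {R : realType} {G : topologicalGroupType} (B : GCstarAlgebra R G).
Hypothesis G_hausdorff : hausdorff_space G.
Hypothesis G_lc : locally_compact [set: G].
Context (mu : {measure set (borel G) -> \bar R}).
Hypothesis mu_haar : is_haar mu.
Context (L : L2_completion mu B).
Implicit Types (u v : G -> B) (z : L) (tau phi : G -> R).

(** Equiboundedness reduces strong convergence to C_c(G,B). The filter is arbitrary because it is
    applied both along refining partitions and along sequences. *)
Lemma equibounded_lim (I : Type) (F : set_system I) {FF : ProperFilter F}
    (A : I -> L -> L) (M : R) : 0 < M ->
  (\forall i \near F, bounded_op (A i) /\ forall x, rnorm (A i x) <= M * rnorm x) ->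
  (forall u, Cc u -> exists y : L, (fun i => A i (L2_of L u)) @ F --> y) ->
  exists T : L -> L, [/\ bounded_op T, forall x, rnorm (T x) <= M * rnorm x
    & forall x, (fun i => A i x) @ F --> T x].
Proof.
move=> M0 AM Acvg.
have [T0 hT0] : exists T0 : (G -> B) -> L, forall u, Cc u -> (fun i => A i (L2_of L u)) @ F --> T0 u.
  suff : forall u, exists y : L, Cc u -> (fun i => A i (L2_of L u)) @ F --> y.
    by move=> /choice[T0 h]; exists T0.
  move=> u; have [cu|ncu] := pselect (Cc u); last by exists 0.
  by have [y hy] := Acvg u cu; exists y.
have [u v cu cv|k u cu|u cu|T [bT TE TM]] := @dense_extension R G B G_hausdorff mu L T0 M M0.
- apply: (@cvg_rnorm_unique _ _ _ F FF (fun i => A i (L2_of L (fun x => u x + v x)))).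
    by apply: hT0; exact: CcD.
  have : (fun i => A i (L2_of L u) + A i (L2_of L v)) @ F --> T0 u + T0 v.
    by apply: cvgD; exact: hT0.
  apply: cvg_trans; apply: near_eq_cvg; apply: filterS AM => i [bA _].
  by rewrite L2_ofD// blinD.
- apply: (@cvg_rnorm_unique _ _ _ F FF (fun i => A i (L2_of L (fun x => k *: u x)))).
    by apply: hT0; exact: CcZ.
  have : (fun i => k *: A i (L2_of L u)) @ F --> k *: T0 u.
    by apply: cvgZr; exact: hT0.
  apply: cvg_trans; apply: near_eq_cvg; apply: filterS AM => i [bA _].
  by rewrite L2_ofZ// blinZ.
- by apply: (cvg_rnorm_le (hT0 _ cu)); apply: filterS AM => i [_]; exact.
exists T; split=> // x; apply/cvg_rnormP => e e0.
have [u cu ux] := L2_of_seq x.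
have e3 : 0 < e / (3 * M) by rewrite divr_gt0// mulr_gt0.
have e4 : 0 < e / 3 by rewrite divr_gt0.
move/cvg_rnormP : ux => /(_ _ e3)[n _ /(_ n (leqnn n)) /= un].
have /cvg_rnormP/(_ _ e4) := hT0 _ (cu n).
apply: filterS2 AM => i [bA AMi]; rewrite -TE// => h.
have h1 : rnorm (A i x - A i (L2_of L (u n))) < e / 3.
  rewrite -blinB// (le_lt_trans (AMi _))// rnormB.
  have -> : e / 3 = M * (e / (3 * M)) by field; rewrite gt_eqF.
  by rewrite ltr_pM2l.
have h2 : rnorm (T (L2_of L (u n)) - T x) < e / 3.
  rewrite -blinB// (le_lt_trans (TM _))//.
  have -> : e / 3 = M * (e / (3 * M)) by field; rewrite gt_eqF.
  by rewrite ltr_pM2l.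
have := ler_rnormBD (A i x) (A i (L2_of L (u n))) (T x).
have := ler_rnormBD (A i (L2_of L (u n))) (T (L2_of L (u n))) (T x).
move: h h1 h2; lra.
Qed.

Lemma equibounded_cvg (I : Type) (F : set_system I) {FF : ProperFilter F}
    (A : I -> L -> L) (T : L -> L) (M : R) : 0 < M ->
  (\forall i \near F, bounded_op (A i) /\ forall x, rnorm (A i x) <= M * rnorm x) ->
  bounded_op T ->
  (forall u, Cc u -> (fun i => A i (L2_of L u)) @ F --> T (L2_of L u)) ->
  forall x, (fun i => A i x) @ F --> T x.
Proof.
move=> M0 AM bT AT.
have [u cu|T' [bT' _ h]] := equibounded_lim M0 AM; first by exists (T (L2_of L u)); exact: AT.
suff -> : T = T' by [].
apply: (bop_eq (L := L)) => // u cu.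
exact: (cvg_rnorm_unique (AT u cu) (h _)).
Qed.

Lemma inner_Cc_eq (f h : L -> L) : bounded_op f -> bounded_op h ->
  (forall u v, Cc u -> Cc v ->
     inner (f (L2_of L u)) (L2_of L v) = inner (L2_of L u) (h (L2_of L v))) ->
  forall x y, inner (f x) y = inner x (h y).
Proof.
move=> bf bh fh x y.
have [u cu ux] := L2_of_seq x; have [v cv vy] := L2_of_seq y.
apply: (@cvg_rnorm_unique _ _ _ \oo _ (fun n => inner (f (L2_of L (u n))) (L2_of L (v n)))).
  by apply: cvg_inner => //; exact: cvg_bop.
by under eq_fun do rewrite fh//; apply: cvg_inner => //; exact: cvg_bop.
Qed.

Lemma L2_class_unique z z' (h : G -> B) : L2_class z h -> L2_class z' h -> z = z'.
Proof.
move=> hz hz'; apply: inner_L2_eq => u cu.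
exact: (bochner_unique (hz u cu) (hz' u cu)).
Qed.

Lemma L2_class_Cc v : Cc v -> L2_class (L2_of L v) v.
Proof. by move=> cv u cu; exact: inner_Cc. Qed.

Lemma pairing_scale (r : G -> R) u v g :
  pairing u (fun g => (r g)%:C *: v g) g = (r g)%:C *: pairing u v g.
Proof. by rewrite /pairing cmulZr gactZ. Qed.

Lemma pairing_scalel (r : G -> R) u v g :
  pairing (fun g => (r g)%:C *: u g) v g = (r g)%:C *: pairing u v g.
Proof. by rewrite /pairing cadjZ conj_real cmulZl gactZ. Qed.

Lemma nmeas_pairing tau u v : measurable_fun [set: borel G] (tau : borel G -> R) ->
  Cc u -> Cc v -> @nmeas R _ (borel G) B (pairing u (fun g => (tau g)%:C *: v g)).
Proof.
move=> mtau cu cv.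
have -> : pairing u (fun g => (tau g)%:C *: v g) = (fun g : borel G => (tau g)%:C *: pairing u v g).
  by apply/funext => g; rewrite pairing_scale.
apply: nmeas_scale_continuous => //.
by apply: continuous_pairing; exact: Cc_continuous.
Qed.

Section Shift.
Implicit Types (b : B) (g : G).

(** The integrand form of the adjoint: after a translation of the variable, the shift by g with
    coefficient b is dual to the shift by g^-1 with coefficient g^-1 applied to the adjoint of b. *)
Lemma pairing_shift b g u (w : G -> B) h :
  pairing (shift_op b g u) w h =
  pairing u (shift_op (gact g^-1%g (cadj b)) g^-1%g w) (g^-1 * h)%g.
Proof.
rewrite /pairing /shift_op invgM !invgK mulVKg gactM; congr (gact _ _).
by rewrite cadjM -gact_cadj -gact_cmul gact_cmul -gactM mulgV gact1 cmulA.
Qed.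

Lemma bochner_translate g (f : borel G -> B) I : is_bochner mu f I ->
  is_bochner mu (fun h : borel G => f (g * h)%g) I.
Proof.
move=> fI; apply: (bochner_push (h := fun h : borel G => (g * h)%g : borel G)) fI.
  by apply: (continuous_borel (f := fun h => (g * h)%g)); exact: continuous_mulgl.
by move=> A mA; exact: haar_preimage.
Qed.

Lemma inner_shift b g u v : Cc u -> Cc v ->
  inner (L2_of L (shift_op b g u)) (L2_of L v) =
  inner (L2_of L u) (L2_of L (shift_op (gact g^-1%g (cadj b)) g^-1%g v)).
Proof.
move=> cu cv.
have h1 := inner_Cc G_hausdorff mu_haar L (Cc_shift G_hausdorff b g cu) cv.
have h2 := inner_Cc G_hausdorff mu_haar L cu (Cc_shift G_hausdorff (gact g^-1%g (cadj b)) g^-1%g cv).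
apply: (bochner_unique h1).
have := bochner_translate g^-1%g h2.
by congr is_bochner; apply/funext => h; rewrite pairing_shift.
Qed.

Lemma shift_adjK b g :
  gact (g^-1)^-1%g (cadj (gact g^-1%g (cadj b))) = b.
Proof. by rewrite -gact_cadj cadjK invgK -gactM mulgV gact1. Qed.

(** In the inner product the translation and the action of g cancel, leaving left multiplication by
    b' = g^-1(b). The norm of b' is at most 2 N, and [pointwise_bound] contributes the factor 4. *)
Lemma shift_bound b g (N : R) u : 0 < N -> rnorm b <= N -> Cc u ->
  rnorm (L2_of L (shift_op b g u)) <= 8 * N * rnorm (L2_of L u).
Proof.
move=> N0 bN cu; pose b' := gact g^-1%g b.
have b'N : rnorm b' <= 2 * N by rewrite (le_trans (gact_bound _ _))// ler_wpM2l.
have N2 : 0 < 2 * N by rewrite mulr_gt0.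
have cb := Cc_cmul G_hausdorff b' cu.
have cs := Cc_shift G_hausdorff b g cu.
have -> : rnorm (L2_of L (shift_op b g u)) = rnorm (L2_of L (fun h => cmul b' (u h))).
  apply/eqP; rewrite -(@eqrXn2 _ 2)// ?rnorm_ge0// -!rnorm_inner; apply/eqP; congr rnorm.
  have h1 := inner_Cc G_hausdorff mu_haar L cs cs.
  have h2 := inner_Cc G_hausdorff mu_haar L cb cb.
  apply: (bochner_unique h1); have := bochner_translate g^-1%g h2.
  congr is_bochner; apply/funext => h; rewrite pairing_shift /pairing.
  congr (gact _ _); rewrite cadjM -cmulA; congr cmul.
  rewrite /shift_op invgK mulVKg -gact_cadj !gact_cmul -gactM mulVg gact1.
  by rewrite -/b'.
have -> : 8 * N = 4 * (2 * N) by ring.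
apply: (@pointwise_bound R G B G_hausdorff mu mu_haar L (fun _ x => cmul b' x) (fun _ x => cmul (cadj b') x)) => //.
- by move=> _ x y; rewrite cadjM cmulA.
- by move=> _ x; rewrite (le_trans (rnormM_le _ _))// ler_wpM2r ?rnorm_ge0.
- by move=> _ x; rewrite (le_trans (rnormM_le _ _))// rnorm_adj ler_wpM2r ?rnorm_ge0.
- by move=> v; exact: Cc_cmul.
- by move=> v; exact: Cc_cmul.
Qed.

Definition Sop b g : L -> L :=
  xget (@id L) [set T : L -> L | bounded_op T /\ forall u, Cc u -> T (L2_of L u) = L2_of L (shift_op b g u)].

Lemma Sop_spec b g : [/\ bounded_op (Sop b g),
   forall u, Cc u -> Sop b g (L2_of L u) = L2_of L (shift_op b g u) &
   forall N x, 0 < N -> rnorm b <= N -> rnorm (Sop b g x) <= 8 * N * rnorm x].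
Proof.
pose N0 := rnorm b + 1.
have N00 : 0 < N0 by rewrite ltr_wpDl// rnorm_ge0.
have N80 : 0 < 8 * N0 by rewrite mulr_gt0.
have bN0 : rnorm b <= N0 by rewrite lerDl.
have [u v cu cv|k u cu|u cu|T [bT TE _]] := @dense_extension R G B G_hausdorff mu L
    (fun u => L2_of L (shift_op b g u)) (8 * N0) N80.
- rewrite -L2_ofD; [|exact: Cc_shift|exact: Cc_shift].
  by congr L2_of; apply/funext => h; rewrite /shift_op gactD cmulDr.
- rewrite -L2_ofZ; last exact: Cc_shift.
  by congr L2_of; apply/funext => h; rewrite /shift_op gactZ cmulZr.
- exact: shift_bound.
have [bS SE] : bounded_op (Sop b g) /\ forall u, Cc u -> Sop b g (L2_of L u) = L2_of L (shift_op b g u).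
  suff : [set T0 : L -> L | bounded_op T0 /\ forall u, Cc u -> T0 (L2_of L u) = L2_of L (shift_op b g u)] (Sop b g) by [].
  by apply: xgetPex; exists T.
split=> // N x N1 bN.
have [u cu ux] := L2_of_seq x.
have h1 : (fun n => rnorm (Sop b g (L2_of L (u n)))) @ \oo --> rnorm (Sop b g x).
  by apply: cvg_rnorm; exact: cvg_bop.
have h2 : (fun n => 8 * N * rnorm (L2_of L (u n))) @ \oo --> 8 * N * rnorm x.
  by apply: cvgM; [exact: cvg_cst|exact: cvg_rnorm].
by apply: (ler_cvg_to h1 h2); apply: nearW => n; rewrite SE// shift_bound.
Qed.

Lemma Sop_bop b g : bounded_op (Sop b g). Proof. by have [] := Sop_spec b g. Qed.

Lemma Sop_Cc b g u : Cc u -> Sop b g (L2_of L u) = L2_of L (shift_op b g u).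
Proof. by have [_ + _] := Sop_spec b g; exact. Qed.

Lemma Sop_bound b g N x : 0 < N -> rnorm b <= N -> rnorm (Sop b g x) <= 8 * N * rnorm x.
Proof. by have [_ _] := Sop_spec b g; exact. Qed.

Lemma Sop_adj b g x y :
  inner (Sop b g x) y = inner x (Sop (gact g^-1%g (cadj b)) g^-1%g y).
Proof.
apply: inner_Cc_eq; [exact: Sop_bop|exact: Sop_bop|] => u v cu cv.
by rewrite !Sop_Cc// inner_shift.
Qed.

End Shift.

Definition mbounded tau : Prop :=
  measurable_fun [set: borel G] (tau : borel G -> R) /\ exists N, forall g, `|tau g| <= N.

Lemma mbounded_pos tau : mbounded tau -> exists2 N, 0 < N & forall g, `|tau g| <= N.
Proof.
move=> [_ [N hN]]; exists (N + 1); last by move=> g; rewrite (le_trans (hN g))// lerDl.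
by rewrite ltr_wpDl// (le_trans _ (hN 1%g)).
Qed.

Lemma mbounded_cst (r : R) : mbounded (fun=> r).
Proof. by split; [exact: measurable_cst|exists `|r|]. Qed.

Lemma mboundedM tau phi : mbounded tau -> mbounded phi -> mbounded (fun g => tau g * phi g).
Proof.
move=> ht hp; have [mt _] := ht; have [mp _] := hp.
have [N N0 hN] := mbounded_pos ht; have [N' N'0 hN'] := mbounded_pos hp.
split; first exact: measurable_funM.
by exists (N * N') => g; rewrite normrM ler_pM.
Qed.

Lemma mboundedB tau phi : mbounded tau -> mbounded phi -> mbounded (fun g => tau g - phi g).
Proof.
move=> [mt [N hN]] [mp [N' hN']]; split; first exact: measurable_funB.
by exists (N + N') => g; rewrite (le_trans (ler_normB _ _))// lerD.
Qed.

Lemma mboundedX tau n : mbounded tau -> mbounded (fun g => tau g ^+ n).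
Proof.
move=> ht; elim: n => [|n IH].
  by under eq_fun do rewrite expr0; exact: mbounded_cst.
by under eq_fun do rewrite exprS; exact: mboundedM.
Qed.

Lemma mbounded_translate tau g : mbounded tau -> mbounded (fun h => tau (g^-1 * h)%g).
Proof.
move=> [mt [N hN]]; split; last by exists N.
have mg : measurable_fun [set: borel G] (fun h : borel G => (g^-1 * h)%g : borel G).
  by apply: (continuous_borel (f := fun h => (g^-1 * h)%g)); exact: continuous_mulgl.
exact: (measurableT_comp mt mg).
Qed.

(** tau u is the limit of f_n u with f_n continuous, close to tau in L^1 over K. Convergence in L^1
    is enough for L^2 because |f_n - f_m|^2 is at most 2 N (|f_n - tau| + |f_m - tau|). The sequence
    is part of the conclusion, as later proofs pass to the limit along it. *)
Lemma mult_exists tau (N : R) u (K : set G) :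
  measurable_fun [set: borel G] (tau : borel G -> R) -> 0 < N -> (forall g, `|tau g| <= N) ->
  Cc u -> compact K -> (forall g, ~ K g -> u g = 0) ->
  exists z, L2_class z (fun g => (tau g)%:C *: u g) /\ exists f : nat -> G -> R,
    [/\ forall n, continuous (f n), forall n g, `|f n g| <= N,
        (fun n => L2_of L (fun g => (f n g)%:C *: u g)) @ \oo --> z
      & forall e : R, 0 < e -> \forall n \near \oo,
          (\int[mu]_g (\1_K (g : borel G) * `|f n g - tau g|)%:E < e%:E)%E].
Proof.
move=> mtau N0 tN cu cK uK.
have mK : measurable (K : set (borel G)) by exact: compact_borel.
have /choice[f hf] : forall n : nat, exists f : G -> R, [/\ continuous f, forall g, `|f g| <= N &
   (\int[mu]_g (\1_K (g : borel G) * `|f g - tau g|)%:E < (n.+1%:R^-1)%:E)%E].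
  move=> n.
  by apply: (approx_bounded G_hausdorff G_lc mu_haar cK mtau N0 tN); rewrite invr_gt0.
have cf n : continuous (f n) by have [] := hf n.
have fN n g : `|f n g| <= N by have [_ + _] := hf n.
have cfu n : Cc (fun g => (f n g)%:C *: u g) by exact: Cc_scale.
have mk n : measurable_fun [set: borel G] (fun g => \1_K (g : borel G) * `|f n g - tau g|).
  apply: measurable_funM; first exact: measurable_indic.
  apply: measurableT_comp => //; apply: measurable_funB => //.
  exact: continuous_borel_real.
have k0 n (g : borel G) : 0 <= \1_K g * `|f n g - tau g| by rewrite mulr_ge0.
have [M M0 uM] := Cc_bounded cu.
(* Product of 2 from [pairing_bound], 2 N from the bound on f_n - f_m, and M^2 from u. *)
pose c := 4 * N * M ^+ 2.
have c0 : 0 < c by rewrite !mulr_gt0// exprn_gt0.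
have dist n m : rnorm (L2_of L (fun g => (f n g)%:C *: u g) - L2_of L (fun g => (f m g)%:C *: u g)) ^+ 2
     < c * (n.+1%:R^-1 + m.+1%:R^-1).
  rewrite -L2_of_sub// -rnorm_inner -lte_fin EFinM.
  set d := fun g : G => _.
  have cd : Cc d by exact: CcB.
  apply: (@le_lt_trans _ _ (c%:E * \int[mu]_g (\1_K (g : borel G) * `|f n g - tau g| +
     \1_K (g : borel G) * `|f m g - tau g|)%:E)%E).
    rewrite -ge0_integralZ_real; [|by apply: measurable_funD|by move=> g; rewrite addr_ge0|exact: ltW].
    apply: (bochner_norm (inner_Cc G_hausdorff mu_haar L cd cd)).
      by apply: measurable_funM; [exact: measurable_cst|exact: measurable_funD].
    move=> g; have [Kg|nKg] := pselect (K g); last first.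
      by rewrite /pairing /d uK// !scaler0 subr0 cmul0r gact0 rnorm0 mulr_ge0 ?addr_ge0// ltW.
    rewrite indicE mem_set// !mul1r (le_trans (pairing_bound _ _ _))//.
    rewrite /d -scalerBl -rmorphB rnormZr.
    have := uM g; have := rnorm_ge0 (u g).
    have : `|f n g - f m g| <= 2 * N.
      by rewrite (le_trans (ler_normB _ _))//; have := fN n g; have := fN m g; lra.
    have : `|f n g - f m g| <= `|f n g - tau g| + `|f m g - tau g|.
      by rewrite [X in _ <= _ + X]distrC -(subrKA (tau g)) ler_normD.
    have := normr_ge0 (f n g - f m g).
    set p := `|f n g - f m g|; set q := _ + _; set r := rnorm _ => p0 pq pN r0 rM.
    have pp : p * p <= 2 * N * q by rewrite ler_pM.
    have rr : r * r <= M ^+ 2 by rewrite expr2 ler_pM.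
    have -> : p * r * (p * r) = (p * p) * (r * r) by ring.
    have -> : c * q = 2 * ((2 * N * q) * M ^+ 2) by rewrite /c; ring.
    by rewrite ler_wpM2l// ler_pM// mulr_ge0.
  rewrite ge0_integralD_real//.
  by rewrite lte_pmul2l// EFinD lteD//; have [_ _] := hf n; have [_ _] := hf m.
have small (e : R) : 0 < e -> exists n0, forall n, (n0 <= n)%N -> n.+1%:R^-1 < e.
  move=> e0; have [n0 _ NP] := near_infty_natSinv_lt (PosNum e0).
  by exists n0 => n /NP.
have [z uz] : exists z : L, (fun n => L2_of L (fun g => (f n g)%:C *: u g)) @ \oo --> z.
  apply: cauchy_seq_cvg => e e0.
  have [|n0 NP] := small (e ^+ 2 / (2 * c)); first by rewrite divr_gt0 ?exprn_gt0// mulr_gt0.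
  exists n0 => n m /NP h1 /NP h2.
  rewrite -(@ltr_pXn2r _ 2)// ?nnegrE ?rnorm_ge0 ?(ltW e0)// (lt_trans (dist n m))//.
  have -> : e ^+ 2 = c * (e ^+ 2 / (2 * c) + e ^+ 2 / (2 * c)) by field; rewrite gt_eqF.
  by rewrite ltr_pM2l// ltrD.
have kc (e : R) : 0 < e -> \forall n \near \oo,
    (\int[mu]_g (\1_K (g : borel G) * `|f n g - tau g|)%:E < e%:E)%E.
  move=> /small[n0 NP]; exists n0 => // n /= /NP h.
  have [_ _ h2] := hf n; apply: (lt_trans h2); rewrite lte_fin//.
exists z; split; last by exists f; split.
move=> v cv; have [M' M'0 vM'] := Cc_bounded cv.
pose d := 2 * (M' * M).
have d0 : 0 < d by rewrite !mulr_gt0.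
have [n|||n g|e e0|I hI vI] := @bochner_lim R _ (borel G) mu B
   (fun n => pairing v (fun g => (f n g)%:C *: u g))
   (fun n => inner (L2_of L v) (L2_of L (fun g => (f n g)%:C *: u g)))
   (fun n g => d * (\1_K (g : borel G) * `|f n g - tau g|))
   (pairing v (fun g => (tau g)%:C *: u g)).
- exact: inner_Cc.
- exact: nmeas_pairing.
- by move=> n; apply: measurable_funM => //; exact: measurable_cst.
- rewrite !pairing_scale -scalerBl -rmorphB rnormZr.
  have [Kg|nKg] := pselect (K g); last first.
    by rewrite /pairing uK// cmul0r gact0 rnorm0 mulr0 mulr_ge0// ltW.
  rewrite indicE mem_set// mul1r mulrC ler_wpM2r// (le_trans (pairing_bound _ _ _))//.
  by rewrite ler_wpM2l// ler_pM// rnorm_ge0.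
- have : 0 < e / d by rewrite divr_gt0.
  move=> /kc; apply: filterS => n h.
  rewrite ge0_integralZ_real//; last exact: ltW.
  have -> : e = d * (e / d) by field; rewrite gt_eqF.
  by rewrite (EFinM d (e / d)) lte_pmul2l.
have -> : inner (L2_of L v) z = I; last exact: hI.
apply: (@cvg_rnorm_unique _ _ _ \oo _ (fun n => inner (L2_of L v) (L2_of L (fun g => (f n g)%:C *: u g)))) => //.
by apply: cvg_inner => //; exact: cvg_cst.
Qed.

Definition Mop tau : L -> L :=
  xget (@id L) [set T : L -> L | bounded_op T /\
    forall u, Cc u -> L2_class (T (L2_of L u)) (fun g => (tau g)%:C *: u g)].

Lemma mult_bound tau (N : R) u z :
  measurable_fun [set: borel G] (tau : borel G -> R) -> 0 < N -> (forall g, `|tau g| <= N) ->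
  Cc u -> L2_class z (fun g => (tau g)%:C *: u g) -> rnorm z <= 4 * N * rnorm (L2_of L u).
Proof.
move=> mtau N0 tN cu hz; have [K cK uK] := Cc_support cu.
have [z' [hz' [f [cf fN fz' _]]]] := mult_exists mtau N0 tN cu cK uK.
rewrite (L2_class_unique hz hz'); apply: (cvg_rnorm_le fz'); apply: nearW => n.
apply: (@pointwise_bound R G B G_hausdorff mu mu_haar L (fun h x => (f n h)%:C *: x) (fun h x => (f n h)%:C *: x)) => //.
- by move=> h x y; rewrite cadjZ conj_real cmulZl cmulZr.
- by move=> h x; rewrite rnormZr ler_wpM2r ?rnorm_ge0.
- by move=> h x; rewrite rnormZr ler_wpM2r ?rnorm_ge0.
- by move=> v; exact: Cc_scale.
- by move=> v; exact: Cc_scale.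
Qed.

Lemma nmeas_pairingZ tau u v : mbounded tau -> Cc u -> Cc v ->
  @nmeas R _ (borel G) B (pairing u (fun g => (tau g)%:C *: v g)).
Proof. by move=> [mt _]; exact: nmeas_pairing. Qed.

Lemma Mop_ex tau : mbounded tau -> bounded_op (Mop tau) /\
  forall u, Cc u -> L2_class (Mop tau (L2_of L u)) (fun g => (tau g)%:C *: u g).
Proof.
move=> ht; have [mt _] := ht; have [N N0 tN] := mbounded_pos ht.
have [T0 hT0] : exists T0 : (G -> B) -> L, forall u, Cc u -> L2_class (T0 u) (fun g => (tau g)%:C *: u g).
  suff : forall u, exists z, Cc u -> L2_class z (fun g => (tau g)%:C *: u g).
    by move=> /choice[T0 h]; exists T0.
  move=> u; have [cu|ncu] := pselect (Cc u); last by exists 0.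
  have [K cK uK] := Cc_support cu.
  by have [z [hz _]] := mult_exists mt N0 tN cu cK uK; exists z.
have [|u v cu cv|k u cu|u cu|T [bT TE _]] := @dense_extension R G B G_hausdorff mu L T0 (4 * N).
- by rewrite mulr_gt0.
- apply: L2_class_unique (hT0 _ (CcD G_hausdorff cu cv)) _ => w cw.
  have := bochnerD (hT0 u cu w cw) (hT0 v cv w cw).
  rewrite -innerD.
  have -> : (fun x => pairing w (fun g => (tau g)%:C *: u g) x + pairing w (fun g => (tau g)%:C *: v g) x)
    = pairing w (fun g => (tau g)%:C *: (u g + v g)).
    by apply/funext => g; rewrite /pairing scalerDr cmulDr gactD.
  by apply; apply: nmeas_pairing => //; exact: CcD.
- apply: L2_class_unique (hT0 _ (CcZ G_hausdorff k cu)) _ => w cw.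
  have e : (fun b : B => k *: b) \o (pairing w (fun g => (tau g)%:C *: u g)) =
     pairing w (fun g => (tau g)%:C *: (k *: u g)).
    by apply/funext => g; rewrite /pairing /= scalerA mulrC -scalerA (cmulZr k) gactZ.
  have := @bochner_map R _ _ mu B B (fun b : B => k *: b) (complex.Re `|k|) _ _ _ _ _ _ (hT0 u cu w cw).
  rewrite e -innerZ; apply.
  + by move=> a b; rewrite scalerDr.
  + by move=> r b; rewrite !scalerA mulrC.
  + by move=> b; rewrite rnormZ.
  + by apply: nmeas_pairing => //; exact: CcZ.
- exact: (mult_bound mt N0 tN cu (hT0 _ cu)).
suff : [set T1 : L -> L | bounded_op T1 /\
    forall u, Cc u -> L2_class (T1 (L2_of L u)) (fun g => (tau g)%:C *: u g)] (Mop tau) by [].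
apply: xgetPex; exists T; split=> // u cu.
by rewrite TE//; exact: hT0.
Qed.

Lemma Mop_bop tau : mbounded tau -> bounded_op (Mop tau).
Proof. by case/Mop_ex. Qed.

Lemma Mop_class tau u : mbounded tau -> Cc u ->
  L2_class (Mop tau (L2_of L u)) (fun g => (tau g)%:C *: u g).
Proof. by move=> /Mop_ex[_]; exact. Qed.

Lemma Mop_bound tau (N : R) x : mbounded tau -> 0 < N -> (forall g, `|tau g| <= N) ->
  rnorm (Mop tau x) <= 4 * N * rnorm x.
Proof.
move=> ht N0 tN; have [mt _] := ht; have [u cu ux] := L2_of_seq x.
have h1 : (fun n => rnorm (Mop tau (L2_of L (u n)))) @ \oo --> rnorm (Mop tau x).
  by apply: cvg_rnorm; apply: cvg_bop => //; exact: Mop_bop.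
have h2 : (fun n => 4 * N * rnorm (L2_of L (u n))) @ \oo --> 4 * N * rnorm x.
  by apply: cvgM; [exact: cvg_cst|exact: cvg_rnorm].
apply: (ler_cvg_to h1 h2); apply: nearW => n.
exact: (mult_bound mt N0 tN (cu n) (Mop_class ht (cu n))).
Qed.

Lemma Mop_eq_support tau phi u (K : set G) : mbounded tau -> mbounded phi -> Cc u ->
  (forall g, ~ K g -> u g = 0) -> (forall g, K g -> tau g = phi g) ->
  Mop tau (L2_of L u) = Mop phi (L2_of L u).
Proof.
move=> ht hp cu uK tp; apply: (L2_class_unique (Mop_class ht cu)).
have -> : (fun g => (tau g)%:C *: u g) = (fun g => (phi g)%:C *: u g); last exact: Mop_class.
apply/funext => g; have [Kg|nKg] := pselect (K g); first by rewrite tp.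
by rewrite uK// !scaler0.
Qed.

Lemma Mop_sym tau x y : mbounded tau -> inner (Mop tau x) y = inner x (Mop tau y).
Proof.
move=> ht; apply: inner_Cc_eq; [exact: Mop_bop|exact: Mop_bop|] => u v cu cv.
rewrite -inner_adj; have h1 := Mop_class ht cv cu; apply: bochner_unique h1.
have h2 := Mop_class ht cu cv.
have e : @cadj R B \o (pairing v (fun g => (tau g)%:C *: u g)) = pairing u (fun g => (tau g)%:C *: v g).
  apply/funext => g; rewrite /pairing /= -gact_cadj cadjM cadjK cadjZ conj_real.
  by rewrite cmulZl cmulZr.
have := @bochner_map R _ _ mu B B (@cadj R B) 1 _ _ _ _ _ _ h2; rewrite e; apply.
- exact: cadjD.
- by move=> r b; rewrite cadjZ conj_real.
- by move=> b; rewrite rnorm_adj mul1r.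
- exact: nmeas_pairingZ.
Qed.

Lemma Mop_cst (r : R) x : Mop (fun=> r) x = r%:C *: x.
Proof.
suff -> : @Mop (fun=> r) = (fun x => r%:C *: x) by [].
apply: (bop_eq (L := L)); [exact/Mop_bop/mbounded_cst|apply: bopZ; exact: bop_id|] => u cu.
rewrite -L2_ofZ//; apply: (L2_class_unique (Mop_class (mbounded_cst r) cu)).
by apply: L2_class_Cc; exact: CcZ.
Qed.

Lemma Mop1 x : Mop (fun=> 1) x = x.
Proof. by rewrite Mop_cst scale1r. Qed.

Lemma MopB tau phi x : mbounded tau -> mbounded phi ->
  Mop (fun g => tau g - phi g) x = Mop tau x - Mop phi x.
Proof.
move=> ht hp; have htp := mboundedB ht hp.
have b0 := Mop_bop htp; have b1 := Mop_bop ht; have b2 := Mop_bop hp.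
suff -> : Mop (fun g => tau g - phi g) = (fun x0 => Mop tau x0 - Mop phi x0) by [].
apply: (bop_eq b0 (bopB b1 b2)).
move=> u cu; apply/eqP; rewrite eq_sym subr_eq; apply/eqP.
apply: (L2_class_unique (Mop_class ht cu)) => w cw.
have := bochnerD (Mop_class htp cu cw) (Mop_class hp cu cw).
rewrite -innerD.
have -> : (fun x => pairing w (fun g => (tau g - phi g)%:C *: u g) x + pairing w (fun g => (phi g)%:C *: u g) x)
    = pairing w (fun g => (tau g)%:C *: u g).
  by apply/funext => g; rewrite !pairing_scale -scalerDl -rmorphD subrK.
by apply; exact: nmeas_pairingZ.
Qed.

(** By symmetry the pairing of v with M_tau M_phi u is that of M_tau v with M_phi u. Since M_tau v
    need not lie in C_c, where M_phi u can be tested, it is replaced by f_n v and the limit is taken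
    under the integral. *)
Lemma MopM tau phi x : mbounded tau -> mbounded phi ->
  Mop tau (Mop phi x) = Mop (fun g => tau g * phi g) x.
Proof.
move=> ht hp; have htp := mboundedM ht hp; rewrite -[LHS]/((Mop tau \o Mop phi) x).
congr (_ x); apply: (bop_eq (L := L)).
- by apply: bop_comp; exact: Mop_bop.
- exact: Mop_bop.
move=> u cu /=; apply: inner_L2_eq => v cv.
apply: bochner_unique (Mop_class htp cu cv).
rewrite -Mop_sym//.
have [mt _] := ht; have [N N0 tN] := mbounded_pos ht.
have [mp _] := hp; have [N' N'0 pN'] := mbounded_pos hp.
have [K cK vK] := Cc_support cv.
have mK : measurable (K : set (borel G)) by exact: compact_borel.
have [z [hz [f [cf fN fz kc]]]] := mult_exists mt N0 tN cv cK vK.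
rewrite (L2_class_unique (Mop_class ht cv) hz).
have [M M0 uM] := Cc_bounded cu; have [M' M'0 vM'] := Cc_bounded cv.
pose d := N' * (2 * (M' * M)).
have d0 : 0 < d by rewrite !mulr_gt0.
have cfv n : Cc (fun g => (f n g)%:C *: v g) by exact: Cc_scale.
have mk n : measurable_fun [set: borel G] (fun g => \1_K (g : borel G) * `|f n g - tau g|).
  apply: measurable_funM; first exact: measurable_indic.
  apply: measurableT_comp => //; apply: measurable_funB => //.
  exact: continuous_borel_real.
have [n|||n g|e e0|I hI vI] := @bochner_lim R _ (borel G) mu B
   (fun n => pairing (fun g => (f n g)%:C *: v g) (fun g => (phi g)%:C *: u g))
   (fun n => inner (L2_of L (fun g => (f n g)%:C *: v g)) (Mop phi (L2_of L u)))
   (fun n g => d * (\1_K (g : borel G) * `|f n g - tau g|))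
   (pairing v (fun g => (tau g * phi g)%:C *: u g)).
- exact: Mop_class.
- exact: nmeas_pairingZ.
- by move=> n; apply: measurable_funM => //; exact: measurable_cst.
- rewrite pairing_scalel !pairing_scale rmorphM -scalerA -scalerBl -rmorphB !rnormZr.
  have [Kg|nKg] := pselect (K g); last first.
    rewrite /pairing vK// cadj0 cmul0l gact0 rnorm0 !mulr0 mulr_ge0//; exact: ltW.
  rewrite indicE mem_set// mul1r mulrC ler_wpM2r// ler_pM ?rnorm_ge0//.
  rewrite (le_trans (pairing_bound _ _ _))//.
  by rewrite ler_wpM2l// ler_pM// rnorm_ge0.
- have : 0 < e / d by rewrite divr_gt0.
  move=> /kc; apply: filterS => n h.
  rewrite ge0_integralZ_real//; last exact: ltW.
  have -> : e = d * (e / d) by field; rewrite gt_eqF.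
  by rewrite (EFinM d (e / d)) lte_pmul2l.
have -> : inner z (Mop phi (L2_of L u)) = I; last exact: hI.
apply: (@cvg_rnorm_unique _ _ _ \oo _ (fun n => inner (L2_of L (fun g => (f n g)%:C *: v g)) (Mop phi (L2_of L u)))) => //.
by apply: cvg_inner => //; exact: cvg_cst.
Qed.

(** This covariance is why a commutator of a multiplier with a shift involves only the difference of
    tau and its translate. *)
Lemma Mop_shift tau b g x : mbounded tau ->
  Sop b g (Mop tau x) = Mop (fun h => tau (g^-1 * h)%g) (Sop b g x).
Proof.
move=> ht; have htg := mbounded_translate g ht.
rewrite -[LHS]/((Sop b g \o Mop tau) x) -[RHS]/((Mop (fun h => tau (g^-1 * h)%g) \o Sop b g) x).
have bM := Mop_bop ht; have bMg := Mop_bop htg; have bS := Sop_bop b g.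
congr (_ x); apply: (bop_eq (L := L)); [exact: bop_comp|exact: bop_comp|].
move=> u cu /=; apply: inner_L2_eq => v cv.
rewrite Sop_Cc//; have cs := Cc_shift G_hausdorff b g cu.
have h1 := bochner_translate g (Mop_class htg cs cv).
rewrite -inner_adj Sop_adj inner_adj Sop_Cc//.
have cs' := Cc_shift G_hausdorff (gact g^-1%g (cadj b)) g^-1%g cv.
have h2 := Mop_class ht cu cs'.
apply: (bochner_unique h2); move: h1; congr is_bochner; apply/funext => h.
rewrite -[RHS]/(pairing (shift_op (gact g^-1%g (cadj b)) g^-1%g v) (fun k => (tau k)%:C *: u k) h).
by rewrite pairing_shift shift_adjK invgK /pairing /shift_op !(gactZ, cmulZr).
Qed.

(** Replacing tau by 1_K tau does not change tau u. The estimate is needed for functions that are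
    small on compact sets but not globally. *)
Lemma Mop_local_bound tau (N : R) u (K : set G) : mbounded tau -> 0 < N -> Cc u ->
  compact K -> (forall g, ~ K g -> u g = 0) -> (forall g, K g -> `|tau g| <= N) ->
  rnorm (Mop tau (L2_of L u)) <= 4 * N * rnorm (L2_of L u).
Proof.
move=> ht N0 cu cK uK tN; pose phi g := \1_K (g : borel G) * tau g.
have mK : measurable (K : set (borel G)) by exact: compact_borel.
have hp : mbounded phi.
  apply: mboundedM => //; split; first exact: measurable_indic.
  by exists 1 => g; rewrite indicE; case: (_ \in _); rewrite ?normr1 ?normr0.
rewrite (Mop_eq_support (phi := phi) ht hp cu uK) => [|g Kg].
  apply: Mop_bound => // g; rewrite /phi indicE.
  have [Kg|nKg] := pselect (K g); first by rewrite mem_set// mul1r tN.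
  by rewrite memNset// mul0r normr0 ltW.
by rewrite /phi indicE mem_set// mul1r.
Qed.

Lemma Mop_cvg (phi_ : nat -> G -> R) tau (N : R) : 0 < N ->
  (forall n, mbounded (phi_ n)) -> mbounded tau -> (forall n g, `|phi_ n g| <= N) ->
  (forall (K : set G) (e : R), compact K -> 0 < e ->
     \forall n \near \oo, forall g, K g -> `|phi_ n g - tau g| <= e) ->
  forall x, (fun n => Mop (phi_ n) x) @ \oo --> Mop tau x.
Proof.
move=> N0 hp ht pN pc; have N4 : 0 < 4 * N by rewrite mulr_gt0.
apply: (equibounded_cvg N4) => [||u cu].
- by apply: nearW => n; split; [exact: Mop_bop|move=> x; exact: Mop_bound].
- exact: Mop_bop.
have [K cK uK] := Cc_support cu; apply/cvg_rnormP => e e0.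
pose d := e / (4 * (rnorm (L2_of L u) + 1)).
have d0 : 0 < d by rewrite divr_gt0// mulr_gt0// ltr_wpDl// rnorm_ge0.
have := pc K d cK d0; apply: filterS => n h.
rewrite -MopB//; apply: (le_lt_trans (Mop_local_bound _ d0 cu cK uK h)); first exact: mboundedB.
rewrite /d; set r := rnorm _; have r0 : 0 <= r by exact: rnorm_ge0.
have r1 : 0 < r + 1 by rewrite ltr_wpDl.
have -> : 4 * (e / (4 * (r + 1))) * r = e * r / (r + 1) by field; rewrite gt_eqF.
by rewrite ltr_pdivrMr// ltr_pM2l// ltrDl.
Qed.

End Multipliers.

(** * Operator norm and convolution *)

Section OperatorNorm.
Context {R : realType} {E : normedModType R[i]}.
Implicit Types (A : E -> E).

Lemma opnorm_set A : bounded_op A ->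
  has_sup [set rnorm (A x) | x in [set x : E | rnorm x <= 1]].
Proof.
move=> bA; have [M M0 hM] := bop_bound bA; split.
  by exists (rnorm (A 0)), 0 => //=; rewrite rnorm0.
exists M => _ [x /= x1 <-]; rewrite (le_trans (hM x))// ler_piMr//.
exact: ltW.
Qed.

Lemma opnorm_ge0 A : bounded_op A -> 0 <= opnorm A.
Proof.
move=> bA; apply: (@le_trans _ _ (rnorm (A 0))); first exact: rnorm_ge0.
by apply: ub_le_sup; [have [] := opnorm_set bA|exists 0 => //=; rewrite rnorm0].
Qed.

Lemma opnorm_le A (M : R) : 0 <= M -> (forall x, rnorm (A x) <= M * rnorm x) -> opnorm A <= M.
Proof.
move=> M0 hM; apply: ge_sup.
  by exists (rnorm (A 0)), 0 => //=; rewrite rnorm0.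
by move=> _ [x /= x1 <-]; rewrite (le_trans (hM x))// ler_piMr.
Qed.

Lemma opnorm_bound A x : bounded_op A -> rnorm (A x) <= opnorm A * rnorm x.
Proof.
move=> bA; have [x0|x0] := eqVneq (rnorm x) 0.
  by rewrite (rnorm0_eq0 x0) blin0// !rnorm0 mulr0.
have xp : 0 < rnorm x by rewrite lt_neqAle eq_sym x0 rnorm_ge0.
rewrite -ler_pdivrMr// mulrC -[X in X * _]ger0_norm ?invr_ge0 ?rnorm_ge0//.
rewrite -rnormZr -(blinZ bA); apply: ub_le_sup; first by have [] := opnorm_set bA.
exists ((rnorm x)^-1%:C *: x) => //=.
by rewrite rnormZr ger0_norm ?invr_ge0 ?rnorm_ge0// mulVf.
Qed.

Lemma opnorm0 : opnorm (fun=> 0 : E) = 0.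
Proof.
apply/eqP; rewrite eq_le opnorm_ge0 ?andbT; last exact: bop0.
by apply: opnorm_le => // x; rewrite rnorm0 mul0r.
Qed.

Lemma opnorm_eq0 A : bounded_op A -> opnorm A = 0 -> A = 0.
Proof.
move=> bA A0; apply/funext => x; apply: rnorm0_eq0; apply/eqP.
by rewrite eq_le rnorm_ge0 andbT (le_trans (opnorm_bound x bA))// A0 mul0r.
Qed.

Lemma opnormD A A' : bounded_op A -> bounded_op A' -> opnorm (A + A') <= opnorm A + opnorm A'.
Proof.
move=> bA bA'; apply: opnorm_le; first by rewrite addr_ge0// opnorm_ge0.
move=> x; rewrite mulrDl (le_trans (ler_rnormD _ _))// lerD ?opnorm_bound//.
Qed.

Lemma opnormZ (k : R[i]) A : bounded_op A -> opnorm (k *: A) = complex.Re `|k| * opnorm A.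
Proof.
have le (j : R[i]) (C : E -> E) : bounded_op C -> opnorm (j *: C) <= complex.Re `|j| * opnorm C.
  move=> bC; apply: opnorm_le; first by rewrite mulr_ge0 ?opnorm_ge0// Re_norm_ge0.
  by move=> x; rewrite rnormZ -mulrA ler_wpM2l ?Re_norm_ge0// opnorm_bound.
move=> bA; apply/eqP; rewrite eq_le; apply/andP; split; first exact: le.
have [->|k0] := eqVneq k 0.
  by rewrite normr0 mul0r opnorm_ge0//; apply: (bopZ 0).
have bkA : bounded_op (k *: A) by exact: (bopZ k).
have h := le k^-1 _ bkA; rewrite scalerA mulVf// scale1r in h.
have kn : complex.Re `|k| * complex.Re `|k^-1| = 1.
  by apply: (@complexI R); rewrite rmorphM /= !Re_normE -normrM mulfV// normr1.
have := ler_wpM2l (Re_norm_ge0 k) h.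
by rewrite mulrA kn mul1r.
Qed.

Lemma opnormN A : bounded_op A -> opnorm (- A) = opnorm A.
Proof. by move=> bA; rewrite -scaleN1r opnormZ// normrN1 mul1r. Qed.

Lemma opnorm_comp A A' : bounded_op A -> bounded_op A' -> opnorm (A \o A') <= opnorm A * opnorm A'.
Proof.
move=> bA bA'; apply: opnorm_le; first by rewrite mulr_ge0// opnorm_ge0.
move=> x /=; rewrite (le_trans (opnorm_bound _ bA))// -mulrA ler_wpM2l ?opnorm_ge0//.
exact: opnorm_bound.
Qed.

Lemma opnorm_dist A A' C : bounded_op A -> bounded_op A' -> bounded_op C ->
  opnorm (A - C) <= opnorm (A - A') + opnorm (A' - C).
Proof.
move=> bA bA' bC; rewrite -[A - C](subrKA A'); apply: opnormD; exact: bopB.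
Qed.

Lemma opnorm_cvg (I : Type) (F : set_system I) {FF : Filter F} (A : I -> E -> E) T x :
  (forall i, bounded_op (A i)) -> bounded_op T ->
  (forall e : R, 0 < e -> \forall i \near F, opnorm (A i - T) < e) ->
  (fun i => A i x) @ F --> T x.
Proof.
move=> bA bT h; apply/cvg_rnormP => e e0.
have : 0 < e / (rnorm x + 1) by rewrite divr_gt0// ltr_wpDl// rnorm_ge0.
move=> /h; apply: filterS => i hi.
have : rnorm ((A i - T) x) <= opnorm (A i - T) * rnorm x by apply: opnorm_bound; exact: bopB.
move=> /le_lt_trans; apply.
have r1 : 0 < rnorm x + 1 by rewrite ltr_wpDl// rnorm_ge0.
apply: (@le_lt_trans _ _ (e / (rnorm x + 1) * rnorm x)).
  by rewrite ler_wpM2r ?rnorm_ge0// ltW.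
by rewrite mulrAC ltr_pdivrMr// ltr_pM2l// ltrDl.
Qed.

End OperatorNorm.

Section OperatorComplete.
Context {R : realType} {E : completeNormedModType R[i]}.

Lemma bop_complete (A : nat -> E -> E) : (forall n, bounded_op (A n)) ->
  (forall e : R, 0 < e -> exists N, forall m n, (N <= m)%N -> (N <= n)%N ->
     opnorm (A m - A n) < e) ->
  exists2 T : E -> E, bounded_op T &
    forall e : R, 0 < e -> \forall n \near \oo, opnorm (A n - T) < e.
Proof.
move=> bA hA.
have hx (x : E) m n : rnorm (A m x - A n x) <= opnorm (A m - A n) * rnorm x.
  by apply: (opnorm_bound (A := A m - A n)); exact: bopB.
have /choice[T hT] : forall x, exists y : E, (fun n => A n x) @ \oo --> y.
  move=> x; apply: cauchy_seq_cvg => e e0.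
  have [|N NP] := hA (e / (rnorm x + 1)); first by rewrite divr_gt0// ltr_wpDl// rnorm_ge0.
  exists N => m n Nm Nn; rewrite (le_lt_trans (hx _ _ _))//.
  have r1 : 0 < rnorm x + 1 by rewrite ltr_wpDl// rnorm_ge0.
  apply: (@le_lt_trans _ _ (e / (rnorm x + 1) * rnorm x)).
    by rewrite ler_wpM2r ?rnorm_ge0// ltW// NP.
  by rewrite mulrAC ltr_pdivrMr// ltr_pM2l// ltrDl.
have tail (e : R) : 0 < e -> exists N, forall n x, (N <= n)%N ->
    rnorm (A n x - T x) <= e * rnorm x.
  move=> e0; have [N NP] := hA e e0; exists N => n x Nn.
  have c : (fun m => A n x - A m x) @ \oo --> A n x - T x.
    by apply: cvgB; [exact: cvg_cst|exact: hT].
  apply: (cvg_rnorm_le c); exists N => // m /= Nm.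
  by rewrite (le_trans (hx _ _ _))// ler_wpM2r ?rnorm_ge0// ltW// NP.
have [N1 hN1] := tail 1 ltr01.
have bT : bounded_op T.
  apply: (@bop_intro _ _ _ (opnorm (A N1) + 1)) => [x y|k x|x].
  - apply: (@cvg_rnorm_unique _ _ _ \oo _ (fun n => A n (x + y))); first exact: hT.
    under eq_fun do rewrite (blinD (bA _)).
    by apply: cvgD; exact: hT.
  - apply: (@cvg_rnorm_unique _ _ _ \oo _ (fun n => A n (k *: x))); first exact: hT.
    under eq_fun do rewrite (blinZ (bA _)).
    by apply: cvgZr; exact: hT.
  - have := ler_rnormBD (T x) (A N1 x) 0; rewrite !subr0 rnormB => /le_trans; apply.
    rewrite mulrDl addrC lerD ?opnorm_bound//; exact: hN1.
exists T => // e e0; have e2 : 0 < e / 2 by rewrite divr_gt0.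
have [N NP] := tail _ e2; exists N => // n /= Nn.
apply: (@le_lt_trans _ _ (e / 2)); last by lra.
by apply: opnorm_le => [|x]; [exact: ltW|exact: NP].
Qed.

End OperatorComplete.

(** * Convolution operators as limits of Riemann sums *)

Section Convolution.
Context {R : realType} {G : topologicalGroupType} (B : GCstarAlgebra R G).
Hypothesis G_hausdorff : hausdorff_space G.
Hypothesis G_lc : locally_compact [set: G].
Context (mu : {measure set (borel G) -> \bar R}).
Hypothesis mu_haar : is_haar mu.
Context (L : L2_completion mu B).
Implicit Types (a b u v : G -> B).

Definition conv_kernel a v (h : G) : G -> B := fun g => shift_op (a g) g v h.

Lemma continuous_kernel a v : continuous a -> continuous v ->
  continuous (fun z : G * G => conv_kernel a v z.2 z.1).
Proof.
move=> ca cv z; apply: cvg_cmul.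
  by apply: (@cvg_comp _ _ _ fst a _ (nbhs z.1)); [exact: cvg_fst|exact: ca].
apply: cvg_gact; first exact: cvg_fst.
apply: (@cvg_comp _ _ _ (fun y : G * G => (y.1^-1 * y.2)%g) v _ (nbhs (z.1^-1 * z.2)%g)); last exact: cv.
apply: (@continuous_mulg2 G (G * G)%type (fun y => (y.1^-1)%g) snd) => y; last exact: cvg_snd.
by apply: (@cvg_comp _ _ _ fst (fun x : G => (x^-1)%g) _ (nbhs y.1)); [exact: cvg_fst|exact: invg_continuous].
Qed.

Lemma continuous_kernel1 a v h : continuous a -> continuous v -> continuous (conv_kernel a v h).
Proof.
move=> ca cv; have c := continuous_kernel ca cv.
move=> g; apply: (@cvg_comp _ _ _ (fun g => (g, h)) (fun z : G * G => conv_kernel a v z.2 z.1) _ (nbhs (g, h))).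
  by apply: cvg_pair => /=; [exact: cvg_id|exact: cvg_cst].
exact: (c (g, h)).
Qed.

Lemma kernel_out a v h g : a g = 0 -> conv_kernel a v h g = 0.
Proof. by rewrite /conv_kernel /shift_op => ->; rewrite cmul0l. Qed.

Lemma convolution_bochner a v h : Cc a -> Cc v ->
  is_bochner mu (conv_kernel a v h : borel G -> B) (convolution mu a v h).
Proof.
move=> ca cv; have [K cK aK] := Cc_support ca.
have [] := @bochner_continuous R G G_hausdorff mu K cK (haar_compact_fin mu_haar cK) B (conv_kernel a v h).
- by apply: continuous_kernel1; exact: Cc_continuous.
- by move=> x nK; apply: kernel_out; exact: aK.
by move=> I hI; exact: bochnerP hI.
Qed.

Lemma convolution_eq a v h I : is_bochner mu (conv_kernel a v h : borel G -> B) I ->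
  convolution mu a v h = I.
Proof. by move=> hI; exact: bochner_eq. Qed.

Definition mulset (K K' : set G) : set G := (fun z : G * G => (z.1 * z.2)%g) @` (K `*` K').

Lemma compact_mulset (K K' : set G) : compact K -> compact K' -> compact (mulset K K').
Proof.
move=> cK cK'; apply: continuous_compact; last exact: compact_setX.
by apply: continuous_subspaceT; exact: mulg_continuous.
Qed.

Lemma shift_out (b : B) g v (K K' : set G) h : K g -> (forall x, ~ K' x -> v x = 0) ->
  ~ mulset K K' h -> shift_op b g v h = 0.
Proof.
move=> Kg vK' nh; rewrite /shift_op vK' ?gact0 ?cmul0r// => K'x; apply: nh.
by exists (g, (g^-1 * h)%g) => /=; [split|rewrite mulVKg].
Qed.

Lemma tagged_sum_bound (K : set G) W s (F : set (borel G) * G -> L) (C : R) : compact K ->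
  tagged_partition K W s -> 0 <= C -> (forall p, K p.2 -> rnorm (F p) <= C) ->
  rnorm (\sum_(p <- s) (fine (mu p.1))%:C *: F p) <= fine (mu K) * C.
Proof.
move=> cK ts C0 FC; have := tagged_mass G_hausdorff cK (haar_compact_fin mu_haar cK) ts => hm.
apply: (@le_trans _ _ ((\sum_(p <- s) fine (mu p.1)) * C)); last by rewrite ler_wpM2r.
rewrite (le_trans (ler_rnorm_sum _ _ _))// mulr_suml big_seq [leRHS]big_seq ler_sum// => p sp.
rewrite rnormZr ger0_norm ?fine_ge0// ler_wpM2l ?fine_ge0// FC//.
by have [/(_ _ sp)[]] := ts.
Qed.

Section Sums.
Context (a : G -> B) (K : set G).
Implicit Types (s : seq (set (borel G) * G)).

Definition rsum s v : G -> B := fun h =>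
  \sum_(p <- s) (fine (mu p.1))%:C *: shift_op (a p.2) p.2 v h.

Definition Rop s : L -> L := fun x =>
  \sum_(p <- s) (fine (mu p.1))%:C *: @Sop R G B mu L (a p.2) p.2 x.

Lemma rsumE s v h : rsum s v h = stepint mu (tagmap (conv_kernel a v h) s).
Proof. by rewrite /rsum /stepint big_map. Qed.

Lemma Cc_rsum s v : Cc v -> Cc (rsum s v).
Proof.
move=> cv; rewrite /rsum; elim: s => [|p s IH].
  by under eq_fun do rewrite big_nil; exact: Cc0.
under eq_fun do rewrite big_cons.
by apply: CcD => //; apply: CcZ => //; exact: Cc_shift.
Qed.

Lemma Rop_Cc s v : Cc v -> Rop s (L2_of L v) = L2_of L (rsum s v).
Proof.
move=> cv; rewrite /Rop /rsum; elim: s => [|p s IH].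
  rewrite big_nil; under [in RHS]eq_fun do rewrite big_nil.
  have := L2_ofZ L 0 (Cc0 B G_hausdorff); by rewrite !scale0r => ->.
rewrite big_cons IH; under [in RHS]eq_fun do rewrite big_cons.
rewrite Sop_Cc// -L2_ofZ; last exact: Cc_shift.
rewrite -L2_ofD//; last exact: (@Cc_rsum s).
by apply: CcZ => //; exact: Cc_shift.
Qed.

Lemma Rop_bop s : bounded_op (Rop s).
Proof.
rewrite /Rop; elim: s => [|p s IH].
  by under eq_fun do rewrite big_nil; exact: bop0.
under eq_fun do rewrite big_cons.
by apply: bopD => //; apply: bopZ; exact: Sop_bop.
Qed.

Hypothesis ca : Cc a.
Hypothesis cK : compact K.
Hypothesis aK : forall g, ~ K g -> a g = 0.

Let Kfin : (mu K < +oo)%E. Proof. exact: haar_compact_fin. Qed.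

Lemma rsum_out W s v (K' : set G) h : tagged_partition K W s ->
  (forall x, ~ K' x -> v x = 0) -> ~ mulset K K' h -> rsum s v h = 0.
Proof.
move=> [ts _] vK' nh; rewrite /rsum big_seq big1// => p /ts[_ _ Kp].
by rewrite (shift_out _ Kp vK' nh) scaler0.
Qed.

Lemma convolution_out v (K' : set G) h : Cc v ->
  (forall x, ~ K' x -> v x = 0) -> ~ mulset K K' h -> convolution mu a v h = 0.
Proof.
move=> cv vK' nh; have hI := convolution_bochner h ca cv.
apply/rnorm0_eq0/eqP; rewrite eq_le rnorm_ge0 andbT -lee_fin.
have := bochner_norm hI (measurable_cst (0 : R)); rewrite integral0; apply => g.
have [Kg|nKg] := pselect (K g).
  by rewrite /conv_kernel (shift_out _ Kg vK' nh) rnorm0.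
by rewrite (kernel_out _ _ (aK nKg)) rnorm0.
Qed.

(** The gauge at y collects the x whose kernels differ little from that of y at all h in K K' at
    once; compactness of K K' makes it a neighbourhood. For other h the kernel vanishes at every
    point of K. *)
Lemma riemann_uniform v (e : R) : Cc v -> 0 < e ->
  \forall s \near partition_filter K, forall h, rnorm (convolution mu a v h - rsum s v h) <= e.
Proof.
move=> cv e0; have [K' cK' vK'] := Cc_support cv.
have m0 : 0 <= fine (mu K) by exact: fine_ge0.
pose d := e / (fine (mu K) + 1).
have d0 : 0 < d by rewrite divr_gt0// ltr_wpDl.
pose W y := [set x | forall h, mulset K K' h ->
  rnorm (conv_kernel a v h x - conv_kernel a v h y) <= d].
exists W.
  move=> y Ky; have /compact_near_coveringP cH := compact_mulset cK cK'.
  apply: (cH G (nbhs y) (fun x h => rnorm (conv_kernel a v h x - conv_kernel a v h y) <= d)) => h _.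
  have d2 : 0 < d / 2 by rewrite divr_gt0.
  have /cvg_rnormP/(_ _ d2) := continuous_kernel (Cc_continuous ca) (Cc_continuous cv) (x := (y, h)).
  move=> [[P Q] /= [Py Qh] PQ]; exists (Q, P); first by split.
  move=> [h' x] /= [Qh' Px].
  have h1 := PQ (x, h') (conj Px Qh'); have h2 := PQ (y, h') (conj (nbhs_singleton Py) Qh').
  rewrite /= in h1 h2.
  have := ler_rnormBD (conv_kernel a v h' x) (conv_kernel a v h y) (conv_kernel a v h' y).
  move=> /le_trans; apply; rewrite (rnormB (conv_kernel a v h y)).
  by rewrite (splitr d) lerD// ltW.
move=> s ts h; rewrite rsumE.
apply: (@le_trans _ _ (d * fine (mu K))).
  apply: (riemann_sum_dist G_hausdorff cK Kfin (ltW d0) ts (convolution_bochner h ca cv)).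
    by move=> x nK; apply: kernel_out; exact: aK.
  move=> y x Ky Kx Wyx; have [Hh|nHh] := pselect (mulset K K' h); first exact: Wyx.
  by rewrite /conv_kernel (shift_out _ Kx vK' nHh) (shift_out _ Ky vK' nHh) subrr rnorm0 ltW.
rewrite /d mulrAC ler_pdivrMr ?ltr_wpDl// ler_pM2l//.
by rewrite lerDl.
Qed.

Let PF : ProperFilter (partition_filter K). Proof. exact: partition_filter_proper. Qed.
#[local] Existing Instance PF.

Lemma Cc_convolution v : Cc v -> Cc (convolution mu a v).
Proof.
move=> cv; have [K' cK' vK'] := Cc_support cv.
apply: (@Cc_intro _ _ _ G_hausdorff _ (mulset K K')).
- move=> h; apply/cvg_rnormP => e e0; have e3 : 0 < e / 3 by rewrite divr_gt0.
  have [s hs] := @filter_ex _ _ PF _ (riemann_uniform cv e3).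
  have /cvg_rnormP/(_ _ e3) := Cc_continuous (Cc_rsum s cv) (x := h).
  apply: filterS => x hx.
  have h1 := hs x; have h2 := hs h.
  have := ler_rnormBD (convolution mu a v x) (rsum s v x) (convolution mu a v h).
  have := ler_rnormBD (rsum s v x) (rsum s v h) (convolution mu a v h).
  rewrite (rnormB (rsum s v h) (convolution mu a v h)); move: hx h1 h2; lra.
- exact: compact_mulset.
- by move=> x nx; apply: (convolution_out cv vK' nx).
Qed.

(** Sums and limit all vanish off the compact set K K', where [L2_of_bound] turns uniform
    convergence into convergence in L^2. *)
Lemma riemann_L2 v : Cc v ->
  (fun s => Rop s (L2_of L v)) @ partition_filter K --> L2_of L (convolution mu a v).
Proof.
move=> cv; have [K' cK' vK'] := Cc_support cv.
have [C C0 hC] := L2_of_bound G_hausdorff mu_haar L (compact_mulset cK cK').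
apply/cvg_rnormP => e e0; have d0 : 0 < e / (2 * C) by rewrite divr_gt0// mulr_gt0.
have [W0 hW0 hW] := riemann_uniform cv d0.
exists W0 => // s ts; have := hW s ts => hs.
rewrite Rop_Cc// -L2_of_sub//; [|exact: Cc_rsum|exact: Cc_convolution].
apply: (@le_lt_trans _ _ (C * (e / (2 * C)))).
  apply: hC.
  - by apply: CcB => //; [exact: Cc_rsum|exact: Cc_convolution].
  - move=> x nx; rewrite (rsum_out ts vK' nx) (convolution_out cv vK' nx) subrr//.
  - by move=> x; rewrite rnormB.
have -> : C * (e / (2 * C)) = e / 2 by field; rewrite gt_eqF.
lra.
Qed.

Lemma Rop_bound W s (N : R) x : tagged_partition K W s -> 0 < N -> (forall g, rnorm (a g) <= N) ->
  rnorm (Rop s x) <= fine (mu K) * (8 * N) * rnorm x.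
Proof.
move=> ts N0 aN; rewrite -!mulrA (mulrA 8); apply: (tagged_sum_bound cK ts).
  by rewrite !mulr_ge0 ?rnorm_ge0// ltW.
by move=> p _; exact: Sop_bound.
Qed.

(** Mass mu(K) times the bound on shifts controls all Riemann sums, so they converge strongly. The
    convergence is recorded with the existence of lambda(a) because commutators are computed on the
    sums. *)
Lemma lambda_limit : exists2 T, is_lambda L a T &
  forall x, (fun s => Rop s x) @ partition_filter K --> T x.
Proof.
have [N N0 aN] := Cc_bounded ca.
have M0 : 0 < fine (mu K) * (8 * N) + 1.
  by rewrite ltr_wpDl// !mulr_ge0 ?fine_ge0// ltW.
have near_s : \forall s \near partition_filter K, bounded_op (Rop s) /\
    forall x, rnorm (Rop s x) <= (fine (mu K) * (8 * N) + 1) * rnorm x.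
  exists (fun=> setT); first by move=> x _; exact: filterT.
  move=> s ts; split; first exact: Rop_bop.
  move=> x; rewrite (le_trans (Rop_bound x ts N0 aN))// ler_wpM2r ?rnorm_ge0//.
  by rewrite lerDl.
have [u cu|T [bT _ hT]] := @equibounded_lim R G B G_hausdorff mu L _ _ PF Rop _ M0 near_s.
  by exists (L2_of L (convolution mu a u)); exact: riemann_L2.
exists T => //; split=> // v cv.
exact: (@cvg_rnorm_unique _ _ _ _ PF _ _ _ (hT _) (riemann_L2 cv)).
Qed.

End Sums.

Lemma lambda_unique a T T' : is_lambda L a T -> is_lambda L a T' -> T = T'.
Proof.
by move=> [bT hT] [bT' hT']; apply: bop_eq => // u cu; rewrite hT// hT'.
Qed.

Lemma Cc_conv a v : Cc a -> Cc v -> Cc (convolution mu a v).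
Proof. by move=> ca cv; have [K cK aK] := Cc_support ca; exact: (Cc_convolution ca cK aK). Qed.

Lemma convolution_linear (k : R[i]) a b v h : Cc a -> Cc b -> Cc v ->
  convolution mu (fun g => k *: a g + b g) v h = k *: convolution mu a v h + convolution mu b v h.
Proof.
move=> ca cb cv; apply: convolution_eq.
have c1 : continuous (conv_kernel (fun g => k *: a g) v h).
  by apply: continuous_kernel1; apply: Cc_continuous => //; exact: CcZ.
have c2 : continuous (conv_kernel (fun g => k *: a g + b g) v h).
  by apply: continuous_kernel1; apply: Cc_continuous => //; apply: CcD => //; exact: CcZ.
have e1 : (fun x : B => k *: x) \o conv_kernel a v h = conv_kernel (fun g => k *: a g) v h.
  by apply/funext => g; rewrite /conv_kernel /shift_op /= cmulZl.
have e2 : (fun g => conv_kernel (fun g => k *: a g) v h g + conv_kernel b v h g) =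
    conv_kernel (fun g => k *: a g + b g) v h.
  by apply/funext => g; rewrite /conv_kernel /shift_op /= cmulDl.
have := @bochner_map R _ _ mu B B (fun x : B => k *: x) (complex.Re `|k|) _ _ _ _ _ _ (convolution_bochner h ca cv).
rewrite e1 => h1.
have := bochnerD (h1 _ _ _ _) (convolution_bochner h cb cv); rewrite e2; apply.
- by move=> x y; rewrite scalerDr.
- by move=> r x; rewrite !scalerA mulrC.
- by move=> x; rewrite rnormZ.
- exact: nmeas_continuous.
- exact: nmeas_continuous.
Qed.

Lemma lambda_linear (k : R[i]) a b T S : Cc a -> Cc b -> is_lambda L a T -> is_lambda L b S ->
  is_lambda L (fun g => k *: a g + b g) (k *: T + S).
Proof.
move=> ca cb [bT hT] [bS hS]; split.
  by apply: (bopD (A := k *: T)) => //; exact: (bopZ k).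
move=> v cv; rewrite -[LHS]/(k *: T (L2_of L v) + S (L2_of L v)) hT// hS//.
rewrite -L2_ofZ; last exact: Cc_conv.
rewrite -L2_ofD; [|by apply: CcZ => //; exact: Cc_conv|exact: Cc_conv].
by congr L2_of; apply/funext => h; rewrite convolution_linear.
Qed.

(** Associativity for a single shift in place of a: the integral is translated by g and the bounded
    map x |-> c g(x) is taken out of it. Riemann sums follow by linearity. *)
Lemma convolution_shift (c : B) g b v h : Cc b -> Cc v ->
  convolution mu (shift_op c g b) v h = shift_op c g (convolution mu b v) h.
Proof.
move=> cb cv; apply: convolution_eq.
have cs := Cc_shift G_hausdorff c g cb.
have ck : continuous (conv_kernel (shift_op c g b) v h).
  by apply: continuous_kernel1; exact: Cc_continuous.
pose phi (x : B) := cmul c (gact g x).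
have e : phi \o conv_kernel b v (g^-1 * h)%g =
    (fun k : borel G => conv_kernel (shift_op c g b) v h (g * k)%g).
  apply/funext => k; rewrite /phi /conv_kernel /shift_op /=.
  by rewrite mulKg gact_cmul cmulA -gactM invgM mulgA.
have := @bochner_map R _ _ mu B B phi (rnorm c * 2) _ _ _ _ _ _ (convolution_bochner (g^-1 * h)%g cb cv).
rewrite e => h1.
have h2 : is_bochner mu (fun k : borel G => conv_kernel (shift_op c g b) v h (g * k)%g)
    (phi (convolution mu b v (g^-1 * h)%g)).
  apply: h1.
  - by move=> x y; rewrite /phi gactD cmulDr.
  - by move=> r x; rewrite /phi gactZ cmulZr.
  - move=> x; rewrite /phi (le_trans (rnormM_le _ _))// -mulrA ler_wpM2l ?rnorm_ge0//.
    exact: gact_bound.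
  - apply: (@nmeas_continuous R G B (fun k => conv_kernel (shift_op c g b) v h (g * k)%g)) => k.
    apply: (@cvg_comp _ _ _ (fun k => (g * k)%g) (conv_kernel (shift_op c g b) v h) _ (nbhs (g * k)%g)).
      exact: continuous_mulgl.
    exact: ck.
have := bochner_translate mu_haar g^-1%g h2.
by under eq_fun do rewrite mulVKg.
Qed.

Lemma convolution_rsum a s b v h : Cc b -> Cc v ->
  convolution mu (rsum a s b) v h = rsum a s (convolution mu b v) h.
Proof.
move=> cb cv; rewrite /rsum; elim: s => [|p s IH].
  rewrite big_nil; under [X in convolution _ X]eq_fun do rewrite big_nil.
  apply: convolution_eq.
  have [I hI] : exists I, is_bochner mu (conv_kernel (fun=> 0 : B) v h : borel G -> B) I.
    by eexists; apply: convolution_bochner => //; exact: Cc0.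
  suff e0 : I = 0 by rewrite -[X in is_bochner _ _ X]e0.
  apply/rnorm0_eq0/eqP; rewrite eq_le rnorm_ge0 andbT -lee_fin.
  have := bochner_norm hI (measurable_cst (0 : R)); rewrite integral0; apply => g.
  by rewrite kernel_out// rnorm0.
under [X in convolution _ X]eq_fun do rewrite big_cons.
rewrite convolution_linear//; [|exact: Cc_shift|exact: (@Cc_rsum a s)].
by rewrite IH big_cons convolution_shift.
Qed.

(* Associativity holds for Riemann sums, so no Fubini theorem is needed. *)
Lemma convolutionA a b v : Cc a -> Cc b -> Cc v ->
  convolution mu a (convolution mu b v) = convolution mu (convolution mu a b) v.
Proof.
move=> ca cb cv; apply/funext => h; apply/subr0_eq/rnorm0_eq0/eqP.
rewrite eq_le rnorm_ge0 andbT; apply/ler_addgt0Pl => e e0; rewrite addr0.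
have [K cK aK] := Cc_support ca; have [K' cK' bK'] := Cc_support cb.
have PF := partition_filter_proper G_hausdorff cK.
have cH := compact_mulset cK cK'.
set H := mulset K K' in cH.
have Hfin := haar_compact_fin mu_haar cH.
have m0 : 0 <= fine (mu H) by exact: fine_ge0.
have [M M0 vM] := Cc_bounded cv.
have cbv := Cc_conv cb cv; have cab := Cc_conv ca cb.
(* One sum s is taken e/2-close for a with b convolved with v, and uniformly d-close for a convolved
   with b. Convolving the latter error with v costs at most d (2 M) mu(H), the 2 coming from
   [gact_bound]. *)
pose d : R := e / 2 / (2 * M * fine (mu H) + 1).
have d0 : 0 < d by rewrite !divr_gt0// ltr_wpDl// !mulr_ge0// ltW.
have e2 : 0 < e / 2 by rewrite divr_gt0.
have n1 := riemann_uniform ca cK aK cbv e2; have n2 := riemann_uniform ca cK aK cb d0.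
have n3 : \forall s \near partition_filter K, tagged_partition K (fun=> setT) s.
  by exists (fun=> setT) => // x _; exact: filterT.
have [s [[hs1 hs2] ts]] := @filter_ex _ _ PF _ (filterI (filterI n1 n2) n3).
have crs := Cc_rsum a s cb.
have dist : rnorm (convolution mu (convolution mu a b) v h - convolution mu (rsum a s b) v h)
    <= (d * (2 * M)) * fine (mu H).
  have dM : 0 <= d * (2 * M) by apply: mulr_ge0; [exact: ltW|apply: mulr_ge0 => //; exact: ltW].
  rewrite -lee_fin -integral_cst_indic//.
  apply: (bochner_dist (convolution_bochner h cab cv) (convolution_bochner h crs cv)).
    exact: measurable_cst_indic.
  move=> g; rewrite /conv_kernel /shift_op -cmulBl.
  have [Hg|nHg] := pselect (H g); last first.
    rewrite (convolution_out ca aK cb bK' nHg) (rsum_out _ ts bK' nHg).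
    by rewrite subrr cmul0l rnorm0 mulr_ge0.
  rewrite indicE mem_set// mulr1 (le_trans (rnormM_le _ _))// ler_pM ?rnorm_ge0//.
  by rewrite (le_trans (gact_bound _ _))// ler_wpM2l.
have h1 := hs1 h; rewrite -convolution_rsum// in h1.
have := ler_rnormBD (convolution mu a (convolution mu b v) h) (convolution mu (rsum a s b) v h)
   (convolution mu (convolution mu a b) v h).
move=> /le_trans; apply; rewrite [leRHS]splitr; apply: lerD; first exact: h1.
rewrite rnormB; apply: (le_trans dist); rewrite /d.
have m1 : 0 < 2 * M * fine (mu H) + 1 by rewrite ltr_wpDl// !mulr_ge0// ltW.
rewrite -mulrA mulrAC ler_pdivrMr// ler_pM2l// lerDl//.
Qed.

Lemma lambda_comp a b T S : Cc a -> Cc b -> is_lambda L a T -> is_lambda L b S ->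
  is_lambda L (convolution mu a b) (T \o S).
Proof.
move=> ca cb [bT hT] [bS hS]; split; first exact: bop_comp.
by move=> v cv /=; rewrite hS// hT ?convolutionA//; exact: Cc_conv.
Qed.

Lemma Crstar_bop T : Crstar L T -> bounded_op T. Proof. by case. Qed.

Lemma Crstar_linear (k : R[i]) S T : Crstar L S -> Crstar L T -> Crstar L (k *: S + T).
Proof.
move=> [bS hS] [bT hT].
have bkS : bounded_op (k *: S) by exact: (bopZ k).
split; first exact: (bopD (A := k *: S)).
move=> e e0.
have k1 : 0 < complex.Re `|k| + 1 by rewrite ltr_wpDl// Re_norm_ge0.
have [|a [S' [ca lS' hS']]] := hS (e / 2 / (complex.Re `|k| + 1)); first by rewrite !divr_gt0.
have [|b [T' [cb lT' hT']]] := hT (e / 2); first by rewrite divr_gt0.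
have bS' : bounded_op S' by case: lS'.
have bT' : bounded_op T' by case: lT'.
exists (fun g => k *: a g + b g), (k *: S' + T'); split.
- by apply: CcD => //; exact: CcZ.
- exact: lambda_linear.
rewrite opprD addrACA -scalerBr.
have bSS : bounded_op (S - S') by exact: bopB.
have bTT : bounded_op (T - T') by exact: bopB.
apply: (le_lt_trans (opnormD (bopZ k bSS) bTT)).
rewrite [ltRHS]splitr ler_ltD// opnormZ//.
apply: (@le_trans _ _ (complex.Re `|k| * (e / 2 / (complex.Re `|k| + 1)))).
  by rewrite ler_wpM2l ?Re_norm_ge0// ltW.
rewrite mulrCA ler_piMr ?divr_ge0// ?(ltW e0)//.
by rewrite ler_pdivrMr// mul1r lerDl.
Qed.

(** Obtained as T - T for some T representing the zero function, so that lambda(0) need not be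
    identified. *)
Lemma Crstar0 : Crstar L 0.
Proof.
have [T lT _] := lambda_limit (Cc0 B G_hausdorff) compact0 (fun g _ => erefl).
have cT : Crstar L T.
  split; first by case: lT.
  move=> e e0; exists (fun=> 0), T; split=> //; first exact: Cc0.
  by rewrite subrr (opnorm0 (E := L)).
by have := Crstar_linear (-1) cT cT; rewrite scaleN1r addNr.
Qed.

Lemma Crstar_lambda a T : Cc a -> is_lambda L a T -> Crstar L T.
Proof.
move=> ca lT; split; first by case: lT.
by move=> e e0; exists a, T; split=> //; rewrite subrr (opnorm0 (E := L)).
Qed.

Lemma Crstar_closed T : bounded_op T ->
  (forall e : R, 0 < e -> exists2 S, Crstar L S & opnorm (T - S) < e) -> Crstar L T.
Proof.
move=> bT h; split=> // e e0; have e2 : 0 < e / 2 by rewrite divr_gt0.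
have [S [bS hS] TS] := h _ e2; have [a [S' [ca lS' SS']]] := hS _ e2.
exists a, S'; split=> //; have bS' : bounded_op S' by case: lS'.
by rewrite (le_lt_trans (opnorm_dist bT bS bS'))// [ltRHS]splitr ltrD.
Qed.

Lemma Crstar_comp S T : Crstar L S -> Crstar L T -> Crstar L (S \o T).
Proof.
move=> [bS hS] [bT hT]; apply: Crstar_closed; first exact: bop_comp.
move=> e e0.
have T1 : 0 < opnorm T + 1 by rewrite ltr_wpDl// opnorm_ge0.
have [|a [S' [ca lS' hS']]] := hS (e / 2 / (opnorm T + 1)); first by rewrite !divr_gt0.
have bS' : bounded_op S' by case: lS'.
have S1 : 0 < opnorm S' + 1 by rewrite ltr_wpDl// opnorm_ge0.
have [|b [T' [cb lT' hT']]] := hT (e / 2 / (opnorm S' + 1)); first by rewrite !divr_gt0.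
have bT' : bounded_op T' by case: lT'.
exists (S' \o T').
  by apply: (Crstar_lambda (Cc_conv ca cb)); exact: lambda_comp.
have bSS : bounded_op (S - S') by exact: bopB.
have bTT : bounded_op (T - T') by exact: bopB.
have -> : S \o T - (S' \o T') = ((S - S') \o T) + (S' \o (T - T')).
  apply/funext => x; rewrite -[LHS]/(S (T x) - S' (T' x)).
  rewrite -[RHS]/((S (T x) - S' (T x)) + S' (T x - T' x)) (blinB bS').
  by rewrite addrA subrK.
apply: (le_lt_trans (opnormD (bop_comp bSS bT) (bop_comp bS' bTT))).
rewrite [ltRHS]splitr ltrD//.
  apply: (le_lt_trans (opnorm_comp bSS bT)).
  apply: (@le_lt_trans _ _ (opnorm (S - S') * (opnorm T + 1))).
    by rewrite ler_wpM2l ?opnorm_ge0// lerDl.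
  by rewrite -ltr_pdivlMr.
apply: (le_lt_trans (opnorm_comp bS' bTT)).
apply: (@le_lt_trans _ _ ((opnorm S' + 1) * opnorm (T - T'))).
  by rewrite ler_wpM2r ?opnorm_ge0// lerDl.
by rewrite mulrC -ltr_pdivlMr.
Qed.

End Convolution.

(** * The derivation D *)

Section WeightFunctions.
Context {R : realType} {G : topologicalGroupType}.
Context {l : G -> R}.
Hypothesis l_length : is_length l.
Hypothesis l_meas : measurable_fun [set: borel G] (l : borel G -> R).
Hypothesis l_sym : forall g : G, l g = l (g^-1)%g.

Definition eps (k : nat) : R := k.+1%:R^-1.

Lemma eps_gt0 k : 0 < eps k. Proof. by rewrite invr_gt0. Qed.

Lemma eps_near (c e : R) : 0 <= c -> 0 < e -> \forall k \near \oo, eps k * c < e.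
Proof.
move=> c0 e0; have d0 : 0 < e / (c + 1) by rewrite divr_gt0// ltr_wpDl.
have := near_infty_natSinv_lt (PosNum d0); apply: filterS => k /= hk.
apply: (@le_lt_trans _ _ (eps k * (c + 1))); first by rewrite ler_wpM2l ?lerDl// ltW// eps_gt0.
by rewrite -ltr_pdivlMr// ltr_wpDl.
Qed.

Definition wt (g : G) : R := 1 + l g.
Definition resolvent (k : nat) (g : G) : R := (1 + eps k * wt g)^-1.
Definition cutoff (k : nat) (g : G) : R := wt g * resolvent k g.

Lemma wt_ge1 g : 1 <= wt g. Proof. by have [l0 _ _] := l_length; rewrite lerDl. Qed.

Lemma wt_gt0 g : 0 < wt g. Proof. exact: lt_le_trans (wt_ge1 g). Qed.

Lemma wt_dist g h : `|wt h - wt (g^-1 * h)%g| <= l g.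
Proof.
have [_ _ lM] := l_length; have h1 := lM g (g^-1 * h)%g; have h2 := lM g^-1%g h.
rewrite mulVKg in h1; rewrite -l_sym in h2.
by rewrite /wt ler_norml; move: h1 h2; lra.
Qed.

Let den_gt1 k g : 1 < 1 + eps k * wt g.
Proof. by rewrite ltrDl mulr_gt0 ?eps_gt0 ?wt_gt0. Qed.

Let den_gt0 k g : 0 < 1 + eps k * wt g. Proof. exact: lt_trans (den_gt1 k g). Qed.

Lemma resolvent_gt0 k g : 0 < resolvent k g. Proof. by rewrite invr_gt0. Qed.

Lemma resolvent_le1 k g : resolvent k g <= 1.
Proof. by rewrite invf_le1// ltW. Qed.

Lemma resolvent_norm k g : `|resolvent k g| <= 1.
Proof. by rewrite ger0_norm ?resolvent_le1// ltW// resolvent_gt0. Qed.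

(** The one identity behind three facts: rho_k is bounded by the inverse of eps_k, the resolvents
    tend to 1 on compact sets, and the resolvent operator is 1 - eps_k rho_k. *)
Lemma eps_cutoff k g : eps k * cutoff k g = 1 - resolvent k g.
Proof. by rewrite /cutoff /resolvent; field; rewrite gt_eqF. Qed.

Lemma cutoff_dist k g : `|cutoff k g - wt g| <= eps k * wt g ^+ 2.
Proof.
have -> : cutoff k g - wt g = - (eps k * wt g ^+ 2 * resolvent k g).
  by rewrite /cutoff /resolvent; field; rewrite gt_eqF.
rewrite normrN ger0_norm.
  by rewrite ler_piMr ?resolvent_le1// mulr_ge0 ?(ltW (eps_gt0 _))// exprn_ge0// ltW// wt_gt0.
by rewrite !mulr_ge0// ltW// ?eps_gt0 ?wt_gt0 ?resolvent_gt0.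
Qed.

(** The difference of the cutoffs is the difference of the weights times two resolvents, each at
    most 1; the bound is thus uniform in k. *)
Lemma cutoff_lipschitz k g h : `|cutoff k h - cutoff k (g^-1 * h)%g| <= l g.
Proof.
set h' := (g^-1 * h)%g.
have -> : cutoff k h - cutoff k h' = (wt h - wt h') * (resolvent k h * resolvent k h').
  by rewrite /cutoff /resolvent; field; rewrite !gt_eqF.
rewrite normrM (le_trans _ (wt_dist g h))// ler_piMr// normrM.
by rewrite mulr_ile1// resolvent_norm.
Qed.

Lemma wt_measurable : measurable_fun [set: borel G] (wt : borel G -> R).
Proof. by apply: measurable_funD => //; exact: measurable_cst. Qed.

Lemma mbounded_resolvent k : mbounded (resolvent k).
Proof.
split; last by exists 1; exact: resolvent_norm.
(* The absolute value changes nothing, as the weight is positive, but makes the outer function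
   continuous on the whole line. *)
have -> : resolvent k = (fun x : R => (1 + eps k * `|x|)^-1) \o wt.
  by apply/funext => g; rewrite /resolvent /= ger0_norm// ltW// wt_gt0.
apply: measurableT_comp; last exact: wt_measurable.
apply: continuous_measurable_fun => x; apply: cvgV.
  by rewrite gt_eqF// ltr_wpDr// mulr_ge0// ltW// eps_gt0.
by apply: cvgD; [exact: cvg_cst|apply: cvgMr; exact: norm_continuous].
Qed.

Lemma mbounded_cutoff k : mbounded (cutoff k).
Proof.
have [mr _] := mbounded_resolvent k.
split; first exact: (measurable_funM wt_measurable mr).
exists (eps k)^-1 => g; rewrite ger0_norm; last first.
  by rewrite mulr_ge0// ltW ?wt_gt0// resolvent_gt0.
rewrite -(@ler_pM2l _ (eps k)) ?eps_gt0// eps_cutoff mulfV ?gt_eqF ?eps_gt0//.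
by rewrite gerBl ltW// resolvent_gt0.
Qed.

End WeightFunctions.

(** * The graph of sigma and commutators with it *)

Section Sigma.
Context {R : realType} {G : topologicalGroupType} {B : GCstarAlgebra R G}.
Hypothesis G_hausdorff : hausdorff_space G.
Hypothesis G_lc : locally_compact [set: G].
Context {mu : {measure set (borel G) -> \bar R}}.
Hypothesis mu_haar : is_haar mu.
Context (L : L2_completion mu B) {l : G -> R}.
Hypothesis l_length : is_length l.
Hypothesis l_meas : measurable_fun [set: borel G] (l : borel G -> R).
Hypothesis l_sym : forall g : G, l g = l (g^-1)%g.
Implicit Types (v w x : L) (A C : L -> L).

Local Notation rho := (@cutoff R G l).
Local Notation res := (@resolvent R G l).
Local Notation Mrho k := (@Mop R G B mu L (rho k)).
Local Notation Mres k := (@Mop R G B mu L (res k)).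

Let brho k : mbounded (rho k). Proof. exact: mbounded_cutoff. Qed.
Let bres k : mbounded (res k). Proof. exact: mbounded_resolvent. Qed.

Let Mmul tau phi x : mbounded tau -> mbounded phi ->
  Mop tau (Mop phi x) = @Mop R G B mu L (fun g => tau g * phi g) x.
Proof. exact: MopM. Qed.

Lemma Mrho_bop k : bounded_op (Mrho k). Proof. exact: Mop_bop. Qed.
Lemma Mres_bop k : bounded_op (Mres k). Proof. exact: Mop_bop. Qed.

Lemma wt_compact (K : set G) : compact K -> exists2 M : R, 0 < M & forall g, K g -> @wt R G l g <= M.
Proof.
move=> cK; have [M M0 lM] := length_bounded_compact G_hausdorff mu_haar l_length l_meas l_sym cK.
by exists (1 + M) => [|g Kg]; [exact: addr_gt0|rewrite lerD2l lM].
Qed.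

Lemma Mres_cvg x : (fun k => Mres k x) @ \oo --> x.
Proof.
rewrite -[X in _ --> X](Mop1 G_hausdorff G_lc mu_haar).
apply: (Mop_cvg G_hausdorff G_lc mu_haar ltr01) => // [|k g|K e cK e0].
- exact: mbounded_cst.
- exact: resolvent_norm.
have [M M0 KM] := wt_compact cK.
have := eps_near (ltW M0) e0; apply: filterS => k hk g Kg.
rewrite distrC -eps_cutoff// ger0_norm; last first.
  by rewrite !mulr_ge0 ?(ltW (eps_gt0 _))// ltW ?wt_gt0 ?resolvent_gt0.
rewrite (le_trans _ (ltW hk))// ler_wpM2l ?(ltW (eps_gt0 _))//.
by rewrite (le_trans _ (KM g Kg))// ler_piMr ?resolvent_le1// ltW// wt_gt0.
Qed.

Lemma Mres_bound k x : rnorm (Mres k x) <= 4 * rnorm x.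
Proof.
rewrite -{1}[4]mulr1; apply: Mop_bound => //; exact: resolvent_norm.
Qed.

Lemma cvg_equibounded (A_ : nat -> L -> L) A (M : R) (x_ : nat -> L) x : 0 < M ->
  (forall n, bounded_op (A_ n)) -> (forall n y, rnorm (A_ n y) <= M * rnorm y) ->
  (fun n => A_ n x) @ \oo --> A x -> x_ @ \oo --> x -> (fun n => A_ n (x_ n)) @ \oo --> A x.
Proof.
move=> M0 bA AM /cvg_rnormP cA /cvg_rnormP cx; apply/cvg_rnormP => e e0.
have := cx (e / (2 * M)); rewrite divr_gt0 ?mulr_gt0// => /(_ isT) => h1.
have := cA (e / 2); rewrite divr_gt0// => /(_ isT) => h2.
apply: filterS2 h1 h2 => n h1 h2.
have h3 := ler_rnormBD (A_ n (x_ n)) (A_ n x) (A x); rewrite -(blinB (bA n)) in h3.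
have h4 := AM n (x_ n - x).
have : M * rnorm (x_ n - x) < e / 2.
  by rewrite -ltr_pdivlMl// mulrC -mulrA -invfM.
lra.
Qed.

Lemma Mres_cvg_seq (x_ : nat -> L) x : x_ @ \oo --> x -> (fun k => Mres k (x_ k)) @ \oo --> x.
Proof.
have M4 : 0 < 4 :> R by [].
exact: (@cvg_equibounded (fun k => Mres k) id 4 _ _ M4 Mres_bop Mres_bound (@Mres_cvg x)).
Qed.

Lemma Mrho_Mres j k x : Mrho k (Mres j x) = Mres k (Mrho j x).
Proof.
rewrite (Mmul _ (brho k) (bres j)) (Mmul _ (bres k) (brho j)); congr (Mop _ x); apply/funext => g.
by rewrite /cutoff mulrAC mulrC mulrA [X in X * _]mulrC.
Qed.

(** sigma is unbounded, hence not an operator [Mop]. On functions supported in K the bounded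
    multiplier 1_K sigma stands in for it. *)
Lemma wt_truncation (K : set G) : compact K ->
  exists2 tau : G -> R, mbounded tau & forall g, K g -> tau g = @wt R G l g.
Proof.
move=> cK; have [M M0 KM] := wt_compact cK.
exists (fun g => \1_K (g : borel G) * wt (l := l) g); last by move=> g Kg; rewrite indicE mem_set ?mul1r.
have mK : measurable (K : set (borel G)) by exact: compact_borel.
split.
  by apply: measurable_funM; [exact: measurable_indic|exact: wt_measurable].
exists M => g; rewrite indicE; case: (boolP (g \in _)) => [|_]; last by rewrite mul0r normr0 ltW.
by rewrite inE mul1r => Kg; rewrite ger0_norm ?KM// ltW// wt_gt0.
Qed.

Lemma truncation_class tau (K : set G) u : mbounded tau -> (forall g, K g -> tau g = @wt R G l g) ->
  Cc u -> (forall g, ~ K g -> u g = 0) ->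
  L2_class (Mop tau (L2_of L u)) (fun g => (1 + l g)%:C *: u g).
Proof.
move=> bt tK cu uK.
have -> : (fun g => (1 + l g)%:C *: u g) = (fun g => (tau g)%:C *: u g); last exact: Mop_class.
apply/funext => g; have [Kg|nKg] := pselect (K g); first by rewrite tK.
by rewrite uK// !scaler0.
Qed.

Lemma Mres_truncation tau (K : set G) u k : mbounded tau -> (forall g, K g -> tau g = @wt R G l g) ->
  Cc u -> (forall g, ~ K g -> u g = 0) ->
  Mres k (Mop tau (L2_of L u)) = Mrho k (L2_of L u).
Proof.
move=> bt tK cu uK; rewrite (Mmul _ (bres k) bt).
apply: (Mop_eq_support G_hausdorff G_lc mu_haar L (mboundedM (bres k) bt) (brho k) cu uK).
by move=> g Kg; rewrite tK// mulrC.
Qed.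

(** Formally, the resolvent is applied to w = sigma v. The graph may only be tested with C_c
    functions, and the resolvent of such a function need not be continuous; it is therefore
    approximated by f_n u with f_n continuous. *)
Lemma sigma_graph_resolvent v w k : sigma_graph l v w -> Mrho k v = Mres k w.
Proof.
move=> vw; apply: inner_L2_eq => u cu; rewrite -!Mop_sym//.
have [K cK uK] := Cc_support cu; have [tau bt tK] := wt_truncation cK.
have [mr _] := bres k.
have [z [zc [f [cf _ fz _]]]] :=
  mult_exists G_hausdorff G_lc mu_haar L mr ltr01 (resolvent_norm l_length k) cu cK uK.
have ez : z = Mres k (L2_of L u) by apply: (L2_class_unique zc); exact: Mop_class.
rewrite {}ez in fz.
have fu n : Cc (fun g => (f n g)%:C *: u g) by exact: Cc_scale.
have fuK n g : ~ K g -> (f n g)%:C *: u g = 0 by move=> nK; rewrite uK// scaler0.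
have e n : inner (Mop tau (L2_of L (fun g => (f n g)%:C *: u g))) v =
    inner (L2_of L (fun g => (f n g)%:C *: u g)) w.
  have [z' hz' <-] := vw _ (fu n); congr inner.
  exact: (L2_class_unique (truncation_class bt tK (fu n) (fuK n)) hz').
apply: (@cvg_rnorm_unique _ _ _ \oo _
    (fun n => inner (L2_of L (fun g => (f n g)%:C *: u g)) w)).
  under eq_fun do rewrite -e.
  apply: cvg_inner; last exact: cvg_cst.
  rewrite -(Mres_truncation _ bt tK cu uK) (Mmul _ (bres k) bt).
  under [fun g => _ * _]eq_fun do rewrite mulrC.
  by rewrite -(Mmul _ bt (bres k)); apply: cvg_bop; first exact: Mop_bop.
by apply: cvg_inner => //; exact: cvg_cst.
Qed.

(** The pairing of rho_k u with x_k tends to that of sigma u with x, because rho_k u is the k-th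
    resolvent of the fixed vector sigma u; by symmetry it also tends to the pairing of u with w. The
    vectors x_k may vary, as needed for [is_D_strong_lim]. *)
Lemma sigma_graph_lim (x_ : nat -> L) x w : x_ @ \oo --> x ->
  (fun k => Mrho k (x_ k)) @ \oo --> w -> sigma_graph l x w.
Proof.
move=> xx xw u cu; have [K cK uK] := Cc_support cu; have [tau bt tK] := wt_truncation cK.
exists (Mop tau (L2_of L u)); first exact: (truncation_class bt tK cu uK).
apply: (@cvg_rnorm_unique _ _ _ \oo _ (fun k => inner (Mrho k (L2_of L u)) (x_ k))).
  apply: cvg_inner => //.
  under eq_fun do rewrite -(Mres_truncation _ bt tK cu uK).
  exact: Mres_cvg.
under eq_fun do rewrite Mop_sym//.
by apply: cvg_inner => //; exact: cvg_cst.
Qed.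

(* [sigma] is the strong limit of the bounded multipliers [rho k = sigma / (1 + eps k * sigma)]. *)
Lemma sigma_graphP v w : sigma_graph l v w <-> (fun k => Mrho k v) @ \oo --> w.
Proof.
split=> [vw|]; last by apply: sigma_graph_lim; exact: cvg_cst.
by under eq_fun do rewrite (sigma_graph_resolvent _ vw); exact: Mres_cvg.
Qed.

(** The vector representing sigma u does not depend on n, so the defining identity passes to the
    limit. *)
Lemma sigma_graph_closed (v_ w_ : nat -> L) v w : (forall n, sigma_graph l (v_ n) (w_ n)) ->
  v_ @ \oo --> v -> w_ @ \oo --> w -> sigma_graph l v w.
Proof.
move=> h vv ww u cu; have [z hz _] := h 0%N u cu; exists z => //.
apply: (@cvg_rnorm_unique _ _ _ \oo _ (fun n => inner z (v_ n))).
  by apply: cvg_inner => //; exact: cvg_cst.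
have -> : (fun n => inner z (v_ n)) = (fun n => inner (L2_of L u) (w_ n)).
  by apply/funext => n; have [z' /(L2_class_unique hz) <-] := h n u cu.
by apply: cvg_inner => //; exact: cvg_cst.
Qed.

(** Ranges of resolvents supply vectors of Dom(sigma) on which a commutator given by [is_D] can be
    evaluated. *)
Lemma sigma_graph_Mres j x : sigma_graph l (Mres j x) (Mrho j x).
Proof. by apply/sigma_graphP; under eq_fun do rewrite Mrho_Mres; exact: Mres_cvg. Qed.

Definition ad (tau : G -> R) A x : L := Mop tau (A x) - A (Mop tau x).

(** Evaluate C at the resolvent of x, whose image under sigma is rho_k x, and apply the resolvent
    again: the result is rho_k A r x - r A rho_k x with r the resolvent. Substituting r = 1 - eps_k
    rho_k, the two terms with rho_k A rho_k cancel. *)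
Lemma is_D_ad A C k x : bounded_op A -> is_D l A C ->
  ad (rho k) A x = Mres k (C (Mres k x)).
Proof.
move=> bA [bC AC]; have [w' h ->] := AC _ _ (sigma_graph_Mres k x).
rewrite (blinB (Mres_bop k)) -(sigma_graph_resolvent _ h) /ad.
have r y : Mres k y = y - (eps k : R)%:C *: Mrho k y.
  have -> : (eps k : R)%:C *: Mrho k y = y - Mres k y; last by rewrite subKr.
  rewrite -[X in _ = X - _](Mop1 G_hausdorff G_lc mu_haar) -(Mop_cst G_hausdorff G_lc mu_haar).
  rewrite (Mmul _ (mbounded_cst _) (brho k)) -(MopB G_hausdorff G_lc mu_haar _ (mbounded_cst 1) (bres k)).
  by congr (Mop _ y); apply/funext => g; exact: eps_cutoff.
rewrite (r x) (r (A (Mrho k x))) (blinB bA) (blinZ bA) (blinB (Mrho_bop k)) (blinZ (Mrho_bop k)).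
by rewrite opprB addrA subrK.
Qed.

(** Forwards, the commutator is C between two resolvents, which tend strongly to 1. Backwards, rho_k
    A v = [rho_k, A] v + A rho_k v converges for v in Dom(sigma), so A v lies in Dom(sigma). *)
Lemma is_D_adP A C : bounded_op A ->
  is_D l A C <-> bounded_op C /\ forall x, (fun k => ad (rho k) A x) @ \oo --> C x.
Proof.
move=> bA; split=> [AC|[bC AC]].
  have [bC _] := AC; split=> // x.
  under eq_fun do rewrite (is_D_ad _ _ bA AC).
  by apply: Mres_cvg_seq; apply: cvg_bop => //; exact: Mres_cvg.
split=> // v w /sigma_graphP vw; exists (C v + A w); last by rewrite addrK.
apply/sigma_graphP; have -> : (fun k => Mrho k (A v)) = (fun k => ad (rho k) A v + A (Mrho k v)).
  by apply/funext => k; rewrite /ad subrK.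
by apply: cvgD; [exact: AC|exact: cvg_bop].
Qed.

Lemma is_D_unique A C C' : bounded_op A -> is_D l A C -> is_D l A C' -> C = C'.
Proof.
move=> bA /(is_D_adP _ bA)[_ h] /(is_D_adP _ bA)[_ h']; apply/funext => x.
exact: (@cvg_rnorm_unique _ _ _ \oo _ _ _ _ (h x) (h' x)).
Qed.

Lemma Dop_eq A C : bounded_op A -> is_D l A C -> Dop l A = C.
Proof.
move=> bA AC; have h : is_D l A (Dop l A) by apply: (@xgetPex _ 0 (is_D l A)); exists C.
exact: (is_D_unique bA h AC).
Qed.

Lemma is_D_id : is_D l (@id L) (fun=> 0).
Proof.
apply/(is_D_adP _ (bop_id (E := L))); split; first exact: bop0.
by move=> x; under eq_fun do rewrite /ad subrr; exact: cvg_cst.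
Qed.

Lemma is_D_linear (j : R[i]) A A' C C' : bounded_op A -> bounded_op A' ->
  is_D l A C -> is_D l A' C' -> is_D l (fun x => j *: A x + A' x) (fun x => j *: C x + C' x).
Proof.
move=> bA bA' /(is_D_adP _ bA)[bC h] /(is_D_adP _ bA')[bC' h'].
apply/is_D_adP; first by apply: bopD => //; exact: bopZ.
split=> [|x]; first by apply: bopD => //; exact: bopZ.
have -> : (fun k => ad (rho k) (fun x => j *: A x + A' x) x) =
    (fun k => j *: ad (rho k) A x + ad (rho k) A' x).
  apply/funext => k; have b := Mrho_bop k.
  by rewrite /ad (blinD b) (blinZ b) scalerBr opprD addrACA.
by apply: cvgD => //; apply: cvgZr.
Qed.

Lemma is_D_comp A A' C C' : bounded_op A -> bounded_op A' ->
  is_D l A C -> is_D l A' C' -> is_D l (A \o A') (fun x => C (A' x) + A (C' x)).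
Proof.
move=> bA bA' /(is_D_adP _ bA)[bC h] /(is_D_adP _ bA')[bC' h'].
apply/is_D_adP; first exact: bop_comp.
split=> [|x]; first by apply: bopD; exact: bop_comp.
have -> : (fun k => ad (rho k) (A \o A') x) =
    (fun k => ad (rho k) A (A' x) + A (ad (rho k) A' x)).
  by apply/funext => k; rewrite /ad (blinB bA) /= addrA subrK.
by apply: cvgD => //; exact: cvg_bop.
Qed.

(* [[rho, A'] = - A' [rho, A] A'] for the inverse [A'] of [A]. *)
Lemma is_D_inv A A' C : bounded_op A -> bounded_op A' -> cancel A A' -> cancel A' A ->
  is_D l A C -> is_D l A' (fun x => - A' (C (A' x))).
Proof.
move=> bA bA' AK A'K /(is_D_adP _ bA)[bC h].
have bD : bounded_op (fun x => A' (C (A' x))) by apply: (bop_comp bA'); exact: (bop_comp bC).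
apply/is_D_adP => //; split; first exact: bopN.
move=> x; have -> : (fun k => ad (rho k) A' x) = (fun k => - A' (ad (rho k) A (A' x))).
  by apply/funext => k; rewrite /ad A'K (blinB bA') AK opprB.
by apply: cvgN; exact: cvg_bop.
Qed.

Lemma is_D_closed (A_ C_ : nat -> L -> L) A C : bounded_op C ->
  (forall n, is_D l (A_ n) (C_ n)) -> (forall x, (fun n => A_ n x) @ \oo --> A x) ->
  (forall x, (fun n => C_ n x) @ \oo --> C x) -> is_D l A C.
Proof.
move=> bC AC cA cC; split=> // v w vw; exists (C v + A w); last by rewrite addrK.
apply: (@sigma_graph_closed (fun n => A_ n v) (fun n => C_ n v + A_ n w)).
- by move=> n; have [_ h] := AC n; have [w' h' ->] := h _ _ vw; rewrite subrK.
- exact: cA.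
- by apply: cvgD; [exact: cC|exact: cA].
Qed.

(** The operators and the cutoffs move with the same index. This allows D^n to be a limit of n-fold
    commutators with rho_k, without iterated limits. *)
Lemma is_D_strong_lim (A_ : nat -> L -> L) A C (M : R) : 0 < M -> bounded_op C ->
  (forall n, bounded_op (A_ n)) -> (forall n y, rnorm (A_ n y) <= M * rnorm y) ->
  (forall x, (fun n => A_ n x) @ \oo --> A x) ->
  (forall x, (fun n => ad (rho n) (A_ n) x) @ \oo --> C x) -> is_D l A C.
Proof.
move=> M0 bC bA AM cA cC; split=> // v w /sigma_graphP vw.
exists (C v + A w); last by rewrite addrK.
apply: (sigma_graph_lim (cA v)).
have -> : (fun k => Mrho k (A_ k v)) = (fun k => ad (rho k) (A_ k) v + A_ k (Mrho k v)).
  by apply/funext => k; rewrite /ad subrK.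
apply: cvgD; first exact: cC.
exact: (@cvg_equibounded A_ A M _ _ M0 bA AM (cA w)).
Qed.

End Sigma.

Lemma expr_dist_bound {R : realType} (n : nat) (M : R) : 0 < M -> exists2 c : R, 0 < c &
  forall x y : R, `|x| <= M -> `|y| <= M -> `|x ^+ n - y ^+ n| <= c * `|x - y|.
Proof.
move=> M0; elim: n => [|n [c c0 IH]].
  by exists 1 => // x y _ _; rewrite subrr normr0 mul1r.
exists (M * c + M ^+ n) => [|x y xM yM]; first by rewrite addr_gt0 ?mulr_gt0// exprn_gt0.
have -> : x ^+ n.+1 - y ^+ n.+1 = x * (x ^+ n - y ^+ n) + y ^+ n * (x - y).
  by rewrite !exprS; ring.
rewrite (le_trans (ler_normD _ _))// !normrM mulrDl lerD//.
  by rewrite -mulrA ler_pM// IH.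
by rewrite ler_wpM2r// normrX lerXn2r// qualifE/= ltW.
Qed.

Lemma blin_sum {R : realType} {E : normedModType R[i]} (A : E -> E) (I : Type) (s : seq I)
    (c : I -> R[i]) (F : I -> E) : bounded_op A ->
  A (\sum_(p <- s) c p *: F p) = \sum_(p <- s) c p *: A (F p).
Proof.
move=> bA; elim: s => [|p s IH]; first by rewrite !big_nil (blin0 bA).
by rewrite !big_cons (blinD bA) (blinZ bA) IH.
Qed.

(** * Smoothness of compactly supported functions *)

Section SmoothElements.
Context {R : realType} {G : topologicalGroupType} {B : GCstarAlgebra R G}.
Hypothesis G_hausdorff : hausdorff_space G.
Hypothesis G_lc : locally_compact [set: G].
Context {mu : {measure set (borel G) -> \bar R}}.
Hypothesis mu_haar : is_haar mu.
Context (L : L2_completion mu B).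
Implicit Types (x : L) (A : L -> L) (tau : G -> R).

Local Notation S := (@Sop R G B mu L).
Local Notation M := (@Mop R G B mu L).

Definition adn tau n A : L -> L := iter n (ad tau) A.

Lemma adnS tau n A x : adn tau n.+1 A x = M tau (adn tau n A x) - adn tau n A (M tau x).
Proof. by []. Qed.

Lemma adn_bop tau n A : mbounded tau -> bounded_op A -> bounded_op (adn tau n A).
Proof.
move=> bt bA; elim: n => //= n IH.
have bM : bounded_op (M tau) by exact: Mop_bop.
by apply: bopB; exact: bop_comp.
Qed.

Definition increment tau g h : R := tau h - tau (g^-1 * h)%g.

Lemma mbounded_increment tau g n : mbounded tau -> mbounded (fun h => increment tau g h ^+ n).
Proof. by move=> bt; apply: mboundedX; apply: mboundedB => //; exact: mbounded_translate. Qed.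

Lemma adn_Sop tau n b g x : mbounded tau ->
  adn tau n (S b g) x = M (fun h => increment tau g h ^+ n) (S b g x).
Proof.
move=> bt; elim: n x => [|n IH] x.
  by under [fun h => _ ^+ 0]eq_fun do rewrite expr0; rewrite (Mop1 G_hausdorff G_lc mu_haar).
have bd := mbounded_increment g n bt; have bg := mbounded_translate g bt.
rewrite adnS !IH (Mop_shift G_hausdorff G_lc mu_haar _ _ _ bt).
rewrite (MopM G_hausdorff G_lc mu_haar _ bt bd) (MopM G_hausdorff G_lc mu_haar _ bd bg).
rewrite -(MopB G_hausdorff G_lc mu_haar _ (mboundedM bt bd) (mboundedM bd bg)).
suff -> : (fun h => increment tau g h ^+ n.+1) = fun h =>
    tau h * increment tau g h ^+ n - increment tau g h ^+ n * tau (g^-1 * h)%g by [].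
by apply/funext => h; rewrite exprS mulrBl [X in _ - X]mulrC.
Qed.

Lemma adn_Rop tau n (a : G -> B) s x : mbounded tau ->
  adn tau n (@Rop R G B mu L a s) x =
  \sum_(p <- s) (fine (mu p.1))%:C *: M (fun h => increment tau p.2 h ^+ n) (S (a p.2) p.2 x).
Proof.
move=> bt; under eq_bigr do rewrite -adn_Sop//.
elim: n x => [//|n IH] x.
rewrite adnS !IH (blin_sum _ _ _ (Mop_bop G_hausdorff G_lc mu_haar L bt)) -sumrB.
by apply: eq_bigr => p _; rewrite adnS scalerBr.
Qed.

Lemma adn_cvg tau n (I : Type) (F : set_system I) {FF : Filter F} (A_ : I -> L -> L) A :
  mbounded tau -> (forall x, (fun i => A_ i x) @ F --> A x) ->
  forall x, (fun i => adn tau n (A_ i) x) @ F --> adn tau n A x.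
Proof.
move=> bt cA; elim: n => [//|n IH] x; apply: cvgB; last exact: IH.
by apply: cvg_bop; [exact: Mop_bop|exact: IH].
Qed.

Context (a : G -> B) (T : L -> L).
Hypothesis ca : Cc a.
Hypothesis aT : is_lambda L a T.

Lemma lambda_bop : bounded_op T. Proof. by case: aT. Qed.

Lemma adn_lambda_cvg (K : set G) tau n x : compact K -> (forall g, ~ K g -> a g = 0) -> mbounded tau ->
  (fun s => adn tau n (@Rop R G B mu L a s) x) @ partition_filter K --> adn tau n T x.
Proof.
move=> cK aK bt.
have [T' aT' T'lim] := lambda_limit G_hausdorff mu_haar L ca cK aK.
rewrite (lambda_unique aT aT'); apply: adn_cvg => //.
exact: partition_filter_proper.
Qed.

Let near_tagged (K : set G) : \forall s \near partition_filter K, tagged_partition K (fun=> setT) s.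
Proof. by exists (fun=> setT) => // x _; exact: filterT. Qed.

Context {l : G -> R}.
Hypothesis l_length : is_length l.
Hypothesis l_meas : measurable_fun [set: borel G] (l : borel G -> R).
Hypothesis l_sym : forall g : G, l g = l (g^-1)%g.

(** The constant does not depend on tau: in the Riemann sums only g in the support of a occur, where
    the increments are at most the supremum of l. All cutoffs rho_k thus share it. *)
Lemma adn_lambda_bound n : exists2 C : R, 0 < C & forall tau, mbounded tau ->
  (forall g h, `|increment tau g h| <= l g) ->
  forall x, rnorm (adn tau n T x) <= C * rnorm x.
Proof.
have [K cK aK] := Cc_support ca; have [N N0 aN] := Cc_bounded ca.
have [M0 M00 lM] := length_bounded_compact G_hausdorff mu_haar l_length l_meas l_sym cK.
have m0 : 0 <= fine (mu K) by exact: fine_ge0.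
have Mn : 0 < M0 ^+ n by rewrite exprn_gt0.
(* Mass of K, bound of the multiplier given by the n-th power of the increment, and bound of the
   shifts. *)
exists (fine (mu K) * (4 * M0 ^+ n * (8 * N)) + 1).
  by rewrite ltr_wpDl// !mulr_ge0// ltW.
move=> tau bt tl x.
have PF := partition_filter_proper G_hausdorff cK; have lim := adn_lambda_cvg (n := n) (x := x) cK aK bt.
apply: (cvg_rnorm_le lim); apply: filterS (near_tagged K) => s ts; rewrite adn_Rop//.
apply: (@le_trans _ _ (fine (mu K) * (4 * M0 ^+ n * (8 * N * rnorm x)))); last first.
  by rewrite !mulrA mulrDl mul1r lerDl rnorm_ge0.
apply: (tagged_sum_bound G_hausdorff mu_haar cK ts); first by rewrite !mulr_ge0 ?rnorm_ge0 ?ltW.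
move=> p Kp; apply: (le_trans (Mop_bound G_hausdorff G_lc mu_haar _ (mbounded_increment p.2 n bt) Mn _)).
  by move=> h; rewrite normrX lerXn2r ?qualifE/= ?(ltW M00)// (le_trans (tl _ _))// lM.
by rewrite ler_wpM2l ?mulr_ge0 ?(ltW Mn)// Sop_bound.
Qed.

Local Notation rho := (@cutoff R G l).
Let brho k : mbounded (rho k). Proof. exact: mbounded_cutoff. Qed.

(** Each of the four cutoff values is compared with sigma, which is at most P at both points. *)
Lemma increment_cutoff_dist (P : R) j k g h : wt (l := l) h <= P -> wt (l := l) (g^-1 * h)%g <= P ->
  `|increment (rho j) g h - increment (rho k) g h| <= 2 * (P ^+ 2 * (eps j + eps k)).
Proof.
move=> h1 h2.
have e m y : wt (l := l) y <= P -> `|rho m y - wt (l := l) y| <= eps m * P ^+ 2.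
  move=> yP; rewrite (le_trans (cutoff_dist l_length _ _))// ler_wpM2l ?(ltW (eps_gt0 _))//.
  by rewrite lerXn2r// ?qualifE/= ?(le_trans _ yP)// ltW// wt_gt0.
have := e j _ h1; have := e k _ h1; have := e j _ h2; have := e k _ h2.
rewrite /increment !ler_norml; lra.
Qed.

(** On each shift the two commutators differ by multiplication with a difference of n-th powers of
    increments. It acts on functions supported in K K', where both increments are close to that of
    sigma. *)
Lemma adn_lambda_cauchy n u : Cc u ->
  exists y : L, (fun k => adn (rho k) n T (L2_of L u)) @ \oo --> y.
Proof.
move=> cu; apply: cauchy_seq_cvg => e e0.
have [K cK aK] := Cc_support ca; have [N N0 aN] := Cc_bounded ca.
have [K' cK' uK'] := Cc_support cu.
have cH := compact_mulset cK cK'.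
have [M0 M00 lM] := length_bounded_compact G_hausdorff mu_haar l_length l_meas l_sym cK.
have [P P0 HP] := wt_compact G_hausdorff mu_haar l_length l_meas l_sym cH.
have [c c0 hc] := expr_dist_bound n M00.
have m0 : 0 <= fine (mu K) by exact: fine_ge0.
(* P bounds sigma at h in K K'. The point g^-1 h may leave that set, but sigma changes by at most l
   g <= M0 there. *)
pose Q := P + M0; have Q0 : 0 < Q by exact: addr_gt0.
pose d j k : R := c * (2 * (Q ^+ 2 * (eps j + eps k))).
have d0 j k : 0 < d j k by rewrite !mulr_gt0 ?exprn_gt0// addr_gt0// eps_gt0.
have est j k : rnorm (adn (rho j) n T (L2_of L u) - adn (rho k) n T (L2_of L u)) <=
    fine (mu K) * (4 * d j k * (8 * N * rnorm (L2_of L u))).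
  have PF := partition_filter_proper G_hausdorff cK.
  have lim := cvgB (adn_lambda_cvg (n := n) (x := L2_of L u) cK aK (brho j)) (adn_lambda_cvg (n := n) (x := L2_of L u) cK aK (brho k)).
  apply: (cvg_rnorm_le (lim _)); apply: filterS (near_tagged K) => s ts.
  rewrite -[X in rnorm X]/(_ - _) !adn_Rop// -sumrB; under eq_bigr do rewrite -scalerBr.
  apply: (tagged_sum_bound G_hausdorff mu_haar cK ts); first (apply: mulr_ge0).
  - by rewrite pmulr_rge0// ltW.
  - by rewrite !mulr_ge0 ?rnorm_ge0// ltW.
  move=> p Kp; have bj := mbounded_increment p.2 n (brho j); have bk := mbounded_increment p.2 n (brho k).
  rewrite -(MopB G_hausdorff G_lc mu_haar _ bj bk) [X in Mop _ X](Sop_Cc G_hausdorff mu_haar L _ _ cu).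
  have cs := Cc_shift G_hausdorff (a p.2) p.2 cu.
  apply: (le_trans (Mop_local_bound G_hausdorff G_lc mu_haar L (mboundedB bj bk) (d0 j k) cs cH _ _)).
  - by move=> h; exact: shift_out.
  - move=> h Hh.
    have lip m : `|increment (rho m) p.2 h| <= M0.
      by rewrite (le_trans (cutoff_lipschitz l_length l_sym _ _ _))// lM.
    rewrite (le_trans (hc _ _ (lip j) (lip k)))// ler_wpM2l ?(ltW c0)//.
    apply: increment_cutoff_dist; first by rewrite (le_trans (HP _ Hh))// lerDl ltW.
    have := wt_dist l_length l_sym p.2 h; have := HP _ Hh; have := lM _ Kp.
    by rewrite ler_norml /Q; lra.
  rewrite ler_pM2l; last exact: mulr_gt0.
  rewrite -[X in rnorm X <= _](Sop_Cc G_hausdorff mu_haar L _ _ cu).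
  exact: Sop_bound.
(* The bound of [est] with eps_j + eps_k replaced by 2, so that [est] reads (eps_j D + eps_k D) /
   2. *)
pose D : R := fine (mu K) * (4 * (c * (2 * (Q ^+ 2 * 2))) * (8 * N * rnorm (L2_of L u))).
have D0 : 0 <= D by rewrite !mulr_ge0 ?rnorm_ge0 ?exprn_ge0// ltW.
have [N1 _ hN] := eps_near D0 e0.
exists N1 => j k jN kN; apply: (le_lt_trans (est j k)).
have := hN j jN; have := hN k kN.
have -> : fine (mu K) * (4 * d j k * (8 * N * rnorm (L2_of L u))) =
   (eps j * D + eps k * D) / 2 by rewrite /d /D; field.
rewrite /=; lra.
Qed.

(** D_n is the strong limit of the n-fold commutators with rho_k. One more commutator with rho_k
    leads from those of order n to those of order n + 1, so [is_D_strong_lim] links D_n to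
    D_(n+1). *)
Lemma lambda_smooth : exists D : nat -> L -> L,
  [/\ D 0%N = T, forall n, bounded_op (D n) & forall n, is_D l (D n) (D n.+1)].
Proof.
have inc k g h : `|increment (rho k) g h| <= l g by exact: cutoff_lipschitz.
have bTn n k : bounded_op (adn (rho k) n T) by apply: adn_bop => //; exact: lambda_bop.
have /choice[D hD] : forall n, exists D : L -> L, bounded_op D /\
    forall x, (fun k => adn (rho k) n T x) @ \oo --> D x.
  move=> n; have [C C0 hC] := adn_lambda_bound n.
  have nb : \forall k \near \oo, bounded_op (adn (rho k) n T) /\
      forall x, rnorm (adn (rho k) n T x) <= C * rnorm x.
    by apply: nearW => k; split=> // x; exact: hC.
  have [u cu|D [bD _ cD]] := equibounded_lim G_hausdorff C0 nb; last by exists D.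
  exact: adn_lambda_cauchy.
exists D; split=> [|n|n]; last 2 first.
- by have [] := hD n.
- have [C C0 hC] := adn_lambda_bound n.
  apply: (is_D_strong_lim G_hausdorff G_lc mu_haar l_length l_meas l_sym C0 _ (bTn n)) => [|k x|x|x].
  + by have [] := hD n.+1.
  + exact: hC.
  + by have [_] := hD n; exact.
  + by have [_] := hD n.+1; exact.
apply/funext => x; have [_ h] := hD 0%N.
exact: (@cvg_rnorm_unique _ _ _ \oo _ _ _ _ (h x) (cvg_cst _)).
Qed.

End SmoothElements.

(** * The algebra of smooth operators *)

Section Derivations.
Context {R : realType} {G : topologicalGroupType} {B : GCstarAlgebra R G}.
Hypothesis G_hausdorff : hausdorff_space G.
Hypothesis G_lc : locally_compact [set: G].
Context {mu : {measure set (borel G) -> \bar R}}.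
Hypothesis mu_haar : is_haar mu.
Context (L : L2_completion mu B) {l : G -> R}.
Hypothesis l_length : is_length l.
Hypothesis l_meas : measurable_fun [set: borel G] (l : borel G -> R).
Hypothesis l_sym : forall g : G, l g = l (g^-1)%g.
Implicit Types (A C : L -> L).

Let Dop_eq A C : bounded_op A -> is_D l A C -> Dop l A = C.
Proof. exact: Dop_eq. Qed.

Lemma Dn_bounded_bop n A : Dn_bounded l n A -> bounded_op A.
Proof. by elim: n => // n IH [/IH]. Qed.

Lemma Dn_Sr n A : Dn l n.+1 A = Dn l n (Dop l A).
Proof. exact: iterSr. Qed.

(** The definition adds the outermost D last. Peeling off the innermost one instead suits inductions
    that apply the hypothesis to D(A). *)
Lemma Dn_boundedS n A : Dn_bounded l n.+1 A <->
  [/\ bounded_op A, is_D l A (Dop l A) & Dn_bounded l n (Dop l A)].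
Proof.
elim: n => [|n IH]; split.
- by move=> [bA [C hC]]; rewrite (Dop_eq bA hC); split=> //; case: hC.
- by move=> [bA hC _]; split=> //; exists (Dop l A).
- by move=> [/IH[bA hC hn] h]; split=> //; split=> //; rewrite -Dn_Sr.
- by move=> [bA hC [hn h]]; split; [apply/IH|rewrite Dn_Sr].
Qed.

Lemma Dn_bounded_intro n A C : bounded_op A -> is_D l A C -> Dn_bounded l n C ->
  Dn_bounded l n.+1 A /\ Dn l n.+1 A = Dn l n C.
Proof.
by move=> bA hC hn; rewrite Dn_Sr Dn_boundedS (Dop_eq bA hC).
Qed.

Lemma Dn_bounded_le m n A : (m <= n)%N -> Dn_bounded l n A -> Dn_bounded l m A.
Proof.
elim: n => [|n IH]; first by rewrite leqn0 => /eqP ->.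
by rewrite leq_eqVlt => /predU1P[->//|/IH h] [/h].
Qed.

Lemma Dn_bop n A : Dn_bounded l n A -> bounded_op (Dn l n A).
Proof. by elim: n A => // n IH A /Dn_boundedS[_ _ /IH]; rewrite Dn_Sr. Qed.

Lemma Dn_linear n (j : R[i]) A A' : Dn_bounded l n A -> Dn_bounded l n A' ->
  Dn_bounded l n (j *: A + A') /\ Dn l n (j *: A + A') = j *: Dn l n A + Dn l n A'.
Proof.
elim: n A A' => [|n IH] A A'.
  by move=> bA bA'; split=> //; apply: (bopD (A := j *: A)) => //; exact: (bopZ j).
move=> /Dn_boundedS[bA hA nA] /Dn_boundedS[bA' hA' nA'].
have [h1 h2] := IH _ _ nA nA'; rewrite (Dn_Sr n A) (Dn_Sr n A') -h2; apply: Dn_bounded_intro => //.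
  by apply: (bopD (A := j *: A)) => //; exact: (bopZ j).
exact: is_D_linear.
Qed.

Lemma is_D_0 : is_D l (0 : L -> L) 0.
Proof.
have h := is_D_id G_hausdorff G_lc mu_haar L l_length l_meas l_sym.
have := is_D_linear G_hausdorff G_lc mu_haar l_length l_meas l_sym (-1) (bop_id (E := L)) (bop_id (E := L)) h h.
have -> : (fun x : L => -1 *: x + x) = 0 by apply/funext => x; rewrite scaleN1r addNr.
by under eq_fun do rewrite scaler0 addr0.
Qed.

Lemma Dn_0 n : Dn_bounded l n (0 : L -> L) /\ Dn l n (0 : L -> L) = 0.
Proof.
elim: n => [|n [h e]]; first by split=> //; exact: bop0.
by have [] := Dn_bounded_intro (bop0 (E := L)) is_D_0 h; rewrite e.
Qed.

Lemma Dn_id n : Dn_bounded l n (@id L) /\ Dn l n (@id L) = if n is 0 then id else 0.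
Proof.
case: n => [|n]; first by split=> //; exact: bop_id.
have [h e] := Dn_0 n; rewrite -[X in _ = X]e; apply: Dn_bounded_intro => //; first exact: bop_id.
exact: is_D_id.
Qed.

(** The Leibniz rule mixes the orders up to n; their sum is monotone in n and submultiplicative up
    to a constant. *)
Definition seminorm_sum n A : R := \sum_(k < n.+1) opnorm (Dn l k A).

Lemma opnorm_le_sum n k A : (k <= n)%N -> Dn_bounded l n A -> opnorm (Dn l k A) <= seminorm_sum n A.
Proof.
move=> kn nA; rewrite /seminorm_sum (bigD1 (Ordinal (kn : (k < n.+1)%N)))//= lerDl sumr_ge0// => i _.
by apply/opnorm_ge0/Dn_bop; apply: (Dn_bounded_le _ nA); rewrite -ltnS.
Qed.

Lemma seminorm_sum_ge0 n A : Dn_bounded l n A -> 0 <= seminorm_sum n A.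
Proof.
move=> nA; apply: (le_trans (opnorm_ge0 _) (opnorm_le_sum (leq0n n) nA)).
exact: Dn_bounded_bop nA.
Qed.

Lemma seminorm_sum_le m n A : (m <= n)%N -> Dn_bounded l n A -> seminorm_sum m A <= seminorm_sum n A.
Proof.
move=> mn nA; rewrite /seminorm_sum (big_ord_widen n.+1 (fun k => opnorm (Dn l k A)))//.
rewrite big_mkcond ler_sum// => i _; case: ifP => // _.
by apply/opnorm_ge0/Dn_bop; apply: (Dn_bounded_le _ nA); rewrite -ltnS.
Qed.

Lemma seminorm_sum_Dop n A : Dn_bounded l n.+1 A -> seminorm_sum n (Dop l A) <= seminorm_sum n.+1 A.
Proof.
move=> /Dn_boundedS[bA _ _]; rewrite /seminorm_sum [leRHS]big_ord_recl.
under [X in _ <= _ + X]eq_bigr do rewrite Dn_Sr.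
by rewrite lerDr opnorm_ge0.
Qed.

Lemma seminorm_sum_bound n A (M : R) : (forall k, (k <= n)%N -> opnorm (Dn l k A) <= M) ->
  seminorm_sum n A <= n.+1%:R * M.
Proof.
move=> h; rewrite mulr_natl -[X in _ <= M *+ X]card_ord -sumr_const ler_sum// => i _.
by apply: h; rewrite -ltnS.
Qed.

(** D(A A') = D(A) A' + A D(A') is a sum of two products of lower order, hence one factor 2 for each
    order. Each factor of these products stays within the sum of seminorms of order n + 1. *)
Lemma Dn_comp n A A' : Dn_bounded l n A -> Dn_bounded l n A' ->
  Dn_bounded l n (A \o A') /\
  opnorm (Dn l n (A \o A')) <= 2 ^+ n * (seminorm_sum n A * seminorm_sum n A').
Proof.
elim: n A A' => [|n IH] A A' nA nA'.
  split; first exact: bop_comp.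
  by rewrite expr0 mul1r /seminorm_sum !big_ord1; exact: opnorm_comp.
have /Dn_boundedS[bA hA dA] := nA; have /Dn_boundedS[bA' hA' dA'] := nA'.
have [mA _] := nA; have [mA' _] := nA'.
have [h1 e1] := IH _ _ dA mA'; have [h2 e2] := IH _ _ mA dA'.
have [h e] := Dn_linear 1 h1 h2; rewrite !scale1r in h e.
have hD := is_D_comp G_hausdorff G_lc mu_haar l_length l_meas l_sym bA bA' hA hA'.
have [k ->] := Dn_bounded_intro (bop_comp bA bA') hD h; split=> //.
rewrite e (le_trans (opnormD (Dn_bop h1) (Dn_bop h2)))//.
have s0 := seminorm_sum_ge0.
rewrite exprS -mulrA mulrDl mul1r lerD// (le_trans e1, le_trans e2)//.
  rewrite ler_wpM2l// ler_pM ?s0//; [exact: seminorm_sum_Dop|exact: seminorm_sum_le].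
rewrite ler_wpM2l// ler_pM ?s0//; [exact: seminorm_sum_le|exact: seminorm_sum_Dop].
Qed.

Lemma seminorm_sum_comp n A A' : Dn_bounded l n A -> Dn_bounded l n A' ->
  seminorm_sum n (A \o A') <= n.+1%:R * 2 ^+ n * (seminorm_sum n A * seminorm_sum n A').
Proof.
move=> nA nA'; rewrite -mulrA; apply: seminorm_sum_bound => k kn.
have [kA kA'] := (Dn_bounded_le kn nA, Dn_bounded_le kn nA').
have [_ /le_trans] := Dn_comp kA kA'; apply.
apply: ler_pM => //; first by rewrite mulr_ge0// seminorm_sum_ge0.
  by rewrite ler_eXn2l// ltr1n.
by apply: ler_pM; rewrite ?seminorm_sum_ge0//; exact: seminorm_sum_le.
Qed.

Lemma Dn_inv n A A' : bounded_op A' -> cancel A A' -> cancel A' A ->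
  Dn_bounded l n A -> Dn_bounded l n A'.
Proof.
move=> bA' AK A'K; elim: n => // n IH nA.
have [mA _] := nA; have /Dn_boundedS[bA hA dA] := nA; have mA' := IH mA.
have hD := is_D_inv G_hausdorff G_lc mu_haar l_length l_meas l_sym bA bA' AK A'K hA.
(* By induction A' already has n bounded commutators, and the formula for D(A') involves only A' and
   D(A). *)
have [h _] := Dn_comp mA' (Dn_comp dA mA').1; have [h' _] := Dn_linear (-1) h (Dn_0 n).1.
rewrite scaleN1r addr0 in h'.
by have [] := Dn_bounded_intro bA' hD h'.
Qed.

End Derivations.

(** * Unitization and inversion *)

Section ComplexModulus.
Context {R : realType}.
Implicit Types (j k : R[i]).

Lemma Re_normM j k : complex.Re `|j * k| = complex.Re `|j| * complex.Re `|k|.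
Proof. by apply: (@complexI R); rewrite rmorphM /= !Re_normE normrM. Qed.

Lemma Re_normD j k : complex.Re `|j + k| <= complex.Re `|j| + complex.Re `|k|.
Proof. exact: (@ler_rnormD R R[i]^o). Qed.

Lemma Re_norm1 : complex.Re `|1 : R[i]| = 1.
Proof. by rewrite normr1. Qed.

Lemma Re_normV k : k != 0 -> complex.Re `|k^-1| = (complex.Re `|k|)^-1.
Proof.
move=> k0; have : complex.Re `|k^-1| * complex.Re `|k| = 1 by rewrite -Re_normM mulVf// Re_norm1.
by move=> h; apply: (@divr1_eq R); rewrite invrK.
Qed.

End ComplexModulus.

Section UnitizationOperators.
Context {R : realType} {E : normedModType R[i]}.
Implicit Types (x y : (E -> E) * R[i]) (A : set (E -> E)).

(** The action of the unitization on E. It is not faithful when the algebra contains the identity,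
    so statements about inverses carry the equation between scalars separately. *)
Definition opn x : E -> E := x.2 *: id + x.1.

Lemma opnE x v : opn x v = x.2 *: v + x.1 v. Proof. by []. Qed.

Lemma opnB x y : opn (x - y) = opn x - opn y.
Proof. by apply/funext => v; rewrite -[LHS]/((x.2 - y.2) *: v + (x.1 v - y.1 v)) scalerBl addrACA -opprD. Qed.

Lemma opn_inv x : x.1 = (- x.2) *: id + opn x.
Proof. by apply/funext => v; rewrite -[RHS]/(- x.2 *: v + (x.2 *: v + x.1 v)) scaleNr addKr. Qed.

Lemma opn_bop x : bounded_op x.1 -> bounded_op (opn x).
Proof. by move=> bx; apply: (bopD (A := x.2 *: id)) => //; apply: (bopZ x.2); exact: bop_id. Qed.

Lemma opn_umul x y : bounded_op x.1 -> opn (umul x y) = opn x \o opn y.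
Proof.
move=> bx; apply/funext => v.
rewrite -[LHS]/((x.2 * y.2) *: v + (x.1 (y.1 v) + y.2 *: x.1 v + x.2 *: y.1 v)).
rewrite /= !opnE (blinD bx) (blinZ bx) scalerDr scalerA -!addrA; congr (_ + _).
by rewrite addrC (addrC (y.2 *: _)) -addrA.
Qed.

Lemma umul_eq1 x y : bounded_op x.1 ->
  umul x y = uone E <-> cancel (opn y) (opn x) /\ x.2 * y.2 = 1.
Proof.
move=> bx; split=> [e|[e e2]].
  split; last by rewrite -[LHS]/((umul x y).2) e.
  move=> v; rewrite -[LHS]/((opn x \o opn y) v) -opn_umul// e.
  by rewrite opnE /= scale1r addr0.
have e1 : (umul x y).1 = 0.
  rewrite opn_inv opn_umul// [(umul x y).2]e2; apply/funext => v.
  by rewrite -[LHS]/(- 1 *: v + opn x (opn y v)) e scaleN1r addNr.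
by rewrite [umul x y]surjective_pairing e1 [(umul x y).2]e2.
Qed.

Lemma is_uinvP A x y : (forall S, A S -> bounded_op S) ->
  is_uinv A x y <->
  [/\ A x.1, A y.1, cancel (opn y) (opn x), cancel (opn x) (opn y) & x.2 * y.2 = 1].
Proof.
move=> bA; split=> [[Ax Ay]|[Ax Ay h1 h2 e]].
  by move=> /(umul_eq1 _ (bA _ Ax))[h1 e] /(umul_eq1 _ (bA _ Ay))[h2 _].
split=> //; first by apply/(umul_eq1 _ (bA _ Ax)).
by apply/(umul_eq1 _ (bA _ Ay)); split=> //; rewrite mulrC.
Qed.

End UnitizationOperators.

(** * Invertibility in the unitized reduced crossed product *)

Section CrossedProductAlgebra.
Context {R : realType} {G : topologicalGroupType} {B : GCstarAlgebra R G}.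
Hypothesis G_hausdorff : hausdorff_space G.
Hypothesis G_lc : locally_compact [set: G].
Context {mu : {measure set (borel G) -> \bar R}}.
Hypothesis mu_haar : is_haar mu.
Context (L : L2_completion mu B).
Implicit Types (F S T : L -> L) (x y z w : (L -> L) * R[i]).

Let Cr_lin (k : R[i]) S T : Crstar L S -> Crstar L T -> Crstar L (k *: S + T).
Proof. exact: Crstar_linear. Qed.

Let Cr_comp S T : Crstar L S -> Crstar L T -> Crstar L (S \o T).
Proof. exact: Crstar_comp. Qed.

Let Cr0 : Crstar L 0. Proof. exact: Crstar0. Qed.

(** The Neumann series without a unit: 1 + T is the inverse of 1 + F. Working with T keeps all
    iterates inside C_r^*, which is closed in norm. *)
Lemma Crstar_quasi_inverse F : Crstar L F -> opnorm F < 1 -> exists T,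
  [/\ Crstar L T, forall v, F v + T v + F (T v) = 0 & forall v, F v + T v + T (F v) = 0].
Proof.
move=> cF F1; have bF := Crstar_bop cF.
(* The iteration T |-> - (F + F T), spelled in the form accepted by [Crstar_linear]. *)
pose step T : L -> L := -1 *: (1 *: F + (F \o T)) + 0.
pose t n := iter n step 0.
have tS n v : t n.+1 v = - (F v + F (t n v)).
  by rewrite -[LHS]/(-1 *: (1 *: F v + F (t n v)) + 0) addr0 scaleN1r scale1r.
have ct n : Crstar L (t n).
  by elim: n => //= n IH; apply: Cr_lin => //; apply: Cr_lin => //; exact: Cr_comp.
have bt n : bounded_op (t n) by exact: Crstar_bop (ct n).
have comm n v : F (t n v) = t n (F v).
  elim: n v => [|n IH] v; first by rewrite /t /= (blin0 bF).
  by rewrite !tS (blinN bF) (blinD bF) IH.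
have F0 : 0 <= opnorm F by exact: opnorm_ge0.
have dt n : opnorm (t n - t n.+1) <= opnorm F * opnorm F ^+ n.
  elim: n => [|n IH].
    rewrite expr0 mulr1; apply: opnorm_le => // v.
    rewrite -[X in rnorm X]/(0 - t 1%N v) tS sub0r opprK (blin0 bF) addr0.
    exact: opnorm_bound.
  rewrite exprS; apply: opnorm_le => [|v]; first by rewrite !mulr_ge0// exprn_ge0.
  have -> : (t n.+1 - t n.+2) v = - F ((t n - t n.+1) v).
    rewrite -[LHS]/(t n.+1 v - t n.+2 v) -[X in F X]/(t n v - t n.+1 v) (tS n.+1) {1}tS (blinB bF).
    by rewrite opprK opprD addrACA addNr add0r opprB addrC.
  rewrite rnormN (le_trans (opnorm_bound _ bF))// -mulrA ler_wpM2l//.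
  rewrite (le_trans (opnorm_bound _ (bopB (bt n) (bt n.+1))))// ler_wpM2r ?rnorm_ge0//.
have [|T bT cT] := bop_complete bt.
  apply: (@geometric_cauchy R (fun m n => opnorm (t m - t n)) (opnorm F) (opnorm F)) => //.
  - by move=> n; rewrite subrr (opnorm0 (E := L)).
  - by move=> m n; rewrite -opprB (opnormN (bopB (bt n) (bt m))).
  - by move=> m n p; exact: opnorm_dist.
  - by rewrite F0.
have cT1 v : (fun n => t n v) @ \oo --> T v by exact: opnorm_cvg.
have e1 v : T v = - (F v + F (T v)).
  apply: (@cvg_rnorm_unique _ _ _ \oo _ (fun n => t n.+1 v)); first by rewrite (cvg_shiftS (fun n => t n v)).
  under eq_fun do rewrite tS; apply: cvgN; apply: cvgD; first exact: cvg_cst.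
  exact: cvg_bop.
have FT v : F (T v) = T (F v).
  apply: (@cvg_rnorm_unique _ _ _ \oo _ (fun n => F (t n v))); first exact: cvg_bop.
  by under eq_fun do rewrite comm; exact: cT1.
have e2 v : F v + T v + F (T v) = 0 by rewrite addrAC {2}e1 subrr.
exists T; split=> // [|v]; last by rewrite -FT.
apply: Crstar_closed => // e /cT [N _ hN]; exists (t N); first exact: ct.
by rewrite -opprB (opnormN (bopB (bt N) bT)); exact: hN N (leqnn N).
Qed.

Lemma Crstar_umul x y : Crstar L x.1 -> Crstar L y.1 -> Crstar L (umul x y).1.
Proof.
move=> cx cy; rewrite -[(umul x y).1]/(x.1 \o y.1 + y.2 *: x.1 + x.2 *: y.1) addrC.
by apply: Cr_lin => //; rewrite addrC; apply: Cr_lin => //; exact: Cr_comp.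
Qed.

(** With e = x - x0 and f = y0 e one has x = x0 (1 + f), so only 1 + f has to be inverted. Its
    scalar part s is split off and the Neumann series is applied to f.1 / s. *)
Lemma Crstar_uinv_near x0 y0 : is_uinv (Crstar L) x0 y0 -> exists2 d : R, 0 < d &
  forall x, Crstar L x.1 -> opnorm (x.1 - x0.1) + complex.Re `|x.2 - x0.2| < d ->
    uinvertible (Crstar L) x.
Proof.
move=> /(is_uinvP _ _ (fun S (h : Crstar L S) => Crstar_bop h))[cx0 cy0 h1 h2 e0].
have [bx0 by0] := (Crstar_bop cx0, Crstar_bop cy0).
pose c := opnorm y0.1 + complex.Re `|y0.2| + 1.
have y00 : 0 <= opnorm y0.1 by exact: opnorm_ge0.
have y02 := Re_norm_ge0 y0.2.
have c0 : 0 < c by rewrite ltr_wpDl// addr_ge0.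
(* Both components of f are then below 1/4, so |s| >= 3/4 and f.1 / s has norm below 1. *)
exists (4 * c)^-1 => [|x cx dx]; first by rewrite invr_gt0 mulr_gt0.
have bx := Crstar_bop cx; pose e := x - x0; pose f := umul y0 e.
have ce : Crstar L e.1 by rewrite /e /= addrC -scaleN1r; exact: Cr_lin.
have be := Crstar_bop ce.
have cf : Crstar L f.1 by exact: Crstar_umul.
have bf := Crstar_bop cf.
pose d := opnorm e.1 + complex.Re `|e.2|.
have [e1 e2] : 0 <= opnorm e.1 /\ 0 <= complex.Re `|e.2| by split; [exact: opnorm_ge0|exact: Re_norm_ge0].
have d4 : c * d < 1 / 4.
  rewrite -ltr_pdivlMl// mul1r -invfM mulrC; exact: dx.
have f1 : opnorm f.1 <= c * d.
  have bT : bounded_op (e.2 *: y0.1) by exact: (bopZ e.2).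
  have bT' : bounded_op (y0.2 *: e.1) by exact: (bopZ y0.2).
  have bc := bop_comp by0 be.
  have := opnormD (bopD bc bT) bT'; have := opnormD bc bT; have := opnorm_comp by0 be.
  rewrite !opnormZ// /c /d -[f.1]/(y0.1 \o e.1 + e.2 *: y0.1 + y0.2 *: e.1).
  nra.
have f2 : complex.Re `|f.2| <= c * d.
  rewrite -[f.2]/(y0.2 * e.2) Re_normM /c /d; nra.
pose s : R[i] := 1 + f.2.
have s34 : 3 / 4 <= complex.Re `|s|.
  have := Re_normD s (- f.2); rewrite /s addrK Re_norm1 normrN; lra.
have s0 : s != 0 by apply: contraTneq s34 => ->; rewrite normr0 -ltNge /=; lra.
have [||T [cT T1 T2]] := @Crstar_quasi_inverse (s^-1 *: f.1).
- by rewrite -[X in Crstar L X]addr0; exact: Cr_lin.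
- rewrite opnormZ// Re_normV// mulrC ltr_pdivrMr ?(lt_le_trans _ s34)//; lra.
(* z is the inverse of 1 + f = s (1 + f.1 / s), and z y0 that of x. *)
pose z : (L -> L) * R[i] := (s^-1 *: T, s^-1).
have cz : Crstar L z.1 by rewrite -[z.1]addr0; exact: Cr_lin.
have bz := Crstar_bop cz; have bT := Crstar_bop cT.
have bX0 := opn_bop bx0; have bz' := opn_bop bz.
have ef v : opn f v = opn y0 (opn e v) by rewrite /f opn_umul.
have hx v : opn x v = opn x0 (v + opn f v).
  rewrite (blinD bX0) ef h1 /e opnB -[(opn x - opn x0) v]/(opn x v - opn x0 v) addrC subrK//.
have vf v : v + opn f v = s *: (v + (s^-1 *: f.1) v).
  rewrite scalerDr -[(s^-1 *: f.1) v]/(s^-1 *: f.1 v) scalerA mulfV// scale1r opnE addrA.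
  by congr (_ + _); rewrite scalerDl scale1r.
have zE v : opn z v = s^-1 *: (v + T v) by rewrite scalerDr.
have k1 v : opn z (v + opn f v) = v.
  by rewrite zE vf (blinZ bT) -scalerDr scalerA mulVf// scale1r (blinD bT) -addrA (addrA ((s^-1 *: f.1) v)) T2 addr0.
have bF : bounded_op (s^-1 *: f.1) by exact: (bopZ s^-1 bf).
have k2 v : opn z v + opn f (opn z v) = v.
  rewrite vf zE (blinZ bF) -scalerDr scalerA mulfV// scale1r (blinD bF).
  by rewrite -addrA (addrA (T v)) (addrC (T v)) T1 addr0.
have es : s = y0.2 * x.2.
  by rewrite /s -[f.2]/(y0.2 * (x.2 - x0.2)) mulrBr (mulrC _ x0.2) e0 addrC subrK.
exists (umul z y0); apply/(is_uinvP _ _ (fun S (h : Crstar L S) => Crstar_bop h)); split=> //.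
- exact: Crstar_umul.
- by move=> v; rewrite opn_umul// hx /= k2 h1.
- by move=> v; rewrite opn_umul// hx /= h2 k1.
by rewrite -[(umul z y0).2]/(s^-1 * y0.2) mulrCA (mulrC x.2) -es mulVf.
Qed.

End CrossedProductAlgebra.

Lemma near_forall_le (P : nat -> nat -> Prop) N : (forall k, \forall n \near \oo, P k n) ->
  \forall n \near \oo, forall k, (k <= N)%N -> P k n.
Proof.
move=> h; elim: N => [|N IH].
  by have := h 0%N; apply: filterS => n Pn k; rewrite leqn0 => /eqP ->.
have := h N.+1; apply: filterS2 IH => n hn Pn k.
by rewrite leq_eqVlt => /predU1P[->//|]; exact: hn.
Qed.

Lemma small_factor {R : realType} (K e : R) : 0 <= K -> 0 < e -> exists2 d : R, 0 < d & d * K < e.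
Proof.
move=> K0 e0; have K1 : 0 < K + 1 by rewrite ltr_wpDl.
exists (e / (K + 1)); first by rewrite divr_gt0.
by rewrite mulrAC ltr_pdivrMr// ltr_pM2l// ltrDl.
Qed.

(** * The Frechet algebra of smooth elements and its inverses *)

Section SmoothAlgebra.
Context {R : realType} {G : topologicalGroupType} {B : GCstarAlgebra R G}.
Hypothesis G_hausdorff : hausdorff_space G.
Hypothesis G_lc : locally_compact [set: G].
Context {mu : {measure set (borel G) -> \bar R}}.
Hypothesis mu_haar : is_haar mu.
Context (L : L2_completion mu B) {l : G -> R}.
Hypothesis l_length : is_length l.
Hypothesis l_meas : measurable_fun [set: borel G] (l : borel G -> R).
Hypothesis l_sym : forall g : G, l g = l (g^-1)%g.
Implicit Types (S T : L -> L) (x y z w : (L -> L) * R[i]).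

Local Notation V := (Vinfty L l).
Local Notation p := (Vseminorm L l).
Local Notation Cr := (Crstar L).
Local Notation Q n A := (seminorm_sum (l := l) n A).
Local Notation cabs k := (complex.Re `|k|).

Let Dlin n (j : R[i]) S T : Dn_bounded l n S -> Dn_bounded l n T ->
  Dn_bounded l n (j *: S + T) /\ Dn l n (j *: S + T) = j *: Dn l n S + Dn l n T.
Proof. exact: Dn_linear. Qed.

Let Dbop n S : Dn_bounded l n S -> bounded_op (Dn l n S). Proof. exact: Dn_bop. Qed.

Let D0 n : Dn_bounded l n (0 : L -> L) /\ Dn l n (0 : L -> L) = 0. Proof. exact: Dn_0. Qed.

Let Q0 n S : Dn_bounded l n S -> 0 <= Q n S. Proof. exact: seminorm_sum_ge0. Qed.

Let pQ n k S : (k <= n)%N -> Dn_bounded l n S -> opnorm (Dn l k S) <= Q n S.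
Proof. exact: opnorm_le_sum. Qed.

Let Qbound n S (M : R) : (forall k, (k <= n)%N -> opnorm (Dn l k S) <= M) -> Q n S <= n.+1%:R * M.
Proof. exact: seminorm_sum_bound. Qed.

Let Dcomp n S T : Dn_bounded l n S -> Dn_bounded l n T -> Dn_bounded l n (S \o T).
Proof. by move=> hS hT; have [] := Dn_comp G_hausdorff G_lc mu_haar l_length l_meas l_sym hS hT. Qed.

Let mulc n : R := n.+1%:R * 2 ^+ n.

Let mulc0 n : 0 < mulc n. Proof. by rewrite mulr_gt0// exprn_gt0. Qed.

Let Qcomp n S T : Dn_bounded l n S -> Dn_bounded l n T -> Q n (S \o T) <= mulc n * (Q n S * Q n T).
Proof. exact: seminorm_sum_comp. Qed.

Lemma Dn_B n S T : Dn_bounded l n S -> Dn_bounded l n T ->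
  Dn_bounded l n (S - T) /\ Dn l n (S - T) = Dn l n S - Dn l n T.
Proof. by move=> hS hT; have := Dlin (-1) hT hS; rewrite !scaleN1r (addrC (- T)) (addrC (- Dn l n T)). Qed.

Lemma Dn_D n S T : Dn_bounded l n S -> Dn_bounded l n T ->
  Dn_bounded l n (S + T) /\ Dn l n (S + T) = Dn l n S + Dn l n T.
Proof. by move=> hS hT; have := Dlin 1 hS hT; rewrite !scale1r. Qed.

Lemma Dn_N n S : Dn_bounded l n S -> Dn_bounded l n (- S) /\ Dn l n (- S) = - Dn l n S.
Proof. by move=> hS; have := Dn_B (D0 n).1 hS; rewrite !sub0r (D0 n).2 sub0r. Qed.

Lemma seminorm_sumN n S : Dn_bounded l n S -> Q n (- S) = Q n S.
Proof.
move=> hS; apply: eq_bigr => k _; have kS : Dn_bounded l k S by apply: (Dn_bounded_le _ hS); rewrite -ltnS.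
by rewrite (Dn_N kS).2 opnormN//; exact: Dbop.
Qed.

Lemma seminorm_sum_dist n S T : Dn_bounded l n S -> Dn_bounded l n T ->
  Q n S <= Q n T + Q n (S - T).
Proof.
move=> hS hT; rewrite /seminorm_sum -big_split ler_sum// => k _.
have kn : (k <= n)%N by rewrite -ltnS.
have [kS kT] := (Dn_bounded_le kn hS, Dn_bounded_le kn hT).
have [h e] := Dn_B kS kT; have := opnormD (Dbop kT) (Dbop h).
by rewrite e addrCA subrr addr0.
Qed.

(** Identifies a sequence constructed by limits with the iterates of [Dop], which are given by a
    choice operator. *)
Lemma Dn_chain (D : nat -> L -> L) : (forall n, bounded_op (D n)) ->
  (forall n, is_D l (D n) (D n.+1)) -> forall n, Dn_bounded l n (D 0%N) /\ Dn l n (D 0%N) = D n.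
Proof.
move=> bD hD; elim=> [|n [h e]]; first by split; first exact: bD.
split; first by split=> //; exists (D n.+1); rewrite e.
rewrite -[LHS]/(Dop l (Dn l n (D 0%N))) e.
exact: (Dop_eq G_hausdorff G_lc mu_haar l_length l_meas l_sym (bD n) (hD n)).
Qed.

Lemma Vinfty_linear (j : R[i]) S T : V S -> V T -> V (j *: S + T).
Proof.
move=> [cS hS] [cT hT]; split; first exact: Crstar_linear.
by move=> n; have [] := Dlin j (hS n) (hT n).
Qed.

Lemma Vinfty0 : V 0.
Proof. by split; [exact: Crstar0|move=> n; have [] := D0 n]. Qed.

Lemma Vinfty_comp S T : V S -> V T -> V (S \o T).
Proof.
move=> [cS hS] [cT hT]; split; first exact: Crstar_comp.
by move=> n; exact: Dcomp.
Qed.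

Lemma Vseminorm_is_seminorm n : is_seminorm V (p n).
Proof.
split=> [S [_ hS]|S T [_ hS] [_ hT]|j S [_ hS]]; rewrite /Vseminorm.
- exact/opnorm_ge0/Dbop.
- by have [_ ->] := Dn_D (hS n) (hT n); apply: opnormD; exact: Dbop.
have [_] := Dlin j (hS n) (D0 n).1; rewrite (D0 n).2 !addr0 => ->.
exact/opnormZ/Dbop.
Qed.

(** For each k the operators D^k(u_n) converge in norm to some D_k. As D is closed, D_(k+1) is D of
    D_k, so D_0 is smooth and is the limit in every seminorm. *)
Lemma Vinfty_complete (u : nat -> L -> L) : (forall n, V (u n)) ->
  (forall k (e : R), 0 < e -> exists N, forall m n,
     (N <= m)%N -> (N <= n)%N -> p k (u m - u n) < e) ->
  exists2 S, V S & (u @ \oo) `=>` seminorm_nbhs V p S.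
Proof.
move=> Vu hu; have hD n k : Dn_bounded l k (u n) by have [_] := Vu n.
have bD n k := Dbop (hD n k).
have /choice[D hDlim] : forall k, exists D : L -> L, bounded_op D /\
    forall e : R, 0 < e -> \forall n \near \oo, opnorm (Dn l k (u n) - D) < e.
  move=> k; have [e e0|D bDk hDk] := bop_complete (fun n => bD n k); last by exists D.
  have [N hN] := hu k e e0; exists N => m n Nm Nn.
  by have := hN m n Nm Nn; rewrite /Vseminorm (Dn_B (hD m k) (hD n k)).2.
have bDk k : bounded_op (D k) by have [] := hDlim k.
have cDk k v : (fun n => Dn l k (u n) v) @ \oo --> D k v.
  by have [_ h] := hDlim k; exact: (opnorm_cvg (A := fun n => Dn l k (u n)) (fun n => bD n k) (bDk k) h).
have isD k : is_D l (D k) (D k.+1).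
  apply: (is_D_closed (A_ := fun n => Dn l k (u n)) (C_ := fun n => Dn l k.+1 (u n))) => // n.
  have [_ [C hC]] := hD n k.+1.
  by rewrite -[Dn l k.+1 (u n)]/(Dop l (Dn l k (u n))) (Dop_eq G_hausdorff G_lc mu_haar l_length l_meas l_sym (bD n k) hC).
have DnD := Dn_chain bDk isD.
have VD : V (D 0%N).
  split; last by move=> k; have [] := DnD k.
  apply: Crstar_closed => // e e0; have [_ /(_ e e0)[N _ hN]] := hDlim 0%N.
  exists (u N); first by have [] := Vu N.
  by rewrite -opprB (opnormN (bopB (bD N 0%N) (bDk 0%N))); exact: (hN N (leqnn N)).
exists (D 0%N) => // U [[N e] /= e0 hU].
have : \forall n \near \oo, forall k, (k <= N)%N -> opnorm (Dn l k (u n) - D k) < e.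
  by apply: near_forall_le => k; have [_] := hDlim k; exact.
apply: filterS => n hn; apply: hU; split=> // k kN.
by rewrite /Vseminorm (Dn_B (hD n k) (DnD k).1).2 (DnD k).2; exact: hn.
Qed.

Lemma Vinfty_frechet_space : frechet_space V p.
Proof.
split.
- by split; [exact: Vinfty0|move=> j S T; exact: Vinfty_linear].
- exact: Vseminorm_is_seminorm.
- by move=> S [_ hS] pS; apply: opnorm_eq0 (pS 0%N); exact: (hS 0%N).
- exact: Vinfty_complete.
Qed.

Lemma Vinfty_comp_continuous S T : V S -> V T ->
  ((fun z : (L -> L) * (L -> L) => z.1 \o z.2) @
     filter_prod (seminorm_nbhs V p S) (seminorm_nbhs V p T))
  `=>` seminorm_nbhs V p (S \o T).
Proof.
move=> VS VT U [[N e] /= e0 hU].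
have [cS hS] := VS; have [cT hT] := VT; have [qS qT] := (Q0 (hS N), Q0 (hT N)).
have n0 : 0 < N.+1%:R :> R by [].
have c0 := mulc0 N.
(* Collects the coefficients of d in the bounds for (S' - S) T' and S (T' - T). The condition d K <
   1 gives d <= 1, which bounds T' in terms of T. *)
pose K : R := 1 + mulc N * N.+1%:R * (Q N T + N.+1%:R + Q N S).
have K1 : 0 <= mulc N * N.+1%:R * (Q N T + N.+1%:R + Q N S).
  by rewrite !mulr_ge0 ?addr_ge0// ltW.
have [||d d0 dK] := @small_factor R K (Num.min 1 e); [by rewrite addr_ge0|by rewrite lt_min ltr01|].
move: dK; rewrite lt_min /K mulrDr mulr1 => /andP[dK1 dKe].
have d1 : d <= 1.
  by apply: le_trans (ltW dK1); rewrite lerDl mulr_ge0// ltW.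
pose nb A := [set A' | V A' /\ forall k, (k <= N)%N -> p k (A' - A) < d].
exists (nb S, nb T); first by split; exists (N, d).
move=> [S' T'] /= [[VS' dS] [VT' dT]]; apply: hU; split; first exact: Vinfty_comp.
have [cS' hS'] := VS'; have [cT' hT'] := VT'.
have [bS _] := Dn_B (hS' N) (hS N); have [bT _] := Dn_B (hT' N) (hT N).
have qSd : Q N (S' - S) <= N.+1%:R * d by apply: Qbound => k kN; exact/ltW/dS.
have qTd : Q N (T' - T) <= N.+1%:R * d by apply: Qbound => k kN; exact/ltW/dT.
have qT' : Q N T' <= Q N T + N.+1%:R * d.
  by rewrite (le_trans (seminorm_sum_dist (hT' N) (hT N)))// lerD2l.
have eq : (S' \o T') - (S \o T) = ((S' - S) \o T') + (S \o (T' - T)).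
  apply/funext => v; rewrite -[LHS]/(S' (T' v) - S (T v)).
  by rewrite -[RHS]/((S' (T' v) - S (T' v)) + S (T' v - T v)) (blinB (hS 0%N)) addrA subrK.
move=> k kN; have h1 := Dcomp bS (hT' N); have h2 := Dcomp (hS N) bT.
rewrite eq /Vseminorm (Dn_D (Dn_bounded_le kN h1) (Dn_bounded_le kN h2)).2.
apply: (le_lt_trans (opnormD (Dbop (Dn_bounded_le kN h1)) (Dbop (Dn_bounded_le kN h2)))).
apply: (@le_lt_trans _ _ (mulc N * (N.+1%:R * d * (Q N T + N.+1%:R)) + mulc N * (Q N S * (N.+1%:R * d)))).
  apply: lerD.
    rewrite (le_trans (pQ kN h1))// (le_trans (Qcomp bS (hT' N)))// ler_pM2l// ler_pM ?Q0//.
    by rewrite (le_trans qT')// lerD2l ler_piMr.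
  by rewrite (le_trans (pQ kN h2))// (le_trans (Qcomp (hS N) bT))// ler_pM2l// ler_wpM2l.
apply: le_lt_trans dKe; rewrite -subr_ge0.
set a := mulc N; set b := N.+1%:R; set q := Q N T; set q' := Q N S.
have -> : d + d * (a * b * (q + b + q')) - (a * (b * d * (q + b)) + a * (q' * (b * d))) = d by ring.
exact: ltW.
Qed.

Lemma Vinfty_frechet_algebra : frechet_algebra V p (fun S T => S \o T).
Proof.
split; [exact: Vinfty_frechet_space|exact: Vinfty_comp|by []| |exact: Vinfty_comp_continuous].
move=> j S T U VS VT [_ /(_ 0%N) bU]; split=> //; apply/funext => v.
by rewrite -[LHS]/(U (j *: S v + T v)) (blinD bU) (blinZ bU).
Qed.

Lemma lambda_Vinfty a T : Cc a -> is_lambda L a T -> V T.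
Proof.
move=> ca lT; split; first exact: Crstar_lambda lT.
have [D [D00 bD hD]] := lambda_smooth G_hausdorff G_lc mu_haar ca lT l_length l_meas l_sym.
by move=> n; rewrite -D00; have [] := Dn_chain bD hD n.
Qed.

Lemma Cc_Vinfty a : Cc a -> exists2 T, is_lambda L a T & V T.
Proof.
move=> ca; have [K cK aK] := Cc_support ca.
have [T lT _] := lambda_limit G_hausdorff mu_haar L ca cK aK.
by exists T => //; exact: lambda_Vinfty lT.
Qed.

Lemma Vinfty_dense S : Cr S -> forall U, seminorm_nbhs Cr (fun=> @opnorm R L) S U -> V `&` U !=set0.
Proof.
move=> [bS hS] U [[N e] /= e0 hU]; have [a [T [ca lT ST]]] := hS e e0.
exists T; split; first exact: lambda_Vinfty lT.
have bT : bounded_op T by case: lT.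
apply: hU; split; first exact: Crstar_lambda lT.
by move=> k _; rewrite -opprB (opnormN (bopB bS bT)).
Qed.

Lemma Vinfty_bop S : V S -> bounded_op S. Proof. by case=> _ /(_ 0%N). Qed.

Lemma opn_Dn n x : Dn_bounded l n x.1 ->
  Dn_bounded l n (opn x) /\ opnorm (Dn l n (opn x)) <= opnorm (Dn l n x.1) + cabs x.2.
Proof.
move=> hx; have [hid e] := Dn_id G_hausdorff G_lc mu_haar L l_length l_meas l_sym n.
have [h ->] := Dlin x.2 hid hx; split=> //.
have bi := Dbop hid; have bx := Dbop hx.
apply: (le_trans (opnormD (bopZ x.2 bi) bx)); rewrite opnormZ// addrC lerD2l ler_piMr ?Re_norm_ge0//.
rewrite e; case: (n) => [|m]; last by rewrite (opnorm0 (E := L)).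
by apply: opnorm_le => // v; rewrite mul1r.
Qed.

(** Converse of [opn_Dn], obtained from it: x.1 is the operator of the pair with entries [opn x] and
    minus the scalar of x. *)
Lemma Dn_opn n x : Dn_bounded l n (opn x) ->
  Dn_bounded l n x.1 /\ opnorm (Dn l n x.1) <= opnorm (Dn l n (opn x)) + cabs x.2.
Proof.
move=> hx; have := @opn_Dn n (opn x, - x.2) hx.
by rewrite -[X in Dn_bounded l n X /\ _]opn_inv -[X in _ /\ opnorm (Dn l n X) <= _]opn_inv normrN.
Qed.

(** Spectral invariance: the operator of y inverts that of x, hence is smooth by [Dn_inv], and y.1
    differs from it by a scalar. *)
Lemma Vinfty_uinv x y : V x.1 -> is_uinv Cr x y -> is_uinv V x y.
Proof.
move=> Vx xy; have [cx cy e1 e2] := xy; split=> //; split=> // n.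
have /(is_uinvP _ _ (fun S (h : Cr S) => Crstar_bop h))[_ _ h1 h2 _] := xy.
have by0 : bounded_op (opn y) by apply: opn_bop; exact: Crstar_bop.
have [_ hx] := Vx; have [hx' _] := opn_Dn (hx n).
by have [] := Dn_opn (Dn_inv G_hausdorff G_lc mu_haar l_length l_meas l_sym by0 h2 h1 hx').
Qed.

Lemma Vinfty_uinvertible x : V x.1 -> uinvertible V x <-> uinvertible Cr x.
Proof.
move=> Vx; split=> [[y [[cx _] [cy _] e1 e2]]|[y xy]]; exists y => //; exact: Vinfty_uinv.
Qed.

(** Since invertibility can be tested in C_r^*, the seminorm of order 0 alone determines a suitable
    neighbourhood. *)
Lemma Vinfty_uinvertible_open : seminorm_open (unitization V) (useminorm p) (uinvertible V).
Proof.
split=> [x [y []]//|x0 ix0]; have Vx0 : V x0.1 by have [y []] := ix0.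
have [y0 /(Crstar_uinv_near G_hausdorff mu_haar)[d d0 hd]] := (Vinfty_uinvertible Vx0).1 ix0.
exists (0%N, d) => // x [Vx /(_ 0%N isT) dx]; apply/(Vinfty_uinvertible Vx).
by apply: hd; [case: Vx|exact: dx].
Qed.

(** The estimate of y - y0 = - y (x - x0) y0 contains y itself. It is therefore used twice: first to
    bound y by twice y0, then to bound the difference. *)
Lemma Vinfty_uinv_continuous x0 y0 N (e : R) : is_uinv V x0 y0 -> 0 < e -> exists2 d : R, 0 < d &
  forall x y, is_uinv V x y -> (forall k, (k <= N)%N -> useminorm p k (x - x0) < d) ->
    forall k, (k <= N)%N -> useminorm p k (y - y0) < e.
Proof.
move=> /(is_uinvP _ _ Vinfty_bop)[[_ hx0] [_ hy0] h1 h2 e0] e_gt0.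
have [hY0 _] := opn_Dn (hy0 N); have [hX0 _] := opn_Dn (hx0 N).
set q := Q N (opn y0); have q0 : 0 <= q by exact: Q0.
set a := cabs y0.2; have a0 : 0 <= a by exact: Re_norm_ge0.
have c0 := mulc0 N; pose c := mulc N ^+ 2 * N.+1%:R; have cp : 0 < c by rewrite mulr_gt0// exprn_gt0.
(* The first two terms make d c q and d a smaller than 1/2, which gives the bounds 2 q and 2 a for y
   and its scalar. The third bounds the operator part; the last counts the scalar part twice, once
   from [Dn_opn] and once from [useminorm]. *)
have K0 : 0 <= 2 * (c * q) + 2 * a + (c * (2 * q) * q) + 4 * a * a.
  by rewrite !addr_ge0// !mulr_ge0// ltW.
have [|d d0 dK] := small_factor K0 (e := Num.min 1 e); first by rewrite lt_min ltr01.
move: dK; rewrite lt_min => /andP[dK1 dKe].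
have dt (t : R) : 0 <= t -> 0 <= d * t by move=> t0; rewrite mulr_ge0// ltW.
have cq0 : 0 <= c * q by rewrite mulr_ge0// ltW.
have u1 := dt _ cq0; have u2 := dt _ a0.
have u3 : 0 <= d * (c * (2 * q) * q) by rewrite dt// !mulr_ge0// ltW.
have u4 : 0 <= d * (4 * a * a) by rewrite dt// !mulr_ge0.
exists d => // x y /(is_uinvP _ _ Vinfty_bop)[[cx hx] [cy hy] g1 g2 e1] dx.
have [hX _] := opn_Dn (hx N); have [hY _] := opn_Dn (hy N).
have bY : bounded_op (opn y) by apply: opn_bop; exact: (hy 0%N).
have [hE _] := Dn_B hX hX0.
have EYY : opn y - opn y0 = - (opn y \o ((opn x - opn x0) \o opn y0)).
  apply/funext => v; rewrite -[RHS]/(- opn y (opn x (opn y0 v) - opn x0 (opn y0 v))).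
  by rewrite h1 (blinB bY) g2 opprB.
have hEY := Dcomp hE hY0; have hYEY := Dcomp hY hEY.
have qE : Q N (opn x - opn x0) <= N.+1%:R * d.
  apply: Qbound => k kN; have kB := Dn_B (hx k) (hx0 k).
  by rewrite -opnB (le_trans (@opn_Dn k (x - x0) kB.1).2)// ltW// (dx k kN).
have qY0 := Q0 hY; have qE0 := Q0 hE.
have QB : Q N (opn y - opn y0) <= d * (c * q) * Q N (opn y).
  rewrite EYY seminorm_sumN// (le_trans (Qcomp hY hEY))//.
  rewrite (_ : d * (c * q) * _ = mulc N * (Q N (opn y) * (mulc N * (N.+1%:R * d * q)))).
    rewrite ler_pM2l// ler_wpM2l// (le_trans (Qcomp hE hY0))// ler_pM2l// ler_wpM2r//.
  by rewrite /c; ring.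
have qY : Q N (opn y) <= 2 * q.
  have := seminorm_sum_dist hY hY0; rewrite -/q; nra.
have ey : y.2 - y0.2 = - (y.2 * (x.2 - x0.2) * y0.2).
  by rewrite mulrBr (mulrC y.2) e1 mulrBl mul1r -mulrA e0 mulr1 opprB.
have xd : cabs (x.2 - x0.2) <= d.
  by apply: ltW; apply: le_lt_trans (dx 0%N isT); rewrite lerDr opnorm_ge0//; exact: (Dbop (Dn_B (hx 0%N) (hx0 0%N)).1).
have xd0 := Re_norm_ge0 (x.2 - x0.2); have b0 := Re_norm_ge0 y.2.
have yd : cabs (y.2 - y0.2) <= cabs y.2 * (d * a).
  by rewrite ey normrN !Re_normM -/a -mulrA ler_wpM2l// ler_wpM2r.
have ya : cabs y.2 <= 2 * a.
  have := Re_normD (y.2 - y0.2) y0.2; rewrite subrK -/a; nra.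
move=> k kN; have kB := Dn_B (hy k) (hy0 k).
have hB := Dn_B hY hY0.
have hk : Dn_bounded l k (opn (y - y0)) by have [] := @opn_Dn k (y - y0) kB.1.
have [_ hle] := Dn_opn hk; rewrite opnB in hle.
have := pQ kN hB.1.
rewrite /useminorm /Vseminorm; set P1 := opnorm (Dn l k (y - y0).1) in hle *.
rewrite -[(y - y0).2]/(y.2 - y0.2) in hle *.
have v1 : d * (c * q) * Q N (opn y) <= d * (c * (2 * q) * q).
  by rewrite [leRHS](_ : _ = d * (c * q) * (2 * q)); [rewrite ler_wpM2l|ring].
have v2 : cabs y.2 * (d * a) <= d * (2 * a * a).
  by rewrite [leRHS](_ : _ = 2 * a * (d * a)); [rewrite ler_wpM2r|ring].
have : d * (4 * a * a) = 2 * (d * (2 * a * a)) by ring.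
move: dKe; rewrite !mulrDr; have := dt _ cq0; lra.
Qed.

Lemma Vinfty_inclusion_continuous S : V S ->
  id @ seminorm_nbhs V p S `=>` seminorm_nbhs Cr (fun=> @opnorm R L) S.
Proof.
move=> VS U [[N e] /= e0 hU]; exists (0%N, e) => // T [VT hT]; apply: hU.
by split; [case: VT|move=> k _; exact: (hT 0%N)].
Qed.

End SmoothAlgebra.

Theorem theorem2p1 (R : realType) (G : topologicalGroupType)
    (G_hausdorff : hausdorff_space G)
    (G_lc : locally_compact [set: G])
    (G_sc : @second_countable G)
    (mu : {measure set (borel G) -> \bar R}) (mu_haar : is_haar mu)
    (B : GCstarAlgebra R G) (L : L2_completion mu B)
    (l : G -> R) (l_length : is_length l)
    (l_meas : measurable_fun [set: borel G] (l : borel G -> R))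
    (l_sym : forall g : G, l g = l (g^-1)%g) :
  let V := Vinfty L l in
  let p := Vseminorm L l in
  let Cr := Crstar L in
  let norm_nbhs := seminorm_nbhs Cr (fun=> @opnorm R L) in
  let Inv := uinvertible V in
  let V_unit_nbhs := seminorm_nbhs (unitization V) (useminorm p) in
  [/\ (* (a) *)
      frechet_algebra V p (fun S T => S \o T) /\
      (forall a : G -> B, Cc a -> exists2 T, is_lambda L a T & V T),
      (* (b) *)
      [/\ V `<=` Cr,
          forall x, V x -> id @ seminorm_nbhs V p x `=>` norm_nbhs x
        & forall x, Cr x -> forall U, norm_nbhs x U -> V `&` U !=set0],
      (* (c) *)
      seminorm_open (unitization V) (useminorm p) Inv /\
      (forall x, Inv x ->
         Inv (uinv V x) /\
         uinv V @ within Inv (V_unit_nbhs x) `=>` V_unit_nbhs (uinv V x))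
    & (* (d) *)
      forall x, unitization V x -> (Inv x <-> uinvertible Cr x)].
Proof.
split.
- split; first exact: Vinfty_frechet_algebra.
  by move=> a; exact: Cc_Vinfty.
- split=> [S []//||].
    by move=> S; exact: Vinfty_inclusion_continuous.
  by move=> S; exact: Vinfty_dense.
- split; first exact: Vinfty_uinvertible_open.
  (* On invertible elements [xget] returns an actual inverse, so its default value 0 does not
     occur. *)
  move=> x ix; have inv y : uinvertible (Vinfty L l) y -> is_uinv (Vinfty L l) y (uinv (Vinfty L l) y).
    by move=> [z yz]; apply: (@xgetPex _ 0 (is_uinv (Vinfty L l) y)); exists z.
  split; first by exists x; have [V1 V2 e1 e2] := inv _ ix; split.
  move=> U [[N e] /= e0 hU].
  have [d d0 hd] := Vinfty_uinv_continuous G_hausdorff G_lc mu_haar l_length l_meas l_sym N (inv _ ix) e0.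
  exists (N, d) => // y [Vy hy] iy; have yi := inv _ iy; apply: hU; split; first by case: yi.
  exact: (hd y _ yi hy).
- by move=> x Vx; exact: Vinfty_uinvertible.
Qed.
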